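(* Let $f(z)=z+\sum_{n\ge 2}a_nz^n$ belong to the class $C$ of normalized convex univalent functions. Then $a_n=O(n^{|a_2|-1})$ as $n\to\infty$, and $$|a_n|\le \exp\left(\frac{|a_2|^2-1}{2}\right),\qquad n\ge 2.$$ The order of growth is sharp: for every $\alpha\in[0,1]$ there exists $f\in C$ with $|a_2|=\alpha$ for which $a_n$ is not $o(n^{\alpha-1})$.
   Context: $\mathbb{D}$ is the open unit disk. $S$ is the class of univalent (injective holomorphic) functions $f(z)=z+\sum_{n=2}^\infty a_nz^n$ in $\mathbb{D}$. $C\subset S$ consists of those $f\in S$ whose range $f(\mathbb{D})$ is a convex set; for $f\in C$ one has $|a_2|\le 1$. *)

(* Defs.v *)
From Stdlib Require Import Reals.
From Coquelicot Require Import Coquelicot.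
Open Scope R_scope.

Definition unit_disk (z : C) : Prop := Cmod z < 1.

(* Functions on the disk are total functions [C -> C] whose values outside the
   disk are irrelevant: every notion below only looks at points of the disk. *)
Definition holomorphic_on_disk (f : C -> C) : Prop :=
  forall z : C, unit_disk z ->
    @ex_derive C_AbsRing C_NormedModule f z.

Definition injective_on_disk (f : C -> C) : Prop :=
  forall z w : C, unit_disk z -> unit_disk w -> f z = f w -> z = w.

(* f(z) = z + a_2 z^2 + a_3 z^3 + ... on the disk. *)
Definition normalized_expansion (f : C -> C) (a : nat -> C) : Prop :=
  a 0%nat = RtoC 0 /\ a 1%nat = RtoC 1 /\
  forall z : C, unit_disk z ->
    @is_pseries C_AbsRing C_NormedModule a z (f z).

Definition class_S (f : C -> C) : Prop :=
  holomorphic_on_disk f /\ injective_on_disk f /\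
  exists a : nat -> C, normalized_expansion f a.

Definition disk_range (f : C -> C) (w : C) : Prop :=
  exists z : C, unit_disk z /\ f z = w.

Definition convex_set (A : C -> Prop) : Prop :=
  forall (u v : C) (t : R), A u -> A v -> 0 <= t <= 1 ->
    A (RtoC (1 - t) * u + RtoC t * v)%C.

Definition class_C (f : C -> C) : Prop :=
  class_S f /\ convex_set (disk_range f).

(* u_n = O(g_n) as n -> oo. *)
Definition big_O (u : nat -> C) (g : nat -> R) : Prop :=
  exists M : R, eventually (fun n : nat => Cmod (u n) <= M * Rabs (g n)).

(* u_n = o(g_n) as n -> oo; [is_domin] takes the dominating function first. *)
Definition little_o (u : nat -> C) (g : nat -> R) : Prop :=
  @is_domin nat R_AbsRing C_AbsRing R_NormedModule C_NormedModule
    eventually g u.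

(* n^s with real exponent; [Rpower] is meaningless at n = 0, which the
   asymptotic notions above ignore. *)
Definition npow (s : R) (n : nat) : R := Rpower (INR n) s.

(* Main.v *)
Require Import Defs.
From Stdlib Require Import Reals Lra Lia Psatz Arith Classical ClassicalEpsilon.
From Coquelicot Require Import Coquelicot.
Open Scope R_scope.

(** For [f] convex and [t] real, the mean of [f(z e^{it})] and [f(z e^{-it})] lies
    in the range of [f], hence equals [f(F_t(z))] with [|F_t(z)| <= |z|] by
    Schwarz's lemma; letting [t -> 0] gives [Re p >= 0] for [p = 1 + z f''/f'],
    and then positivity of the Toeplitz forms of the Taylor coefficients of [p],
    in particular [|p_k| <= 2] and [p_1 = 2 a_2].

    Writing [f' = b^2] gives [n b_n = sum_k (p_k/2) b_(n-k)]. Cauchy-Schwarz turns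
    this recurrence into the Lebedev-Milin bound
    [sum_(k<n) |b_k|^2 <= n exp ((|a_2|^2 - 1)(1 - 1/n))], which dominates
    [n |a_n|].

    For the growth, Toeplitz positivity tested on [g = z f'], with two
    coefficients modified in the optimal way, bounds [|g_n|^2 + |g_(n+1)|^2] by
    [(1 + |a_2|) Q_n / n^2] up to lower order, where [Q_n = sum_(k<n) 4 k |g_k|^2];
    hence [Q_n = O(n^(2 + 2 |a_2|))].

    Sharpness is attained by [(((1+z)/(1-z))^al - 1) / (2 al)], which maps the
    disk onto a sector, and by its limit [(1/2) log ((1+z)/(1-z))] for [al = 0].

    The maximum principle only needs second-order Taylor expansions: compare
    [|H|^2 + e |z|^2] at a maximum with its mean over four nearby points. Smoothness is
    Caratheodory's: [H z = H c + (z - c) P z] with [P] smooth of one order less. *)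

(** The Lebedev-Milin bound alone never decays: its exponent stays bounded in [n], so the power
    [n^(|a_2| - 1)] needs a recursion in which [a_2] acts at every step. Varying a single
    coefficient of [g] in the Toeplitz form gives only [(n-1)^2 |g_n|^2 <= Q_n], hence
    [Q_n = O(n^4)], the rate that belongs to [|a_2| = 1]. The number [p_1 = 2 a_2] couples
    neighbouring coefficients, so two neighbours must be varied, and the resulting bound concerns a
    sum over two indices. The recursion therefore advances by two: [Q_(n+2) <= (1 + (4 + 4 |a_2|)/n
    + O(1/n^2)) Q_n]. The one-coefficient bound then turns the growth of [Q_n] into
    [g_n = O(n^|a_2|)]. Since the argument divides by [1 - |a_2|], the case [|a_2| = 1] is left to
    the exponential bound, which then reads [|a_n| <= 1].

    No integrals occur: Fourier coefficients on a circle are limits of averages over roots of unity,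
    and the maximum principle controls the aliasing. *)

Lemma Cmod_minus_sym (u v : C) : Cmod (u - v) = Cmod (v - u).
Proof. rewrite <- (Cmod_opp (u - v)). f_equal. ring. Qed.

Lemma Cmod_triangle_rev (u v : C) : Cmod u - Cmod v <= Cmod (u - v).
Proof.
  pose proof (Cmod_triangle (u - v) v) as H.
  replace (u - v + v)%C with u in H by ring. lra.
Qed.

Lemma Cmod_triangle_minus (u v : C) : Cmod (u - v) <= Cmod u + Cmod v.
Proof.
  pose proof (Cmod_triangle u (- v)%C) as H.
  rewrite Cmod_opp in H. exact H.
Qed.

Lemma Cmod_sqr (z : C) : Cmod z * Cmod z = fst z * fst z + snd z * snd z.
Proof. pose proof (Cmod2_alt z) as H. unfold Re, Im in H. lra. Qed.

Lemma Cmod_le_sqr (z : C) (M : R) :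
  0 <= M -> fst z * fst z + snd z * snd z <= M * M -> Cmod z <= M.
Proof.
  intros HM H. rewrite <- Cmod_sqr in H.
  pose proof (Cmod_ge_0 z). nra.
Qed.

Lemma Cminus_neq_0 (u v : C) : u <> v -> (u - v)%C <> 0.
Proof.
  intros H E. apply H.
  replace u with (u - v + v)%C by ring. rewrite E. ring.
Qed.

Lemma Cmod_pos (z : C) : z <> 0 -> 0 < Cmod z.
Proof. apply Cmod_gt_0. Qed.

Lemma Cmod_neq_0 (z : C) : 0 < Cmod z -> z <> 0.
Proof. intros H E. rewrite E, Cmod_0 in H. lra. Qed.

Lemma Cmod_0_minus (c : C) : Cmod (c - c) = 0.
Proof. replace (c - c)%C with (RtoC 0) by ring. apply Cmod_0. Qed.

(** * Local smoothness *)

Definition near (c : C) (P : C -> Prop) : Prop :=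
  exists d, 0 < d /\ forall z, Cmod (z - c) < d -> P z.

Lemma near_and (c : C) (P Q : C -> Prop) :
  near c P -> near c Q -> near c (fun z => P z /\ Q z).
Proof.
  intros [d [Hd HP]] [e [He HQ]]. exists (Rmin d e). split.
  - now apply Rmin_pos.
  - intros z Hz. split; [apply HP | apply HQ];
      (eapply Rlt_le_trans; [exact Hz|]); [apply Rmin_l | apply Rmin_r].
Qed.

Lemma near_imp (c : C) (P Q : C -> Prop) :
  (forall z, P z -> Q z) -> near c P -> near c Q.
Proof. intros HPQ [d [Hd HP]]. exists d. auto. Qed.

Lemma near_here (c : C) (P : C -> Prop) : near c P -> P c.
Proof. intros [d [Hd HP]]. apply HP. rewrite Cmod_0_minus. exact Hd. Qed.

Lemma near_true (c : C) (P : C -> Prop) : (forall z, P z) -> near c P.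
Proof. intros HP. exists 1. split; [lra | auto]. Qed.

Lemma near_open_ball (c c0 : C) (r : R) :
  Cmod (c - c0) < r -> near c (fun z => Cmod (z - c0) < r).
Proof.
  intros H. exists (r - Cmod (c - c0)). split; [lra|].
  intros z Hz. pose proof (Cmod_triangle (z - c) (c - c0)) as T.
  replace (z - c + (c - c0))%C with (z - c0)%C in T by ring. lra.
Qed.

Lemma near_disk (c : C) : unit_disk c -> near c unit_disk.
Proof.
  intros H. unfold unit_disk in *.
  apply near_imp with (P := fun z => Cmod (z - 0) < 1).
  - intros z. now replace (z - 0)%C with z by ring.
  - apply near_open_ball. now replace (c - 0)%C with c by ring.
Qed.

Definition cont_at (H : C -> C) (c : C) : Prop :=
  forall e, 0 < e -> near c (fun z => Cmod (H z - H c) < e).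

(** A condition at the single point [c]: unfolded, it gives a Taylor polynomial of degree [n] at [c]
    with error [o(|z-c|^n)] and asks nothing of derivatives at neighbouring points. Products,
    inverses, compositions and lifts through a univalent function then reduce to algebra on the
    factor [P]. *)
Fixpoint smooth (n : nat) (H : C -> C) (c : C) : Prop :=
  match n with
  | O => cont_at H c
  | S m => exists P, smooth m P c /\ near c (fun z => H z = H c + (z - c) * P z)%C
  end.

Lemma cont_at_ext (H K : C -> C) (c : C) :
  near c (fun z => H z = K z) -> cont_at H c -> cont_at K c.
Proof.
  intros E HH e He.
  pose proof (near_here _ _ E) as Ec; simpl in Ec.
  generalize (near_and _ _ _ E (HH e He)). apply near_imp.
  intros z [E1 E2]. rewrite <- E1, <- Ec. exact E2.
Qed.

Lemma smooth_ext (n : nat) (H K : C -> C) (c : C) :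
  near c (fun z => H z = K z) -> smooth n H c -> smooth n K c.
Proof.
  intros E. destruct n as [|n]; simpl.
  - now apply cont_at_ext.
  - intros [P [HP HE]]. exists P. split; [exact HP|].
    pose proof (near_here _ _ E) as Ec; simpl in Ec.
    generalize (near_and _ _ _ E HE). apply near_imp.
    intros z [E1 E2]. now rewrite <- E1, <- Ec.
Qed.

Lemma cont_at_bounded (H : C -> C) (c : C) :
  cont_at H c -> near c (fun z => Cmod (H z) < Cmod (H c) + 1).
Proof.
  intros HH. generalize (HH 1 Rlt_0_1). apply near_imp.
  intros z Hz. pose proof (Cmod_triangle_rev (H z) (H c)). lra.
Qed.

Lemma cont_at_nonzero (H : C -> C) (c : C) :
  cont_at H c -> H c <> 0 -> near c (fun z => Cmod (H c) / 2 < Cmod (H z)).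
Proof.
  intros HH H0. pose proof (Cmod_pos _ H0) as Hp.
  generalize (HH (Cmod (H c) / 2) ltac:(lra)). apply near_imp.
  intros z Hz. pose proof (Cmod_triangle_rev (H c) (H z)) as T.
  rewrite (Cmod_minus_sym (H c)) in T. lra.
Qed.

Lemma cont_at_const (k c : C) : cont_at (fun _ => k) c.
Proof.
  intros e He. apply near_true. intros z. now rewrite Cmod_0_minus.
Qed.

Lemma cont_at_id (c : C) : cont_at (fun z => z) c.
Proof. intros e He. exists e. auto. Qed.

Lemma cont_at_plus (H K : C -> C) (c : C) :
  cont_at H c -> cont_at K c -> cont_at (fun z => H z + K z)%C c.
Proof.
  intros HH HK e He.
  generalize (near_and _ _ _ (HH (e / 2) ltac:(lra)) (HK (e / 2) ltac:(lra))).
  apply near_imp. intros z [H1 H2].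
  replace (H z + K z - (H c + K c))%C with (H z - H c + (K z - K c))%C by ring.
  pose proof (Cmod_triangle (H z - H c) (K z - K c)). lra.
Qed.

Lemma cont_at_mult (H K : C -> C) (c : C) :
  cont_at H c -> cont_at K c -> cont_at (fun z => H z * K z)%C c.
Proof.
  intros HH HK e He.
  set (A := Cmod (H c) + 1). set (B := Cmod (K c) + 1).
  assert (HA : 0 < A) by (unfold A; pose proof (Cmod_ge_0 (H c)); lra).
  assert (HB : 0 < B) by (unfold B; pose proof (Cmod_ge_0 (K c)); lra).
  assert (H1 : 0 < e / (2 * A)) by (apply Rdiv_lt_0_compat; lra).
  assert (H2 : 0 < e / (2 * B)) by (apply Rdiv_lt_0_compat; lra).
  generalize (near_and _ _ _ (near_and _ _ _ (HH _ H2) (HK _ H1)) (cont_at_bounded _ _ HH)).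
  apply near_imp. intros z [[E1 E2] E3]. fold A in E3.
  replace (H z * K z - H c * K c)%C with (H z * (K z - K c) + (H z - H c) * K c)%C by ring.
  eapply Rle_lt_trans; [apply Cmod_triangle|]. rewrite !Cmod_mult.
  pose proof (Cmod_ge_0 (H z)). pose proof (Cmod_ge_0 (K z - K c)).
  pose proof (Cmod_ge_0 (K c)). pose proof (Cmod_ge_0 (H z - H c)).
  assert (Cmod (H z) * Cmod (K z - K c) < A * (e / (2 * A))).
  { apply Rle_lt_trans with (A * Cmod (K z - K c)).
    - apply Rmult_le_compat_r; lra.
    - apply Rmult_lt_compat_l; lra. }
  assert (Cmod (H z - H c) * Cmod (K c) <= e / (2 * B) * B).
  { apply Rmult_le_compat; try lra. unfold B. lra. }
  replace (A * (e / (2 * A))) with (e / 2) in * by (field; lra).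
  replace (e / (2 * B) * B) with (e / 2) in * by (field; lra). lra.
Qed.

Lemma cont_at_inv (H : C -> C) (c : C) :
  cont_at H c -> H c <> 0 -> cont_at (fun z => / H z)%C c.
Proof.
  intros HH H0 e He. pose proof (Cmod_pos _ H0) as Hp.
  set (m := Cmod (H c)) in *.
  assert (Hd : 0 < e * (m * m / 2)) by (apply Rmult_lt_0_compat; nra).
  generalize (near_and _ _ _ (HH _ Hd) (cont_at_nonzero _ _ HH H0)).
  apply near_imp. intros z [E1 E2]. fold m in E2.
  assert (Hz : H z <> 0) by (apply Cmod_neq_0; lra).
  replace (/ H z - / H c)%C with ((H c - H z) * / (H z * H c))%C by (field; auto).
  rewrite Cmod_mult, Cmod_inv, Cmod_mult by now apply Cmult_neq_0.
  fold m. rewrite Cmod_minus_sym.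
  apply Rmult_lt_reg_r with (Cmod (H z) * m); [nra|].
  rewrite Rmult_assoc, Rinv_l by nra. rewrite Rmult_1_r.
  eapply Rlt_le_trans; [exact E1|]. apply Rmult_le_compat_l; nra.
Qed.

Lemma cont_at_comp (H K : C -> C) (c : C) :
  cont_at H c -> cont_at K (H c) -> cont_at (fun z => K (H z)) c.
Proof.
  intros HH HK e He. destruct (HK e He) as [d [Hd HKd]].
  generalize (HH d Hd). apply near_imp. intros z Hz. now apply HKd.
Qed.

Lemma smooth_pred (n : nat) (H : C -> C) (c : C) : smooth (S n) H c -> smooth n H c.
Proof.
  revert H. induction n as [|n IH]; intros H [P [HP HE]].
  - simpl in *.
    apply cont_at_ext with (fun z => H c + (z - c) * P z)%C.
    + revert HE. now apply near_imp.
    + apply cont_at_plus; [apply cont_at_const|]. apply cont_at_mult; [|exact HP].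
      apply (cont_at_plus (fun z => z) (fun _ => - c)%C);
        [apply cont_at_id | apply cont_at_const].
  - exists P. split; [now apply IH | exact HE].
Qed.

Lemma smooth_cont (n : nat) (H : C -> C) (c : C) : smooth n H c -> cont_at H c.
Proof.
  revert H. induction n as [|n IH]; intros H; [easy|].
  intros HS. apply IH. now apply smooth_pred.
Qed.

Lemma smooth_const (n : nat) (k c : C) : smooth n (fun _ => k) c.
Proof.
  revert k. induction n as [|n IH]; intros k; [apply cont_at_const|].
  exists (fun _ => RtoC 0). split; [apply IH|]. apply near_true. intros z. ring.
Qed.

Lemma smooth_id (n : nat) (c : C) : smooth n (fun z => z) c.
Proof.
  destruct n as [|n]; [apply cont_at_id|].
  exists (fun _ => RtoC 1). split; [apply smooth_const|]. apply near_true. intros z. ring.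
Qed.

Lemma smooth_plus (n : nat) (H K : C -> C) (c : C) :
  smooth n H c -> smooth n K c -> smooth n (fun z => H z + K z)%C c.
Proof.
  revert H K. induction n as [|n IH]; intros H K; [apply cont_at_plus|].
  intros [P [HP HE]] [Q [HQ KE]]. exists (fun z => P z + Q z)%C.
  split; [now apply IH|]. generalize (near_and _ _ _ HE KE). apply near_imp.
  intros z [-> ->]. ring.
Qed.

Lemma smooth_mult (n : nat) (H K : C -> C) (c : C) :
  smooth n H c -> smooth n K c -> smooth n (fun z => H z * K z)%C c.
Proof.
  revert H K. induction n as [|n IH]; intros H K; [apply cont_at_mult|].
  intros HH HK. pose proof (smooth_pred _ _ _ HK) as HK'.
  destruct HH as [P [HP HE]]. destruct HK as [Q [HQ KE]].
  exists (fun z => P z * K z + H c * Q z)%C. split.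
  - apply smooth_plus; [now apply IH|]. apply IH; [apply smooth_const | exact HQ].
  - generalize (near_and _ _ _ HE KE). apply near_imp.
    intros z [-> E]. rewrite E. ring.
Qed.

Lemma smooth_inv (n : nat) (H : C -> C) (c : C) :
  smooth n H c -> H c <> 0 -> smooth n (fun z => / H z)%C c.
Proof.
  revert H. induction n as [|n IH]; intros H HH H0; [now apply cont_at_inv|].
  pose proof (IH _ (smooth_pred _ _ _ HH) H0) as HI.
  pose proof (cont_at_nonzero _ _ (smooth_cont _ _ _ HH) H0) as HN.
  destruct HH as [P [HP HE]].
  exists (fun z => (- / H c) * (P z * / H z))%C. split.
  - apply smooth_mult; [apply smooth_const|]. now apply smooth_mult.
  - generalize (near_and _ _ _ HE HN). apply near_imp. intros z [E Hz].
    assert (H z <> 0) by (apply Cmod_neq_0; pose proof (Cmod_ge_0 (H c)); lra).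
    replace (/ H c + (z - c) * (- / H c * (P z * / H z)))%C
      with (/ H c - ((z - c) * P z) * / H c * / H z)%C by ring.
    replace ((z - c) * P z)%C with (H z - H c)%C by (rewrite E; ring).
    field. auto.
Qed.

Lemma smooth_comp (n : nat) (H K : C -> C) (c : C) :
  smooth n H c -> smooth n K (H c) -> smooth n (fun z => K (H z)) c.
Proof.
  revert K. induction n as [|n IH]; intros K HH HK; [now apply cont_at_comp|].
  pose proof (smooth_pred _ _ _ HH) as HH'.
  pose proof (smooth_cont _ _ _ HH) as HC.
  destruct HH as [P [HP HE]]. destruct HK as [Q [HQ [d [Hd KE]]]].
  exists (fun z => P z * Q (H z))%C. split.
  - apply smooth_mult; [exact HP|]. now apply IH.
  - generalize (near_and _ _ _ HE (HC d Hd)). apply near_imp. intros z [E Hz].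
    rewrite (KE _ Hz). replace (H z - H c)%C with ((z - c) * P z)%C by (rewrite E; ring).
    ring.
Qed.

Lemma smooth_minus (n : nat) (H K : C -> C) (c : C) :
  smooth n H c -> smooth n K c -> smooth n (fun z => H z - K z)%C c.
Proof.
  intros HH HK. apply smooth_ext with (fun z => H z + (- RtoC 1) * K z)%C.
  - apply near_true. intros z. ring.
  - apply smooth_plus; [exact HH|]. apply smooth_mult; [apply smooth_const | exact HK].
Qed.

Lemma smooth_div (n : nat) (H K : C -> C) (c : C) :
  smooth n H c -> smooth n K c -> K c <> 0 -> smooth n (fun z => H z / K z)%C c.
Proof.
  intros HH HK H0. apply smooth_mult; [exact HH|]. now apply smooth_inv.
Qed.

(* The difference quotient keeps all but one order of smoothness at the base
   point, where it has to be filled in with the right value. *)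
Lemma smooth_quotient (n : nat) (H : C -> C) (w c l : C) :
  smooth (S n) H c ->
  (c = w -> exists P, smooth n P w /\ P w = l /\
     near w (fun z => H z = H w + (z - w) * P z)%C) ->
  smooth n (fun z => if Ceq_dec z w then l else (H z - H w) / (z - w))%C c.
Proof.
  intros HH HP. destruct (Ceq_dec c w) as [->|Hne].
  - destruct (HP eq_refl) as [P [HS [Hl HE]]].
    apply smooth_ext with P; [|exact HS].
    revert HE. apply near_imp. intros z E.
    destruct (Ceq_dec z w) as [->|Hz]; [exact Hl|].
    rewrite E. field. now apply Cminus_neq_0.
  - apply smooth_ext with (fun z => (H z - H w) / (z - w))%C.
    + exists (Cmod (c - w)). split; [apply Cmod_pos, Cminus_neq_0, Hne|].
      intros z Hz. destruct (Ceq_dec z w) as [->|]; [|reflexivity].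
      rewrite Cmod_minus_sym in Hz. lra.
    + apply smooth_div.
      * apply smooth_minus; [now apply smooth_pred | apply smooth_const].
      * apply smooth_minus; [apply smooth_id | apply smooth_const].
      * now apply Cminus_neq_0.
Qed.

(** * The maximum principle *)

Lemma choice_function (A B : Type) (P : A -> B -> Prop) :
  (forall x, exists y, P x y) -> exists f : A -> B, forall x, P x (f x).
Proof.
  intros H. exists (fun x => proj1_sig (constructive_indefinite_description _ (H x))).
  intros x. apply proj2_sig.
Qed.

(** Compactness in the one form needed: a property that persists when [d] shrinks and holds locally
    with a fixed [d] holds with one [d] on all of [K]. Boundedness of a continuous function uses
    [u z <= / d], attainment of its supremum uses [u z <= s - d]. *)
Lemma compact_uniform (K : C -> Prop) (P : C -> R -> Prop) (B : R) :
  (forall z, K z -> Cmod z <= B) ->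
  (forall z, ~ K z -> near z (fun w => ~ K w)) ->
  (forall z d e, P z d -> 0 < e <= d -> P z e) ->
  (forall z, K z -> exists d, 0 < d /\ forall w, K w -> Cmod (w - z) < d -> P w d) ->
  exists d, 0 < d /\ forall z, K z -> P z d.
Proof.
  intros HB Hclosed Hmono Hloc.
  assert (G : forall p : C, exists d : posreal, forall z, K z ->
            Rabs (fst z - fst p) < d -> Rabs (snd z - snd p) < d -> P z d).
  { intros p.
    assert (Hp : exists d, 0 < d /\ forall w, K w -> Cmod (w - p) < d -> P w d).
    { destruct (classic (K p)) as [HK|HK]; [now apply Hloc|].
      destruct (Hclosed _ HK) as [d [Hd HE]]. exists d. split; [exact Hd|].
      intros w Hw Hwd. exfalso. now apply (HE w). }
    destruct Hp as [d [Hd HE]].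
    assert (Hd2 : 0 < d / 2) by lra. exists (mkposreal _ Hd2). simpl.
    intros z Hz H1 H2. apply Hmono with d; [|lra]. apply HE; [exact Hz|].
    apply Rle_lt_trans with (Rabs (fst z - fst p) + Rabs (snd z - snd p)); [|lra].
    pose proof (Rabs_pos (fst z - fst p)). pose proof (Rabs_pos (snd z - snd p)).
    apply Cmod_le_sqr; [lra|].
    pose proof (Rsqr_abs (fst z - fst p)) as E1. pose proof (Rsqr_abs (snd z - snd p)) as E2.
    unfold Rsqr in E1, E2. simpl. unfold Rminus in *. rewrite E1, E2. nra. }
  destruct (choice_function _ _ _ G) as [dl Hdl].
  destruct (compactness_value_2d (-B) B (-B) B (fun x y => dl (x, y))) as [d Hd].
  exists d. split; [apply cond_pos|]. intros z Hz.
  pose proof (Rmax_Cmod z) as Hm. pose proof (HB z Hz) as Hb.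
  pose proof (Rmax_l (Rabs (fst z)) (Rabs (snd z))) as M1.
  pose proof (Rmax_r (Rabs (fst z)) (Rabs (snd z))) as M2.
  assert (Hx : -B <= fst z <= B) by (apply Rabs_le_between; lra).
  assert (Hy : -B <= snd z <= B) by (apply Rabs_le_between; lra).
  (* The gauge form of compactness provides its tag [(x, y)] only under a double negation, so the
     goal is negated first. *)
  apply NNPP. intros Hn. apply (Hd _ _ Hx Hy). intros [x [y [_ [_ [H1 [H2 H3]]]]]].
  apply Hn. apply Hmono with (dl (x, y)); [now apply (Hdl (x, y))|].
  split; [apply cond_pos | exact H3].
Qed.

Lemma compact_max (K : C -> Prop) (u : C -> R) (B : R) (z0 : C) :
  (forall z, K z -> Cmod z <= B) ->
  (forall z, ~ K z -> near z (fun w => ~ K w)) ->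
  (forall z e, K z -> 0 < e -> near z (fun w => Rabs (u w - u z) < e)) ->
  K z0 -> exists z, K z /\ forall w, K w -> u w <= u z.
Proof.
  intros HB Hclosed Hcont H0.
  assert (Hbdd : exists M, forall z, K z -> u z <= M).
  { destruct (compact_uniform K (fun z d => u z <= / d) B) as [d [Hd HE]]; auto.
    - intros z d e H He. apply Rle_trans with (/ d); [exact H|].
      apply Rinv_le_contravar; lra.
    - intros z Hz. destruct (Hcont z 1 Hz Rlt_0_1) as [d [Hd HE]].
      set (q := Rmax (u z + 1) 1).
      assert (Hq : 1 <= q) by apply Rmax_r.
      assert (Hq' : u z + 1 <= q) by apply Rmax_l.
      exists (Rmin d (/ q)).
      assert (Hp : 0 < Rmin d (/ q)).
      { apply Rmin_pos; [exact Hd | apply Rinv_0_lt_compat; lra]. }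
      split; [exact Hp|]. intros w Hw Hwz.
      assert (E : Rabs (u w - u z) < 1).
      { apply HE. eapply Rlt_le_trans; [exact Hwz | apply Rmin_l]. }
      apply Rabs_lt_between in E.
      apply Rle_trans with q; [lra|].
      pose proof (Rinv_le_contravar _ _ Hp (Rmin_r d (/ q))) as Hi.
      rewrite Rinv_inv in Hi. exact Hi.
    - now exists (/ d). }
  destruct (completeness (fun r => exists z, K z /\ r = u z)) as [s [Hs1 Hs2]].
  { destruct Hbdd as [M HM]. exists M. intros r [z [Hz ->]]. now apply HM. }
  { exists (u z0), z0. auto. }
  apply NNPP. intros Hno.
  assert (Hlt : forall z, K z -> u z < s).
  { intros z Hz. apply Rnot_le_lt. intros Hsz. apply Hno. exists z.
    split; [exact Hz|]. intros w Hw. apply Rle_trans with s; [|exact Hsz].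
    apply Hs1. now exists w. }
  (* If [s] is not attained, the pointwise [u z < s] becomes a uniform gap [d], which contradicts
     that [s] is the least upper bound. *)
  destruct (compact_uniform K (fun z d => u z <= s - d) B) as [d [Hd HE]]; auto.
  - intros z d e H He. lra.
  - intros z Hz. pose proof (Hlt _ Hz) as L.
    destruct (Hcont z ((s - u z) / 2) Hz ltac:(lra)) as [d [Hd HE]].
    exists (Rmin d ((s - u z) / 2)). split; [apply Rmin_pos; lra|].
    intros w Hw Hwz.
    assert (E : Rabs (u w - u z) < (s - u z) / 2).
    { apply HE. eapply Rlt_le_trans; [exact Hwz | apply Rmin_l]. }
    apply Rabs_lt_between in E.
    pose proof (Rmin_r d ((s - u z) / 2)). lra.
  - assert (s <= s - d); [|lra]. apply Hs2. intros r [z [Hz ->]]. now apply HE.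
Qed.

(** The flag [b] treats the circle and the closed disk together; stating [K] through an equation
    lets [eq_refl] instantiate it. *)
Lemma circle_compact (K : C -> Prop) (c : C) (r : R) (b : bool) :
  K = (fun z => if b then Cmod (z - c) = r else Cmod (z - c) <= r) ->
  (forall z, K z -> Cmod z <= r + Cmod c) /\
  (forall z, ~ K z -> near z (fun w => ~ K w)).
Proof.
  intros ->. split.
  - intros z Hz. pose proof (Cmod_triangle_rev z c). destruct b; lra.
  - intros z Hz.
    assert (Hfar : r < Cmod (z - c) \/ (b = true /\ Cmod (z - c) < r)).
    { destruct b; [|left; lra]. destruct (Rtotal_order (Cmod (z - c)) r) as [H|[H|H]];
        [right; auto | contradiction | left; lra]. }
    destruct Hfar as [H|[-> H]].
    + exists (Cmod (z - c) - r). split; [lra|]. intros w Hw Hk.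
      pose proof (Cmod_triangle (z - w) (w - c)) as T.
      replace (z - w + (w - c))%C with (z - c)%C in T by ring.
      rewrite (Cmod_minus_sym z w) in T. destruct b; lra.
    + exists (r - Cmod (z - c)). split; [lra|]. intros w Hw Hk.
      pose proof (Cmod_triangle (w - z) (z - c)) as T.
      replace (w - z + (z - c))%C with (w - c)%C in T by ring. lra.
Qed.

Lemma Cmod_cont (H : C -> C) (c : C) (e : R) :
  cont_at H c -> 0 < e -> near c (fun w => Rabs (Cmod (H w) - Cmod (H c)) < e).
Proof.
  intros HH He. generalize (HH e He). apply near_imp. intros z Hz.
  pose proof (Cmod_triangle_rev (H z) (H c)). pose proof (Cmod_triangle_rev (H c) (H z)) as T.
  rewrite (Cmod_minus_sym (H c)) in T. apply Rabs_lt_between. lra.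
Qed.

Lemma circle_bound (H : C -> C) (c : C) (r : R) :
  0 <= r -> (forall z, Cmod (z - c) = r -> cont_at H z) ->
  exists z, Cmod (z - c) = r /\ forall w, Cmod (w - c) = r -> Cmod (H w) <= Cmod (H z).
Proof.
  intros Hr HH.
  destruct (circle_compact _ c r true eq_refl) as [H1 H2].
  apply (compact_max _ (fun z => Cmod (H z)) _ (c + RtoC r)%C H1 H2).
  - intros z e Hz He. apply Cmod_cont; auto.
  - replace (c + RtoC r - c)%C with (RtoC r) by ring. rewrite Cmod_R. now apply Rabs_pos_eq.
Qed.

(* Averaging over the four directions [d * i^k] kills every cross term of a
   quadratic polynomial. *)
Lemma four_point_mean (h0 h1 h2 : C) (d : R) :
  let q w := Cmod (h0 + h1 * w + h2 * (w * w))%C in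
  4 * (Cmod h0 * Cmod h0) <=
  q (RtoC d) * q (RtoC d) + q (- RtoC d)%C * q (- RtoC d)%C +
  q (RtoC d * Ci)%C * q (RtoC d * Ci)%C + q (- RtoC d * Ci)%C * q (- RtoC d * Ci)%C.
Proof.
  intros q. unfold q. rewrite !Cmod_sqr.
  destruct h0 as [a b], h1 as [a1 b1], h2 as [a2 b2]. unfold RtoC, Ci. simpl.
  nra.
Qed.

Lemma smooth_taylor2 (H : C -> C) (c : C) :
  smooth 2 H c -> exists h1 h2, forall e, 0 < e ->
    near c (fun z => Cmod (H z - (H c + h1 * (z - c) + h2 * ((z - c) * (z - c)))) <=
                     e * Cmod (z - c) ^ 2).
Proof.
  intros [P [[Q [HQ PE]] HE]]. exists (P c), (Q c). intros e He.
  generalize (near_and _ _ _ (near_and _ _ _ PE HE) (HQ e He)). apply near_imp.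
  intros z [[E1 E2] E3]. rewrite E2, E1.
  replace (H c + (z - c) * (P c + (z - c) * Q z) -
    (H c + P c * (z - c) + Q c * ((z - c) * (z - c))))%C
    with ((Q z - Q c) * ((z - c) * (z - c)))%C by ring.
  rewrite !Cmod_mult. simpl. rewrite Rmult_1_r.
  apply Rmult_le_compat_r; [|lra]. apply Rmult_le_pos; apply Cmod_ge_0.
Qed.

Lemma maximum_principle (H : C -> C) (c : C) (r M : R) :
  0 <= M -> (forall z, Cmod (z - c) <= r -> smooth 2 H z) ->
  (forall z, Cmod (z - c) = r -> Cmod (H z) <= M) ->
  forall z, Cmod (z - c) <= r -> Cmod (H z) <= M.
Proof.
  intros HM HS HB z1 Hz1. apply Rnot_lt_le. intros Hlt.
  pose proof (Rle_trans _ _ _ (Cmod_ge_0 _) Hz1) as Hr.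
  set (m1 := Cmod (H z1)) in *.
  (* So small that [e r^2 < m1^2 - M^2]: on the boundary [u] stays below [u z1], and the maximum
     point of [u] is interior. *)
  set (e := (m1 * m1 - M * M) / (r * r + 1) / 2).
  assert (He : 0 < e).
  { unfold e. apply Rdiv_lt_0_compat; [apply Rdiv_lt_0_compat; nra | lra]. }
  assert (Her : e * (r * r) < m1 * m1 - M * M).
  { assert (E : e * (r * r + 1) * 2 = m1 * m1 - M * M) by (unfold e; field; nra). nra. }
  set (u := fun z => Cmod (H z) * Cmod (H z) + e * (Cmod (z - c) * Cmod (z - c))).
  destruct (circle_compact _ c r false eq_refl) as [K1 K2].
  destruct (compact_max _ u _ z1 K1 K2) as [s [Hs Hmax]]; [|exact Hz1|].
  { intros z d Hz Hd.
    assert (C1 : cont_at (fun w => RtoC (Cmod (H w))) z).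
    { intros f Hf. generalize (Cmod_cont _ _ f (smooth_cont _ _ _ (HS z Hz)) Hf).
      apply near_imp. intros w Hw. now rewrite <- RtoC_minus, Cmod_R. }
    assert (C2 : cont_at (fun w => RtoC (Cmod (w - c))) z).
    { intros f Hf.
      generalize (Cmod_cont (fun w => w - c)%C z f
        (smooth_cont 0 _ _ (smooth_minus 0 _ _ z (smooth_id 0 z) (smooth_const 0 c z))) Hf).
      apply near_imp. intros w Hw. now rewrite <- RtoC_minus, Cmod_R. }
    pose proof (cont_at_plus _ _ _ (cont_at_mult _ _ _ C1 C1)
      (cont_at_mult _ _ _ (cont_at_const (RtoC e) z) (cont_at_mult _ _ _ C2 C2))) as C3.
    generalize (C3 d Hd). apply near_imp. intros w Hw.
    rewrite <- !RtoC_mult, <- !RtoC_plus, <- RtoC_minus, Cmod_R in Hw. exact Hw. }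
  assert (Hus : M * M + e * (r * r) < u s).
  { apply Rlt_le_trans with (u z1); [|now apply Hmax]. unfold u. fold m1.
    pose proof (Cmod_ge_0 (z1 - c)). nra. }
  assert (Hin : Cmod (s - c) < r).
  { destruct (Rle_lt_or_eq_dec _ _ Hs) as [|E]; [assumption|exfalso].
    pose proof (HB s E). unfold u in Hus. rewrite E in Hus.
    pose proof (Cmod_ge_0 (H s)). nra. }
  destruct (smooth_taylor2 _ _ (HS s Hs)) as [h1 [h2 HT]].
  set (L := Cmod (H s) + Cmod h1 + Cmod h2 + 1).
  assert (HL : 1 <= L).
  { unfold L. pose proof (Cmod_ge_0 (H s)). pose proof (Cmod_ge_0 h1).
    pose proof (Cmod_ge_0 h2). lra. }
  (* [L] bounds the quadratic Taylor polynomial at distance at most 1. A Taylor error [k d^2] costs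
     at most [2 L k d^2 = e d^2 / 2] after squaring, less than the gain [e d^2] in the mean of
     [e |z - c|^2]. *)
  assert (Hk : 0 < e / (4 * L)) by (apply Rdiv_lt_0_compat; lra).
  destruct (near_and _ _ _ (HT _ Hk) (near_open_ball s c r Hin)) as [d0 [Hd0 HE]].
  set (k := e / (4 * L)) in *.
  set (d := Rmin (d0 / 2) 1).
  assert (Hd : 0 < d <= 1).
  { split; [apply Rmin_pos; lra | apply Rmin_r]. }
  assert (Hdd : d < d0).
  { unfold d. pose proof (Rmin_l (d0 / 2) 1). lra. }
  set (q := fun w => Cmod (H s + h1 * w + h2 * (w * w))%C).
  assert (Hw : forall w : C, Cmod w = d ->
    q w * q w - 2 * L * k * (d * d) +
      e * (Cmod (s - c + w) * Cmod (s - c + w)) <= u s).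
  { intros w Ew.
    destruct (HE (s + w)%C) as [T1 T2].
    { replace (s + w - s)%C with w by ring. lra. }
    apply Rle_trans with (u (s + w)%C); [|apply Hmax; lra].
    unfold u. replace (s + w - c)%C with (s - c + w)%C by ring.
    apply Rplus_le_compat_r.
    replace (s + w - s)%C with w in T1 by ring. rewrite Ew in T1.
    pose proof (Cmod_triangle_rev (H s + h1 * w + h2 * (w * w)) (H (s + w)%C)) as T3.
    rewrite (Cmod_minus_sym _ (H (s + w)%C)) in T3. fold (q w) in T3.
    assert (Hq : q w <= L).
    { unfold q. pose proof (Cmod_triangle (H s + h1 * w) (h2 * (w * w))) as T4.
      pose proof (Cmod_triangle (H s) (h1 * w)) as T5.
      rewrite !Cmod_mult, Ew in T4. rewrite Cmod_mult, Ew in T5. unfold L.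
      assert (Cmod h1 * d <= Cmod h1 * 1)
        by (apply Rmult_le_compat_l; [apply Cmod_ge_0 | apply Hd]).
      assert (Cmod h2 * (d * d) <= Cmod h2 * 1)
        by (apply Rmult_le_compat_l; [apply Cmod_ge_0 | nra]).
      lra. }
    assert (0 <= q w) by apply Cmod_ge_0.
    pose proof (Cmod_ge_0 (H (s + w)%C)).
    assert (E : 0 <= k * (d * d)) by nra.
    replace (d ^ 2) with (d * d) in T1 by ring.
    destruct (Rle_lt_dec (q w) (k * (d * d))).
    - nra.
    - nra. }
  assert (Ed : Cmod (RtoC d) = d) by (rewrite Cmod_R; apply Rabs_pos_eq; apply Rlt_le, Hd).
  pose proof (Hw (RtoC d) Ed) as W1.
  assert (Ed2 : Cmod (- RtoC d) = d) by (rewrite Cmod_opp; exact Ed).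
  assert (Ed3 : Cmod (RtoC d * Ci) = d) by (rewrite Cmod_mult, Cmod_Ci, Ed; ring).
  assert (Ed4 : Cmod (- RtoC d * Ci) = d) by (rewrite Cmod_mult, Cmod_Ci, Ed2; ring).
  pose proof (Hw _ Ed2) as W2. pose proof (Hw _ Ed3) as W3. pose proof (Hw _ Ed4) as W4.
  pose proof (four_point_mean (H s) h1 h2 d) as F. simpl in F. fold (q (RtoC d)) in F.
  fold (q (- RtoC d)%C) in F. fold (q (RtoC d * Ci)%C) in F. fold (q (- RtoC d * Ci)%C) in F.
  assert (S4 : Cmod (s - c + RtoC d) * Cmod (s - c + RtoC d) +
    Cmod (s - c + - RtoC d) * Cmod (s - c + - RtoC d) +
    Cmod (s - c + RtoC d * Ci) * Cmod (s - c + RtoC d * Ci) +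
    Cmod (s - c + - RtoC d * Ci) * Cmod (s - c + - RtoC d * Ci) =
    4 * (Cmod (s - c) * Cmod (s - c)) + 4 * (d * d)).
  { rewrite !Cmod_sqr. destruct (s - c)%C as [x y]. unfold RtoC, Ci. simpl. ring. }
  assert (Hus' : u s = Cmod (H s) * Cmod (H s) + e * (Cmod (s - c) * Cmod (s - c)))
    by reflexivity.
  assert (HkL : 2 * L * k = e / 2) by (unfold k; field; lra).
  rewrite HkL in *. apply (f_equal (Rmult e)) in S4.
  assert (0 < e * (d * d)) by (apply Rmult_lt_0_compat; nra).
  lra.
Qed.

(** * Injective smooth functions *)

(** The minimum of [|f z - f c|] is found as the maximum of the modulus of the reciprocal. *)
Lemma circle_separation (f : C -> C) (c : C) (r : R) :
  0 <= r -> (forall z, Cmod (z - c) = r -> smooth 2 f z) ->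
  (forall z, Cmod (z - c) = r -> f z <> f c) ->
  exists m, 0 < m /\ forall z, Cmod (z - c) = r -> m <= Cmod (f z - f c).
Proof.
  intros Hr HS HN.
  assert (HN' : forall z, Cmod (z - c) = r -> (f z - f c)%C <> 0)
    by (intros z Hz; apply Cminus_neq_0; auto).
  destruct (circle_bound (fun z => / (f z - f c))%C c r Hr) as [z [Hz Hmax]].
  { intros z Hz. apply (smooth_cont 2). apply smooth_inv; [|auto].
    apply smooth_minus; [auto | apply smooth_const]. }
  exists (Cmod (f z - f c)). split; [apply Cmod_pos; auto|].
  intros w Hw. specialize (Hmax w Hw). rewrite !Cmod_inv in Hmax by auto.
  rewrite <- (Rinv_inv (Cmod (f w - f c))), <- (Rinv_inv (Cmod (f z - f c))).
  apply Rinv_le_contravar; [|exact Hmax].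
  apply Rinv_0_lt_compat, Cmod_pos; auto.
Qed.

(** If a value [y] within [m/2] of [f c] were omitted, [1/(f - y)] would be at most [2/m] in modulus
    on the circle but larger than [2/m] at the centre, against the maximum principle. *)
Lemma open_mapping (f : C -> C) (c : C) (r : R) :
  0 < r -> (forall z, Cmod (z - c) <= r -> smooth 2 f z) ->
  (forall z, Cmod (z - c) = r -> f z <> f c) ->
  near (f c) (fun y => exists z, Cmod (z - c) < r /\ f z = y).
Proof.
  intros Hr HS HN.
  destruct (circle_separation f c r) as [m [Hm Hsep]]; auto; [lra | intros; apply HS; lra|].
  exists (m / 2). split; [lra|]. intros y Hy. apply NNPP. intros Hno.
  assert (Hb : forall z, Cmod (z - c) = r -> m / 2 <= Cmod (f z - y)).
  { intros z Hz. pose proof (Hsep z Hz) as S1.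
    pose proof (Cmod_triangle_rev (f z - f c) (y - f c)) as T.
    replace (f z - f c - (y - f c))%C with (f z - y)%C in T by ring. lra. }
  assert (H0 : forall z, Cmod (z - c) <= r -> (f z - y)%C <> 0).
  { intros z Hz E. destruct (Rle_lt_or_eq_dec _ _ Hz) as [L|L].
    - apply Hno. exists z. split; [exact L|].
      replace (f z) with (f z - y + y)%C by ring. rewrite E. ring.
    - pose proof (Hb z L) as B. rewrite E, Cmod_0 in B. lra. }
  assert (Hc : Cmod (c - c) <= r) by (rewrite Cmod_0_minus; lra).
  pose proof (maximum_principle (fun z => / (f z - y))%C c r (/ (m / 2))) as MP.
  assert (B : Cmod (/ (f c - y)) <= / (m / 2)).
  { apply MP; auto.
    - left. apply Rinv_0_lt_compat. lra.
    - intros z Hz. apply smooth_inv; [|auto].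
      apply smooth_minus; [auto | apply smooth_const].
    - intros z Hz. rewrite Cmod_inv by (apply H0; lra).
      apply Rinv_le_contravar; [lra | auto]. }
  rewrite Cmod_inv in B by auto.
  rewrite Cmod_minus_sym in Hy. apply (Rlt_not_le _ _ Hy).
  rewrite <- (Rinv_inv (Cmod (f c - y))), <- (Rinv_inv (m / 2)).
  apply Rinv_le_contravar; [|exact B]. apply Rinv_0_lt_compat, Cmod_pos; auto.
Qed.

Definition has_slope (n : nat) (f : C -> C) (c l : C) : Prop :=
  exists P, smooth n P c /\ P c = l /\ near c (fun z => f z = f c + (z - c) * P z)%C.

(* A Hurwitz argument: as [w -> c] the difference quotients [(f z - f w)/(z - w)],
   which never vanish, stay away from [0] on the circle, hence also at [z = c]. *)
Lemma injective_slope_nonzero (f : C -> C) (c : C) (r : R) (D : C -> C) :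
  0 < r -> (forall z, Cmod (z - c) <= r -> smooth 3 f z) ->
  (forall z w, Cmod (z - c) <= r -> Cmod (w - c) <= r -> f z = f w -> z = w) ->
  (forall z, Cmod (z - c) <= r -> has_slope 2 f z (D z)) ->
  (forall d, 0 < d -> exists w, Cmod (w - c) < d /\ D w <> 0) ->
  D c <> 0.
Proof.
  intros Hr HS Hinj HD Hex E0.
  assert (Hcr : Cmod (c - c) <= r) by (rewrite Cmod_0_minus; lra).
  destruct (circle_separation f c r) as [m [Hm Hsep]]; [lra | | |].
  { intros z Hz. apply smooth_pred, HS. lra. }
  { intros z Hz E. apply Hinj in E; try lra.
    rewrite E, Cmod_0_minus in Hz. lra. }
  (* On the circle [|f z - f w| >= m/2] for [w] close to [c], while [|z - w| <= 2 r]; so [k] bounds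
     the difference quotient from below. *)
  assert (Hk : 0 < m / (4 * r)) by (apply Rdiv_lt_0_compat; lra).
  set (k := m / (4 * r)) in *.
  destruct (HD c Hcr) as [P [HP [HPc HE]]].
  assert (Hcf : cont_at f c) by (apply (smooth_cont 3), HS, Hcr).
  assert (Hm2 : 0 < m / 2) by lra.
  destruct (near_and _ _ _ (near_and _ _ _ HE (smooth_cont _ _ _ HP k Hk))
    (near_and _ _ _ (Hcf _ Hm2) (near_open_ball c c r ltac:(rewrite Cmod_0_minus; lra))))
    as [d [Hd Hn]].
  destruct (Hex d Hd) as [w [Hw HDw]].
  destruct (Hn w Hw) as [[F1 F2] [F3 F4]]. rewrite HPc, E0 in F2.
  replace (P w - 0)%C with (P w) in F2 by ring.
  assert (Hwc : c <> w) by (intros <-; auto).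
  set (K := fun z => if Ceq_dec z w then D w else ((f z - f w) / (z - w))%C).
  assert (K0 : forall z, Cmod (z - c) <= r -> K z <> 0).
  { intros z Hz. unfold K. destruct (Ceq_dec z w) as [|Hzw]; [exact HDw|].
    intros E. apply Hzw. apply Hinj; [lra | lra|].
    replace (f z) with ((f z - f w) / (z - w) * (z - w) + f w)%C
      by (field; now apply Cminus_neq_0).
    rewrite E. ring. }
  assert (B : Cmod (/ K c) <= / k).
  { apply (maximum_principle (fun z => / K z)%C c r); auto.
    - left. now apply Rinv_0_lt_compat.
    - intros z Hz. apply smooth_inv; [|auto]. apply smooth_quotient; [auto|].
      intros ->. apply HD. lra.
    - intros z Hz. rewrite Cmod_inv by (apply K0; lra).
      apply Rinv_le_contravar; [exact Hk|]. unfold K.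
      assert (Hzw : z <> w) by (intros ->; lra).
      destruct (Ceq_dec z w) as [|_]; [contradiction|].
      rewrite Cmod_div by now apply Cminus_neq_0.
      pose proof (Cmod_pos _ (Cminus_neq_0 _ _ Hzw)) as Hp.
      apply Rmult_le_reg_r with (Cmod (z - w)); [exact Hp|].
      unfold Rdiv at 1. rewrite Rmult_assoc, Rinv_l, Rmult_1_r by lra.
      pose proof (Cmod_triangle_minus (z - c) (w - c)) as T1.
      replace (z - c - (w - c))%C with (z - w)%C in T1 by ring.
      pose proof (Cmod_triangle_rev (f z - f c) (f w - f c)) as T2.
      replace (f z - f c - (f w - f c))%C with (f z - f w)%C in T2 by ring.
      pose proof (Hsep z Hz) as S1.
      apply Rle_trans with (k * (2 * r)).
      + apply Rmult_le_compat_l; lra.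
      + unfold k. replace (m / (4 * r) * (2 * r)) with (m / 2) by (field; lra). lra. }
  rewrite Cmod_inv in B by auto. apply (Rlt_not_le _ _ F2).
  assert (EK : K c = P w).
  { unfold K. destruct (Ceq_dec c w) as [|_]; [contradiction|].
    rewrite F1. field. now apply Cminus_neq_0. }
  rewrite EK in B. rewrite <- (Rinv_inv k), <- (Rinv_inv (Cmod (P w))).
  apply Rinv_le_contravar; [|exact B].
  apply Rinv_0_lt_compat, Cmod_pos. rewrite <- EK. auto.
Qed.

(** * Curves *)

(** Caratheodory's form again, so that the chain rule with [has_slope] amounts to substituting one
    factorization into the other. *)
Definition curve_slope (g : R -> C) (t : R) (l : C) : Prop :=
  exists P : R -> C, P t = l /\
    (forall e, 0 < e -> exists d, 0 < d /\
       forall s, Rabs (s - t) < d -> Cmod (P s - l) < e) /\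
    (exists d, 0 < d /\
       forall s, Rabs (s - t) < d -> g s = g t + RtoC (s - t) * P s)%C.

Lemma curve_slope_cont (g : R -> C) (t : R) (l : C) :
  curve_slope g t l ->
  forall e, 0 < e -> exists d, 0 < d /\ forall s, Rabs (s - t) < d -> Cmod (g s - g t) < e.
Proof.
  intros [P [_ [Hc [d2 [Hd2 HE]]]]] e He.
  destruct (Hc 1 Rlt_0_1) as [d1 [Hd1 HP]].
  set (L := Cmod l + 1).
  assert (HL : 0 < L) by (unfold L; pose proof (Cmod_ge_0 l); lra).
  exists (Rmin (Rmin d1 d2) (e / L)). split.
  { apply Rmin_pos; [now apply Rmin_pos | now apply Rdiv_lt_0_compat]. }
  intros s Hs.
  pose proof (Rmin_l (Rmin d1 d2) (e / L)). pose proof (Rmin_r (Rmin d1 d2) (e / L)).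
  pose proof (Rmin_l d1 d2). pose proof (Rmin_r d1 d2).
  rewrite HE by lra.
  replace (g t + RtoC (s - t) * P s - g t)%C with (RtoC (s - t) * P s)%C by ring.
  rewrite Cmod_mult, Cmod_R. pose proof (HP s ltac:(lra)).
  pose proof (Cmod_triangle_rev (P s) l).
  apply Rle_lt_trans with (Rabs (s - t) * L).
  - apply Rmult_le_compat_l; [apply Rabs_pos | unfold L; lra].
  - apply Rmult_lt_reg_r with (/ L); [now apply Rinv_0_lt_compat|].
    rewrite Rmult_assoc, Rinv_r, Rmult_1_r by lra. unfold Rdiv in *. lra.
Qed.

Lemma curve_slope_comp (f : C -> C) (g : R -> C) (t : R) (l m : C) :
  curve_slope g t l -> has_slope 0 f (g t) m -> curve_slope (fun s => f (g s)) t (l * m)%C.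
Proof.
  intros HG [Q [HQ [HQm [d3 [Hd3 HF]]]]].
  pose proof (curve_slope_cont _ _ _ HG) as Hg.
  destruct HG as [P [HPt [HP [d2 [Hd2 HE]]]]].
  exists (fun s => P s * Q (g s))%C. split; [now rewrite HPt, HQm|]. split.
  - intros e He.
    assert (HA : 0 < Cmod l + 1) by (pose proof (Cmod_ge_0 l); lra).
    assert (HB : 0 < Cmod m + 1) by (pose proof (Cmod_ge_0 m); lra).
    set (A := Cmod l + 1) in *. set (B := Cmod m + 1) in *.
    assert (He1 : 0 < e / (2 * A)) by (apply Rdiv_lt_0_compat; lra).
    assert (He2 : 0 < Rmin 1 (e / (2 * B))) by (apply Rmin_pos; [lra | apply Rdiv_lt_0_compat; lra]).
    destruct (HQ _ He1) as [dq [Hdq HQ']]. destruct (Hg _ Hdq) as [d4 [Hd4 Hg']].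
    destruct (HP _ He2) as [d5 [Hd5 HP']].
    exists (Rmin d4 d5). split; [now apply Rmin_pos|]. intros s Hs.
    pose proof (Rmin_l d4 d5). pose proof (Rmin_r d4 d5).
    pose proof (HP' s ltac:(lra)) as B1. pose proof (HQ' _ (Hg' s ltac:(lra))) as B2.
    rewrite HQm in B2.
    replace (P s * Q (g s) - l * m)%C with (P s * (Q (g s) - m) + (P s - l) * m)%C by ring.
    eapply Rle_lt_trans; [apply Cmod_triangle|]. rewrite !Cmod_mult.
    pose proof (Rmin_l 1 (e / (2 * B))). pose proof (Rmin_r 1 (e / (2 * B))).
    pose proof (Cmod_triangle_rev (P s) l). pose proof (Cmod_ge_0 (P s)).
    pose proof (Cmod_ge_0 (Q (g s) - m)). pose proof (Cmod_ge_0 m).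
    pose proof (Cmod_ge_0 (P s - l)).
    assert (Cmod (P s) * Cmod (Q (g s) - m) < A * (e / (2 * A))).
    { apply Rle_lt_trans with (A * Cmod (Q (g s) - m)).
      - apply Rmult_le_compat_r; [lra | unfold A; lra].
      - apply Rmult_lt_compat_l; lra. }
    assert (Cmod (P s - l) * Cmod m <= e / (2 * B) * B).
    { apply Rmult_le_compat; try lra. unfold B. lra. }
    replace (A * (e / (2 * A))) with (e / 2) in * by (field; lra).
    replace (e / (2 * B) * B) with (e / 2) in * by (field; lra). lra.
  - destruct (Hg _ Hd3) as [d4 [Hd4 Hg']].
    exists (Rmin d2 d4). split; [now apply Rmin_pos|]. intros s Hs.
    pose proof (Rmin_l d2 d4). pose proof (Rmin_r d2 d4).
    rewrite (HF (g s)) by (apply Hg'; lra).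
    replace (g s - g t)%C with (RtoC (s - t) * P s)%C by (rewrite (HE s) by lra; ring).
    ring.
Qed.

Lemma curve_slope_of_parts (x y : R -> R) (t p q : R) :
  is_derive x t p -> is_derive y t q -> curve_slope (fun s => (x s, y s)) t (p, q).
Proof.
  intros Hx Hy. apply is_derive_Reals in Hx. apply is_derive_Reals in Hy.
  exists (fun s => if Req_dec_T s t then (p, q) else
     ((x s - x t) / (s - t), (y s - y t) / (s - t))).
  split; [destruct (Req_dec_T t t); [reflexivity | contradiction]|]. split.
  - intros e He. assert (He2 : 0 < e / 2) by lra.
    destruct (Hx _ He2) as [[d1 Hd1] H1]. destruct (Hy _ He2) as [[d2 Hd2] H2].
    simpl in H1, H2. exists (Rmin d1 d2). split; [now apply Rmin_pos|]. intros s Hs.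
    pose proof (Rmin_l d1 d2). pose proof (Rmin_r d1 d2).
    destruct (Req_dec_T s t) as [|Hne]; [rewrite Cmod_0_minus; lra|].
    specialize (H1 (s - t) ltac:(lra) ltac:(lra)).
    specialize (H2 (s - t) ltac:(lra) ltac:(lra)).
    replace (t + (s - t)) with s in * by ring.
    set (u := (x s - x t) / (s - t) - p) in *. set (v := (y s - y t) / (s - t) - q) in *.
    apply Rle_lt_trans with (Rabs u + Rabs v); [|lra].
    apply Cmod_le_sqr; [pose proof (Rabs_pos u); pose proof (Rabs_pos v); lra|].
    simpl. fold (Rminus ((x s - x t) / (s - t)) p). fold (Rminus ((y s - y t) / (s - t)) q).
    fold u v. pose proof (Rsqr_abs u) as E1. pose proof (Rsqr_abs v) as E2.
    unfold Rsqr in E1, E2. rewrite E1, E2.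
    pose proof (Rabs_pos u). pose proof (Rabs_pos v). nra.
  - exists 1. split; [lra|]. intros s _.
    destruct (Req_dec_T s t) as [->|Hne].
    + replace (t - t) with 0 by ring.
      apply injective_projections; simpl; ring.
    + apply injective_projections; simpl; field; lra.
Qed.

Lemma curve_slope_parts (g : R -> C) (t : R) (l : C) :
  curve_slope g t l ->
  is_derive (fun s => fst (g s)) t (fst l) /\ is_derive (fun s => snd (g s)) t (snd l).
Proof.
  intros [P [HPt [HP [d2 [Hd2 HE]]]]].
  assert (G : forall e, 0 < e -> exists d : posreal, forall h, h <> 0 -> Rabs h < d ->
     Rabs ((fst (g (t + h)) - fst (g t)) / h - fst l) < e /\
     Rabs ((snd (g (t + h)) - snd (g t)) / h - snd l) < e).
  { intros e He. destruct (HP e He) as [d1 [Hd1 H1]].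
    assert (Hp : 0 < Rmin d1 d2) by now apply Rmin_pos.
    exists (mkposreal _ Hp). simpl. intros h Hh Hhd.
    pose proof (Rmin_l d1 d2). pose proof (Rmin_r d1 d2).
    rewrite HE by (replace (t + h - t) with h by ring; lra).
    specialize (H1 (t + h)).
    replace (t + h - t) with h in * by ring. specialize (H1 ltac:(lra)).
    set (q := P (t + h)) in *. set (v := (q - l)%C) in *.
    pose proof (Rmax_Cmod v) as HM.
    pose proof (Rmax_l (Rabs (fst v)) (Rabs (snd v))).
    pose proof (Rmax_r (Rabs (fst v)) (Rabs (snd v))).
    split.
    - replace ((fst (g t + RtoC h * q)%C - fst (g t)) / h - fst l)
        with (fst v) by (unfold v; simpl; field; auto). lra.
    - replace ((snd (g t + RtoC h * q)%C - snd (g t)) / h - snd l)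
        with (snd v) by (unfold v; simpl; field; auto). lra. }
  split; apply is_derive_Reals; intros e He; destruct (G e He) as [d Hd];
    exists d; intros h H1 H2; now apply Hd.
Qed.

Lemma curve_slope_zero (g : R -> C) (a b : R) :
  a < b -> (forall t, a <= t <= b -> curve_slope g t 0) -> g a = g b.
Proof.
  intros Hab HD. apply injective_projections.
  - apply (eq_is_derive (fun s => fst (g s))); [|exact Hab].
    intros t Ht. exact (proj1 (curve_slope_parts _ _ _ (HD t Ht))).
  - apply (eq_is_derive (fun s => snd (g s))); [|exact Hab].
    intros t Ht. exact (proj2 (curve_slope_parts _ _ _ (HD t Ht))).
Qed.

(** Restricted to the segment from [c] to [w], [f] becomes a curve of slope zero, whose real and
    imaginary parts are constant. *)
Lemma slope_zero_const (f : C -> C) (c : C) (r : R) :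
  (forall z, Cmod (z - c) < r -> has_slope 0 f z 0) ->
  forall w, Cmod (w - c) < r -> f w = f c.
Proof.
  intros HD w Hw.
  set (g := fun t : R => (fst c + t * (fst w - fst c), snd c + t * (snd w - snd c)) : C).
  assert (Hg : forall t, g t = (c + RtoC t * (w - c))%C).
  { intros t. unfold g. apply injective_projections; simpl; ring. }
  pose proof (curve_slope_zero (fun t => f (g t)) 0 1 Rlt_0_1) as H.
  cbv beta in H. rewrite !Hg in H.
  replace (c + RtoC 0 * (w - c))%C with c in H by ring.
  replace (c + RtoC 1 * (w - c))%C with w in H by ring.
  symmetry. apply H. intros t Ht.
  rewrite <- (Cmult_0_r (w - c)).
  apply curve_slope_comp.
  - rewrite (surjective_pairing (w - c)%C).
    apply curve_slope_of_parts; simpl; auto_derive; auto; ring.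
  - apply HD. rewrite Hg. replace (c + RtoC t * (w - c) - c)%C with (RtoC t * (w - c))%C by ring.
    rewrite Cmod_mult, Cmod_R, Rabs_pos_eq by lra. pose proof (Cmod_ge_0 (w - c)). nra.
Qed.

(** * Power series on the unit disk *)

Fixpoint csum (f : nat -> C) (n : nat) : C :=
  match n with O => RtoC 0 | S m => (csum f m + f m)%C end.

Fixpoint rsum (f : nat -> R) (n : nat) : R :=
  match n with O => 0 | S m => rsum f m + f m end.

Lemma csum_ext (f g : nat -> C) (n : nat) :
  (forall k, (k < n)%nat -> f k = g k) -> csum f n = csum g n.
Proof.
  intros E. induction n as [|n IH]; [reflexivity|]. simpl.
  rewrite IH by (intros; apply E; lia). now rewrite E by lia.
Qed.

Lemma rsum_le (f g : nat -> R) (n : nat) :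
  (forall k, (k < n)%nat -> f k <= g k) -> rsum f n <= rsum g n.
Proof.
  intros E. induction n as [|n IH]; [simpl; lra|]. simpl.
  apply Rplus_le_compat; [apply IH; intros; apply E; lia | apply E; lia].
Qed.

Lemma rsum_ge_0 (f : nat -> R) (n : nat) : (forall k, 0 <= f k) -> 0 <= rsum f n.
Proof.
  intros E. induction n as [|n IH]; simpl; [lra|]. pose proof (E n). lra.
Qed.

Lemma csum_plus (f g : nat -> C) (n : nat) :
  csum (fun k => f k + g k)%C n = (csum f n + csum g n)%C.
Proof. induction n as [|n IH]; simpl; [ring|]. rewrite IH. ring. Qed.

Lemma csum_scal (c : C) (f : nat -> C) (n : nat) :
  csum (fun k => c * f k)%C n = (c * csum f n)%C.
Proof. induction n as [|n IH]; simpl; [ring|]. rewrite IH. ring. Qed.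

Lemma csum_0 (n : nat) : csum (fun _ => RtoC 0) n = RtoC 0.
Proof. induction n as [|n IH]; simpl; [reflexivity|]. rewrite IH. ring. Qed.

Lemma csum_first (f : nat -> C) (n : nat) :
  csum f (S n) = (f O + csum (fun k => f (S k)) n)%C.
Proof. induction n as [|n IH]; [simpl; ring|]. simpl in *. rewrite IH. ring. Qed.

Lemma rsum_first (f : nat -> R) (n : nat) :
  rsum f (S n) = f O + rsum (fun k => f (S k)) n.
Proof. induction n as [|n IH]; [simpl; ring|]. simpl in *. rewrite IH. ring. Qed.

Lemma csum_swap (f : nat -> nat -> C) (n m : nat) :
  csum (fun i => csum (fun j => f i j) m) n = csum (fun j => csum (fun i => f i j) n) m.
Proof.
  induction n as [|n IH]; simpl; [now rewrite csum_0|]. now rewrite IH, csum_plus.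
Qed.

Lemma csum_conj (f : nat -> C) (n : nat) :
  Cconj (csum f n) = csum (fun k => Cconj (f k)) n.
Proof.
  induction n as [|n IH]; simpl.
  - apply injective_projections; simpl; ring.
  - now rewrite Cplus_conj, IH.
Qed.

Lemma Re_csum (f : nat -> C) (n : nat) : Re (csum f n) = rsum (fun k => Re (f k)) n.
Proof. induction n as [|n IH]; cbn [csum rsum]; [reflexivity|]. now rewrite re_plus, IH. Qed.

Lemma Cmod_csum (f : nat -> C) (n : nat) : Cmod (csum f n) <= rsum (fun k => Cmod (f k)) n.
Proof.
  induction n as [|n IH]; simpl; [rewrite Cmod_0; lra|].
  eapply Rle_trans; [apply Cmod_triangle|]. lra.
Qed.

Lemma ratio_lt_1 (x y : R) : 0 <= x < y -> 0 <= x / y < 1.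
Proof.
  intros H. split; [apply Rmult_le_pos; [lra | left; apply Rinv_0_lt_compat; lra]|].
  apply Rmult_lt_reg_r with y; [lra|]. unfold Rdiv. rewrite Rmult_assoc, Rinv_l; lra.
Qed.

Lemma rsum_geom (q : R) (n : nat) : 0 <= q < 1 -> rsum (fun k => q ^ k) n <= / (1 - q).
Proof.
  intros Hq.
  assert (E : (1 - q) * rsum (fun k => q ^ k) n = 1 - q ^ n).
  { induction n as [|n IH]; simpl; [ring|]. rewrite Rmult_plus_distr_l, IH. ring. }
  assert (0 <= q ^ n) by (apply pow_le; lra).
  apply Rmult_le_reg_l with (1 - q); [lra|]. rewrite E, Rinv_r by lra. lra.
Qed.

Lemma rsum_scal (c : R) (f : nat -> R) (n : nat) :
  rsum (fun k => c * f k) n = c * rsum f n.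
Proof. induction n as [|n IH]; simpl; [ring|]. rewrite IH. ring. Qed.

(** * Limits of complex sequences and sums of series *)

Definition tends (u : nat -> C) (l : C) : Prop :=
  forall e, 0 < e -> exists N, forall n, (N <= n)%nat -> Cmod (u n - l) < e.

Lemma tends_unique (u : nat -> C) (l m : C) : tends u l -> tends u m -> l = m.
Proof.
  intros Hl Hm. destruct (classic (l = m)) as [|Hne]; [assumption|exfalso].
  pose proof (Cmod_pos _ (Cminus_neq_0 _ _ Hne)) as Hp.
  destruct (Hl (Cmod (l - m) / 2) ltac:(lra)) as [N1 H1].
  destruct (Hm (Cmod (l - m) / 2) ltac:(lra)) as [N2 H2].
  specialize (H1 (N1 + N2)%nat ltac:(lia)). specialize (H2 (N1 + N2)%nat ltac:(lia)).
  set (x := u (N1 + N2)%nat) in *.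
  pose proof (Cmod_triangle_minus (x - m) (x - l)) as T.
  replace (x - m - (x - l))%C with (l - m)%C in T by ring. lra.
Qed.

Lemma tends_ext (u v : nat -> C) (l : C) :
  (forall n, u n = v n) -> tends u l -> tends v l.
Proof.
  intros E H e He. destruct (H e He) as [N HN]. exists N. intros n Hn.
  rewrite <- E. auto.
Qed.

Lemma tends_plus (u v : nat -> C) (l m : C) :
  tends u l -> tends v m -> tends (fun n => u n + v n)%C (l + m)%C.
Proof.
  intros Hl Hm e He.
  destruct (Hl (e / 2) ltac:(lra)) as [N1 H1]. destruct (Hm (e / 2) ltac:(lra)) as [N2 H2].
  exists (N1 + N2)%nat. intros n Hn.
  specialize (H1 n ltac:(lia)). specialize (H2 n ltac:(lia)).
  replace (u n + v n - (l + m))%C with (u n - l + (v n - m))%C by ring.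
  pose proof (Cmod_triangle (u n - l) (v n - m)). lra.
Qed.

Lemma tends_scal (c : C) (u : nat -> C) (l : C) :
  tends u l -> tends (fun n => c * u n)%C (c * l)%C.
Proof.
  intros Hl e He. pose proof (Cmod_ge_0 c) as Hc.
  destruct (Hl (e / (Cmod c + 1))) as [N HN]; [apply Rdiv_lt_0_compat; lra|].
  exists N. intros n Hn. specialize (HN n Hn).
  replace (c * u n - c * l)%C with (c * (u n - l))%C by ring. rewrite Cmod_mult.
  pose proof (Cmod_ge_0 (u n - l)).
  apply Rle_lt_trans with ((Cmod c + 1) * Cmod (u n - l)); [nra|].
  apply Rmult_lt_reg_r with (/ (Cmod c + 1)); [apply Rinv_0_lt_compat; lra|].
  rewrite (Rmult_comm (Cmod c + 1)), Rmult_assoc, Rinv_r by lra.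
  unfold Rdiv in HN. lra.
Qed.

Lemma tends_const (c : C) : tends (fun _ => c) c.
Proof. intros e He. exists O. intros n _. now rewrite Cmod_0_minus. Qed.

Lemma tends_shift (u : nat -> C) (l : C) : tends u l -> tends (fun n => u (S n)) l.
Proof. intros H e He. destruct (H e He) as [N HN]. exists N. intros n Hn. apply HN. lia. Qed.

Lemma tends_unshift (u : nat -> C) (l : C) : tends (fun n => u (S n)) l -> tends u l.
Proof.
  intros H e He. destruct (H e He) as [N HN]. exists (S N). intros [|n] Hn; [lia|].
  apply HN. lia.
Qed.

Lemma tends_bound (u : nat -> C) (l : C) (B : R) :
  tends u l -> (forall n, Cmod (u n) <= B) -> Cmod l <= B.
Proof.
  intros H HB. apply Rnot_lt_le. intros Hlt.
  destruct (H (Cmod l - B) ltac:(lra)) as [N HN]. specialize (HN N ltac:(lia)).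
  pose proof (HB N). pose proof (Cmod_triangle_rev l (u N)) as T.
  rewrite Cmod_minus_sym in T. lra.
Qed.

Definition series_to (a : nat -> C) (l : C) : Prop := tends (csum a) l.

Lemma sum_n_csum (a : nat -> C) (n : nat) :
  @sum_n C_AbelianMonoid a n = csum a (S n).
Proof.
  induction n as [|n IH].
  - rewrite sum_O. simpl. ring.
  - rewrite sum_Sn, IH. reflexivity.
Qed.

Lemma series_to_is_series (a : nat -> C) (l : C) :
  series_to a l <-> @is_series C_AbsRing C_NormedModule a l.
Proof.
  split.
  - intros H. apply filterlim_locally_ball_norm. intros [e He].
    destruct (H e He) as [N HN]. exists N. intros n Hn.
    unfold ball_norm. change (Cmod (sum_n a n - l)%C < e).
    rewrite sum_n_csum. apply HN. lia.
  - intros H e He. unfold is_series in H.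
    pose proof (proj1 (filterlim_locally_ball_norm _ _) H (mkposreal e He)) as [N HN].
    exists (S N). intros n Hn. destruct n as [|n]; [lia|].
    specialize (HN n ltac:(lia)). unfold ball_norm in HN.
    change (Cmod (sum_n a n - l)%C < e) in HN. now rewrite sum_n_csum in HN.
Qed.

Lemma series_to_is_pseries (a : nat -> C) (z l : C) :
  series_to (fun n => a n * z ^ n)%C l <-> @is_pseries C_AbsRing C_NormedModule a z l.
Proof.
  unfold is_pseries. rewrite <- series_to_is_series.
  assert (E : forall n, csum (fun n => a n * z ^ n)%C n =
     csum (fun k => @scal C_AbsRing C_NormedModule (@pow_n C_AbsRing z k) (a k)) n).
  { intros n. apply csum_ext. intros k _.
    change (a k * z ^ k = z ^ k * a k)%C. ring. }
  split; apply tends_ext; intros n; [apply E | symmetry; apply E].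
Qed.

Lemma series_dominated (a : nat -> C) (b : nat -> R) (B : R) :
  (forall n, Cmod (a n) <= b n) -> (forall n, rsum b n <= B) -> exists l, series_to a l.
Proof.
  intros Hab HB.
  assert (Hex : ex_series b).
  { assert (Hb0 : forall n, 0 <= b n) by (intros n; pose proof (Cmod_ge_0 (a n)); pose proof (Hab n); lra).
    assert (E : forall n, sum_n b n = rsum b (S n)).
    { intros n. induction n as [|n IH]; [rewrite sum_O; simpl; ring|].
      rewrite sum_Sn, IH. reflexivity. }
    destruct (ex_finite_lim_seq_incr (sum_n b) B) as [l Hl]; [| |now exists l].
    - intros n. rewrite !E. simpl. pose proof (Hb0 (S n)). lra.
    - intros n. rewrite E. apply HB. }
  destruct (ex_series_le (K := C_AbsRing) (V := C_CompleteNormedModule) a b Hab Hex) as [l Hl].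
  exists l. now apply series_to_is_series.
Qed.

(** Equivalent to a radius of convergence at least 1, but phrased on coefficients, where stability
    under shifts, linear combinations and multiplication by [n] is immediate or nearly so. *)
Definition disk_series (a : nat -> C) : Prop :=
  forall r, 0 < r < 1 -> exists M, forall n, Cmod (a n) * r ^ n <= M.

Lemma disk_series_abs (a : nat -> C) (r : R) :
  disk_series a -> 0 <= r < 1 ->
  exists B, forall n, rsum (fun k => Cmod (a k) * r ^ k) n <= B.
Proof.
  intros Ha Hr. set (s := (1 + r) / 2). assert (Hs : r < s < 1) by (unfold s; lra).
  destruct (Ha s ltac:(lra)) as [M HM].
  assert (Hq : 0 <= r / s < 1) by (apply ratio_lt_1; lra).
  exists (M * / (1 - r / s)). intros n.
  assert (HM0 : 0 <= M).
  { pose proof (HM O) as H0. pose proof (Cmod_ge_0 (a O)). simpl in H0. lra. }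
  apply Rle_trans with (rsum (fun k => M * (r / s) ^ k) n).
  - apply rsum_le. intros k _.
    replace (r ^ k) with (s ^ k * (r / s) ^ k)
      by (rewrite <- Rpow_mult_distr; f_equal; field; lra).
    rewrite <- Rmult_assoc. apply Rmult_le_compat_r; [apply pow_le; lra | apply HM].
  - rewrite rsum_scal. apply Rmult_le_compat_l; [exact HM0 | now apply rsum_geom].
Qed.

(** A total function by choice; its value is the sum of the series only where the series converges,
    in particular on the disk for a [disk_series]. *)
Definition psum (a : nat -> C) (z : C) : C :=
  epsilon (inhabits (RtoC 0)) (series_to (fun n => a n * z ^ n)%C).

Lemma psum_spec (a : nat -> C) (z : C) :
  disk_series a -> unit_disk z -> series_to (fun n => a n * z ^ n)%C (psum a z).
Proof.
  intros Ha Hz. unfold psum. apply epsilon_spec.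
  destruct (disk_series_abs a (Cmod z) Ha) as [B HB]; [split; [apply Cmod_ge_0 | exact Hz]|].
  apply (series_dominated _ (fun k => Cmod (a k) * Cmod z ^ k) B); [|exact HB].
  intros n. rewrite Cmod_mult, Cmod_pow. lra.
Qed.

Lemma psum_unique (a : nat -> C) (z l : C) :
  disk_series a -> unit_disk z -> series_to (fun n => a n * z ^ n)%C l -> psum a z = l.
Proof. intros Ha Hz H. eapply tends_unique; [apply psum_spec; auto | exact H]. Qed.

Lemma psum_bound (a : nat -> C) (r : R) :
  disk_series a -> 0 <= r < 1 -> exists B, 0 <= B /\ forall z, Cmod z <= r -> Cmod (psum a z) <= B.
Proof.
  intros Ha Hr. destruct (disk_series_abs a r Ha Hr) as [B HB].
  exists B. split; [apply (HB O)|]. intros z Hz.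
  eapply tends_bound; [apply psum_spec; [exact Ha | unfold unit_disk; lra]|].
  intros n. eapply Rle_trans; [apply Cmod_csum|]. eapply Rle_trans; [|apply (HB n)].
  apply rsum_le. intros k _. rewrite Cmod_mult, Cmod_pow.
  apply Rmult_le_compat_l; [apply Cmod_ge_0|].
  apply pow_incr. split; [apply Cmod_ge_0 | exact Hz].
Qed.

Lemma pseries_disk_series (a : nat -> C) (f : C -> C) :
  (forall z, unit_disk z -> @is_pseries C_AbsRing C_NormedModule a z (f z)) -> disk_series a.
Proof.
  intros H r Hr.
  assert (Hd : unit_disk (RtoC r)) by (unfold unit_disk; rewrite Cmod_R, Rabs_pos_eq; lra).
  pose proof (proj2 (series_to_is_pseries _ _ _) (H _ Hd)) as HS.
  destruct (HS 1 Rlt_0_1) as [N HN].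
  assert (G : forall m, exists M, forall n, (n < m)%nat -> Cmod (a n) * r ^ n <= M).
  { intros m. induction m as [|m [M IH]]; [exists 0; lia|].
    exists (Rmax M (Cmod (a m) * r ^ m)). intros n Hn.
    destruct (Nat.eq_dec n m) as [->|]; [apply Rmax_r|].
    eapply Rle_trans; [apply IH; lia | apply Rmax_l]. }
  (* From [N] on the partial sums lie within 1 of the limit, so each further term has modulus below
     2; [M] covers the first [N] terms. *)
  destruct (G N) as [M HM]. exists (Rmax M 2). intros n.
  destruct (Nat.lt_ge_cases n N) as [L|L].
  - eapply Rle_trans; [now apply HM | apply Rmax_l].
  - eapply Rle_trans; [|apply Rmax_r].
    pose proof (HN n L) as A1. pose proof (HN (S n) ltac:(lia)) as A2. simpl in A2.
    set (x := csum (fun n => a n * RtoC r ^ n)%C n) in *.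
    set (y := (a n * RtoC r ^ n)%C) in *.
    pose proof (Cmod_triangle_minus (x + y - f (RtoC r)) (x - f (RtoC r))) as T.
    replace (x + y - f (RtoC r) - (x - f (RtoC r)))%C with y in T by ring.
    unfold y in T at 1. rewrite Cmod_mult, Cmod_pow, Cmod_R, Rabs_pos_eq in T by lra. lra.
Qed.

Lemma disk_series_shift (a : nat -> C) (m : nat) :
  disk_series a -> disk_series (fun n => a (m + n)%nat).
Proof.
  intros Ha r Hr. destruct (Ha r Hr) as [M HM]. exists (M * / r ^ m). intros n.
  assert (0 < r ^ m) by (apply pow_lt; lra).
  apply Rmult_le_reg_r with (r ^ m); [assumption|].
  rewrite (Rmult_assoc M), Rinv_l by lra. rewrite Rmult_1_r, Rmult_assoc, <- pow_add.
  rewrite (Nat.add_comm n m). apply HM.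
Qed.

Lemma disk_series_plus (a b : nat -> C) :
  disk_series a -> disk_series b -> disk_series (fun n => a n + b n)%C.
Proof.
  intros Ha Hb r Hr. destruct (Ha r Hr) as [M HM]. destruct (Hb r Hr) as [L HL].
  exists (M + L). intros n. pose proof (HM n). pose proof (HL n).
  pose proof (Cmod_triangle (a n) (b n)).
  assert (0 < r ^ n) by (apply pow_lt; lra). nra.
Qed.

Lemma disk_series_scal (c : C) (a : nat -> C) :
  disk_series a -> disk_series (fun n => c * a n)%C.
Proof.
  intros Ha r Hr. destruct (Ha r Hr) as [M HM]. exists (Cmod c * M). intros n.
  rewrite Cmod_mult, Rmult_assoc. apply Rmult_le_compat_l; [apply Cmod_ge_0 | apply HM].
Qed.

Lemma disk_series_bounded (a : nat -> C) (M : R) :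
  (forall n, Cmod (a n) <= M) -> disk_series a.
Proof.
  intros HM r Hr. exists M. intros n.
  assert (0 < r ^ n <= 1).
  { split; [apply pow_lt; lra|]. rewrite <- (pow1 n). apply pow_incr. lra. }
  pose proof (HM n). pose proof (Cmod_ge_0 (a n)). nra.
Qed.

(** Bernoulli's inequality for [(1 + h)^n] with [1 + h = 1/q]. *)
Lemma pow_linear_bound (q : R) : 0 < q < 1 -> exists M, forall n, INR n * q ^ n <= M.
Proof.
  intros Hq. set (h := / q - 1).
  assert (Hh : 0 < h).
  { unfold h. assert (/ 1 < / q) by (apply Rinv_lt_contravar; lra). rewrite Rinv_1 in *. lra. }
  exists (/ h). intros n.
  pose proof (poly n h Hh) as B.
  assert (E : (1 + h) ^ n * q ^ n = 1).
  { rewrite <- Rpow_mult_distr. replace ((1 + h) * q) with 1 by (unfold h; field; lra).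
    apply pow1. }
  assert (Hp : 0 < q ^ n) by (apply pow_lt; lra).
  apply Rmult_le_reg_l with h; [exact Hh|]. rewrite Rinv_r by lra.
  apply Rle_trans with ((1 + h) ^ n * q ^ n); [nra | lra].
Qed.

Lemma disk_series_mul_n (a : nat -> C) :
  disk_series a -> disk_series (fun n => RtoC (INR n) * a n)%C.
Proof.
  intros Ha r Hr. set (s := (1 + r) / 2). assert (Hs : r < s < 1) by (unfold s; lra).
  destruct (Ha s ltac:(lra)) as [M HM].
  destruct (pow_linear_bound (r / s)) as [L HL].
  { split; [apply Rdiv_lt_0_compat | apply ratio_lt_1]; lra. }
  exists (M * L). intros n. rewrite Cmod_mult, Cmod_R, Rabs_pos_eq by apply pos_INR.
  replace (r ^ n) with (s ^ n * (r / s) ^ n)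
    by (rewrite <- Rpow_mult_distr; f_equal; field; lra).
  replace (INR n * Cmod (a n) * (s ^ n * (r / s) ^ n))
    with ((Cmod (a n) * s ^ n) * (INR n * (r / s) ^ n)) by ring.
  assert (0 < r / s) by (apply Rdiv_lt_0_compat; lra).
  apply Rmult_le_compat; auto.
  - apply Rmult_le_pos; [apply Cmod_ge_0 | apply pow_le; lra].
  - apply Rmult_le_pos; [apply pos_INR | apply pow_le; lra].
Qed.

Lemma psum_0 (a : nat -> C) : disk_series a -> psum a 0 = a O.
Proof.
  intros Ha. apply psum_unique; [exact Ha | unfold unit_disk; rewrite Cmod_0; lra|].
  intros e He. exists 1%nat. intros [|n] Hn; [lia|].
  replace (csum (fun n => a n * 0 ^ n)%C (S n)) with (a O); [now rewrite Cmod_0_minus|].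
  clear Hn. induction n as [|n IH]; [simpl; ring|].
  change (a O = csum (fun n => a n * 0 ^ n)%C (S n) + a (S n) * 0 ^ S n)%C.
  rewrite <- IH. rewrite Cpow_S. ring.
Qed.

Lemma psum_shift (a : nat -> C) (z : C) :
  disk_series a -> unit_disk z -> psum a z = (a O + z * psum (fun n => a (S n)) z)%C.
Proof.
  intros Ha Hz. apply psum_unique; auto.
  pose proof (psum_spec _ z (disk_series_shift a 1 Ha) Hz) as HS.
  change (fun n => a (1 + n)%nat) with (fun n => a (S n)) in HS.
  apply tends_unshift.
  apply tends_ext with (fun n => a O + z * csum (fun k => a (S k) * z ^ k) n)%C.
  - intros n. rewrite csum_first. f_equal; [simpl; ring|].
    rewrite <- csum_scal. apply csum_ext. intros k _. rewrite Cpow_S. ring.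
  - apply tends_plus; [apply tends_const|]. apply tends_scal. exact HS.
Qed.

Lemma psum_plus (a b : nat -> C) (z : C) :
  disk_series a -> disk_series b -> unit_disk z ->
  psum (fun n => a n + b n)%C z = (psum a z + psum b z)%C.
Proof.
  intros Ha Hb Hz. apply psum_unique; [now apply disk_series_plus | exact Hz|].
  pose proof (tends_plus _ _ _ _ (psum_spec a z Ha Hz) (psum_spec b z Hb Hz)) as H.
  revert H. apply tends_ext. intros n. rewrite <- csum_plus. apply csum_ext.
  intros k _. ring.
Qed.

Lemma psum_scal (c : C) (a : nat -> C) (z : C) :
  disk_series a -> unit_disk z -> psum (fun n => c * a n)%C z = (c * psum a z)%C.
Proof.
  intros Ha Hz. apply psum_unique; [now apply disk_series_scal | exact Hz|].
  pose proof (tends_scal c _ _ (psum_spec a z Ha Hz)) as H.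
  revert H. apply tends_ext. intros n. rewrite <- csum_scal. apply csum_ext.
  intros k _. ring.
Qed.

Lemma psum_ext (a b : nat -> C) (z : C) :
  disk_series a -> unit_disk z -> (forall n, a n = b n) -> psum a z = psum b z.
Proof.
  intros Ha Hz E.
  assert (Hb : disk_series b).
  { intros r Hr. destruct (Ha r Hr) as [M HM]. exists M. intros n. rewrite <- E. apply HM. }
  apply psum_unique; auto. generalize (psum_spec b z Hb Hz). apply tends_ext.
  intros n. apply csum_ext. intros k _. now rewrite E.
Qed.

Lemma tends_geometric (a : nat -> C) (z : C) :
  disk_series a -> unit_disk z -> tends (fun n => a n * z ^ n)%C 0.
Proof.
  intros Ha Hz. pose proof (psum_spec a z Ha Hz) as H.
  pose proof (tends_plus _ _ _ _ (tends_shift _ _ H) (tends_scal (- RtoC 1) _ _ H)) as T.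
  replace (psum a z + - (1) * psum a z)%C with (RtoC 0) in T by ring.
  revert T. apply tends_ext. intros n. simpl. ring.
Qed.

(** Horner's division by [z - c]: these are the coefficients of [(psum a z - psum a c)/(z - c)]. The
    Caratheodory factor of a power series is thus again a power series on the disk, and smoothness
    of every order follows by induction. *)
Definition synthetic (a : nat -> C) (c : C) (j : nat) : C :=
  psum (fun i => a (S j + i)%nat) c.

Lemma disk_series_synthetic (a : nat -> C) (c : C) :
  disk_series a -> unit_disk c -> disk_series (synthetic a c).
Proof.
  intros Ha Hc r Hr. unfold unit_disk in Hc. pose proof (Cmod_ge_0 c) as Hc0.
  (* With [s] above both [r] and [|c|], the coefficient bound [M / s^n] makes the sum defining
     [synthetic] geometric of ratio [|c|/s] and leaves the decay [s^-j]. *)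
  set (s := (1 + Rmax r (Cmod c)) / 2).
  assert (Hs : Rmax r (Cmod c) < s < 1).
  { assert (Rmax r (Cmod c) < 1) by (apply Rmax_lub_lt; lra). unfold s. lra. }
  pose proof (Rmax_l r (Cmod c)). pose proof (Rmax_r r (Cmod c)).
  destruct (Ha s ltac:(lra)) as [M HM].
  assert (HM0 : 0 <= M).
  { pose proof (HM O) as H0'. pose proof (Cmod_ge_0 (a O)). simpl in H0'. lra. }
  set (q := Cmod c / s).
  assert (Hq : 0 <= q < 1) by (apply ratio_lt_1; lra).
  exists (M / s * / (1 - q)). intros j.
  assert (Hsj : 0 < s ^ j) by (apply pow_lt; lra).
  apply Rle_trans with (Cmod (synthetic a c j) * s ^ j).
  { apply Rmult_le_compat_l; [apply Cmod_ge_0|]. apply pow_incr. lra. }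
  apply Rmult_le_reg_r with (/ s ^ j); [now apply Rinv_0_lt_compat|].
  rewrite Rmult_assoc, Rinv_r, Rmult_1_r by lra.
  unfold synthetic. eapply tends_bound.
  { apply psum_spec; [apply (disk_series_shift a (S j) Ha) | exact Hc]. }
  intros n. eapply Rle_trans; [apply Cmod_csum|].
  apply Rle_trans with (rsum (fun k => M / s * / s ^ j * q ^ k) n).
  - apply rsum_le. intros k _. rewrite Cmod_mult, Cmod_pow.
    replace (Cmod c ^ k) with (s ^ k * q ^ k)
      by (rewrite <- Rpow_mult_distr; f_equal; unfold q; field; lra).
    rewrite <- Rmult_assoc. apply Rmult_le_compat_r; [apply pow_le; lra|].
    apply Rmult_le_reg_r with (s ^ S j); [apply pow_lt; lra|].
    rewrite Rmult_assoc, <- pow_add, (Nat.add_comm k).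
    eapply Rle_trans; [apply HM|]. right. simpl. field. lra.
  - rewrite rsum_scal.
    replace (M / s * / (1 - q) * / s ^ j) with (M / s * / s ^ j * / (1 - q)) by ring.
    apply Rmult_le_compat_l; [|now apply rsum_geom].
    apply Rmult_le_pos; [apply Rmult_le_pos; [lra|]|]; left; apply Rinv_0_lt_compat; lra.
Qed.

Lemma synthetic_step (a : nat -> C) (c : C) (j : nat) :
  disk_series a -> unit_disk c ->
  synthetic a c j = (a (S j) + c * synthetic a c (S j))%C.
Proof.
  intros Ha Hc. unfold synthetic.
  rewrite (psum_shift _ c (disk_series_shift a (S j) Ha) Hc).
  f_equal; [f_equal; lia|]. f_equal.
  apply psum_ext; [|exact Hc|].
  - apply (disk_series_shift _ 1 (disk_series_shift a (S j) Ha)).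
  - intros n. f_equal. lia.
Qed.

Lemma psum_factor (a : nat -> C) (z c : C) :
  disk_series a -> unit_disk z -> unit_disk c ->
  psum a z = (psum a c + (z - c) * psum (synthetic a c) z)%C.
Proof.
  intros Ha Hz Hc. pose proof (disk_series_synthetic a c Ha Hc) as Hb.
  set (b := synthetic a c) in *.
  assert (Eb : psum a c = (a O + c * b O)%C) by (apply psum_shift; auto).
  (* The factorization holds for partial sums up to the boundary term [- z b_n z^n], which tends to
     0. *)
  assert (E : forall n, csum (fun k => a k * z ^ k)%C (S n) =
    (psum a c + (z - c) * csum (fun k => b k * z ^ k) (S n) + - z * (b n * z ^ n))%C).
  { intros n. induction n as [|n IH]; [simpl; rewrite Eb; ring|].
    change (csum (fun k => a k * z ^ k)%C (S (S n))) with
      (csum (fun k => a k * z ^ k)%C (S n) + a (S n) * z ^ S n)%C.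
    rewrite IH.
    change (csum (fun k => b k * z ^ k)%C (S (S n))) with
      (csum (fun k => b k * z ^ k)%C (S n) + b (S n) * z ^ S n)%C.
    pose proof (synthetic_step a c n Ha Hc) as ES. fold b in ES. rewrite ES.
    rewrite (Cpow_S z n). ring. }
  apply psum_unique; auto. apply tends_unshift.
  apply tends_ext with (1 := fun n => eq_sym (E n)).
  replace (psum a c + (z - c) * psum b z)%C with
    (psum a c + (z - c) * psum b z + - z * 0)%C by ring.
  apply tends_plus; [|apply tends_scal; now apply tends_geometric].
  apply tends_plus; [apply tends_const|]. apply tends_scal.
  apply (tends_shift _ _ (psum_spec b z Hb Hz)).
Qed.

Lemma psum_cont (a : nat -> C) (c : C) : disk_series a -> unit_disk c -> cont_at (psum a) c.
Proof.
  intros Ha Hc e He. pose proof (Cmod_ge_0 c) as Hc0.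
  pose proof Hc as Hc1. unfold unit_disk in Hc1.
  set (r := (1 + Cmod c) / 2). assert (Hr : Cmod c < r < 1) by (unfold r; lra).
  destruct (psum_bound _ r (disk_series_synthetic a c Ha Hc) ltac:(lra)) as [B [HB0 HB]].
  assert (Hk : 0 < e / (B + 1)) by (apply Rdiv_lt_0_compat; lra).
  exists (Rmin (r - Cmod c) (e / (B + 1))). split; [apply Rmin_pos; lra|].
  intros z Hz. pose proof (Rmin_l (r - Cmod c) (e / (B + 1))).
  pose proof (Rmin_r (r - Cmod c) (e / (B + 1))).
  pose proof (Cmod_triangle_rev z c).
  rewrite (psum_factor a z c) by (auto; unfold unit_disk; lra).
  replace (psum a c + (z - c) * psum (synthetic a c) z - psum a c)%C
    with ((z - c) * psum (synthetic a c) z)%C by ring.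
  rewrite Cmod_mult. pose proof (HB z ltac:(lra)). pose proof (Cmod_ge_0 (z - c)).
  apply Rle_lt_trans with (Cmod (z - c) * (B + 1)); [apply Rmult_le_compat_l; lra|].
  apply Rmult_lt_reg_r with (/ (B + 1)); [apply Rinv_0_lt_compat; lra|].
  rewrite Rmult_assoc, Rinv_r by lra. unfold Rdiv in *. lra.
Qed.

Lemma smooth_psum (n : nat) (a : nat -> C) (c : C) :
  disk_series a -> unit_disk c -> smooth n (psum a) c.
Proof.
  revert a. induction n as [|n IH]; intros a Ha Hc; [now apply psum_cont|].
  exists (psum (synthetic a c)). split.
  - apply IH; [now apply disk_series_synthetic | exact Hc].
  - generalize (near_disk c Hc). apply near_imp. intros z Hz. now apply psum_factor.
Qed.

Definition deriv_coef (a : nat -> C) (n : nat) : C := (RtoC (INR (S n)) * a (S n))%C.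

Lemma disk_series_deriv (a : nat -> C) : disk_series a -> disk_series (deriv_coef a).
Proof. intros Ha. exact (disk_series_shift _ 1 (disk_series_mul_n a Ha)). Qed.

(** Abel summation: at [c] the partial sums of the two series differ by [n b_n c^n], which tends to
    0 because multiplication by [n] preserves [disk_series]. *)
Lemma psum_synthetic_diag (a : nat -> C) (c : C) :
  disk_series a -> unit_disk c -> psum (synthetic a c) c = psum (deriv_coef a) c.
Proof.
  intros Ha Hc. pose proof (disk_series_synthetic a c Ha Hc) as Hb.
  set (b := synthetic a c) in *.
  apply psum_unique; auto.
  pose proof (psum_spec _ c (disk_series_deriv a Ha) Hc) as H1.
  pose proof (tends_geometric _ c (disk_series_mul_n b Hb) Hc) as H2.
  pose proof (tends_plus _ _ _ _ H1 H2) as H3. rewrite Cplus_0_r in H3.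
  revert H3. apply tends_ext. intros n. induction n as [|n IH]; [simpl; ring|].
  change (csum (fun k => b k * c ^ k)%C (S n)) with
    (csum (fun k => b k * c ^ k)%C n + b n * c ^ n)%C.
  rewrite <- IH. cbn [csum]. unfold deriv_coef at 2.
  pose proof (synthetic_step a c n Ha Hc) as ES. fold b in ES. rewrite ES.
  rewrite Cpow_S, S_INR, RtoC_plus. ring.
Qed.

Lemma psum_slope (n : nat) (a : nat -> C) (c : C) :
  disk_series a -> unit_disk c -> has_slope n (psum a) c (psum (deriv_coef a) c).
Proof.
  intros Ha Hc. exists (psum (synthetic a c)). split; [|split].
  - apply smooth_psum; [now apply disk_series_synthetic | exact Hc].
  - now apply psum_synthetic_diag.
  - generalize (near_disk c Hc). apply near_imp. intros z Hz. now apply psum_factor.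
Qed.

(** * Subordination to a univalent function *)

(** The Hurwitz argument requires points near [c] where the derivative does not vanish. If there
    were none, [psum a] would be constant on a small disk, against injectivity. *)
Lemma univalent_deriv_nonzero (a : nat -> C) (c : C) :
  disk_series a -> injective_on_disk (psum a) -> unit_disk c ->
  psum (deriv_coef a) c <> 0.
Proof.
  intros Ha Hinj Hc. pose proof Hc as Hc1. unfold unit_disk in Hc1.
  set (r := (1 - Cmod c) / 2).
  assert (Hr : 0 < r) by (unfold r; lra).
  assert (Hin : forall z, Cmod (z - c) <= r -> unit_disk z).
  { intros z Hz. unfold unit_disk. pose proof (Cmod_triangle_rev z c). unfold r in Hz. lra. }
  apply (injective_slope_nonzero (psum a) c r (psum (deriv_coef a))); auto.
  - intros z Hz. apply smooth_psum; auto.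
  - intros z Hz. apply psum_slope; auto.
  - intros d Hd. apply NNPP. intros Hno.
    assert (Hmin : 0 < Rmin d r) by now apply Rmin_pos.
    pose proof (Rmin_l d r). pose proof (Rmin_r d r).
    assert (E : psum a (c + RtoC (Rmin d r / 2))%C = psum a c).
    { apply slope_zero_const with (r := Rmin d r).
      - intros z Hz. replace (RtoC 0) with (psum (deriv_coef a) z).
        + apply psum_slope; [exact Ha | apply Hin; lra].
        + apply NNPP. intros Hn. apply Hno. exists z. split; [lra | exact Hn].
      - replace (c + RtoC (Rmin d r / 2) - c)%C with (RtoC (Rmin d r / 2)) by ring.
        rewrite Cmod_R, Rabs_pos_eq; lra. }
    assert (Em : Cmod (c + RtoC (Rmin d r / 2) - c) = Rmin d r / 2).
    { replace (c + RtoC (Rmin d r / 2) - c)%C with (RtoC (Rmin d r / 2)) by ring.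
      rewrite Cmod_R, Rabs_pos_eq; lra. }
    apply Hinj in E; [|apply Hin; lra | exact Hc].
    rewrite E, Cmod_0_minus in Em. lra.
Qed.

Lemma univalent_open (a : nat -> C) (c : C) (e : R) :
  disk_series a -> injective_on_disk (psum a) -> unit_disk c -> 0 < e ->
  near (psum a c) (fun y => exists z, unit_disk z /\ Cmod (z - c) < e /\ psum a z = y).
Proof.
  intros Ha Hinj Hc He. pose proof Hc as Hc1. unfold unit_disk in Hc1.
  set (r := Rmin e ((1 - Cmod c) / 2)).
  assert (Hr : 0 < r) by (apply Rmin_pos; lra).
  assert (Hr1 : r <= e) by apply Rmin_l.
  assert (Hr2 : r <= (1 - Cmod c) / 2) by apply Rmin_r.
  assert (Hin : forall z, Cmod (z - c) <= r -> unit_disk z).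
  { intros z Hz. unfold unit_disk. pose proof (Cmod_triangle_rev z c). lra. }
  generalize (open_mapping (psum a) c r Hr). intros HO.
  eapply near_imp; [|apply HO].
  - intros y [z [Hz Ey]]. exists z. split; [apply Hin; lra | split; [lra | exact Ey]].
  - intros z Hz. apply smooth_psum; auto.
  - intros z Hz E. apply Hinj in E; [|apply Hin; lra | exact Hc].
    rewrite E, Cmod_0_minus in Hz. lra.
Qed.

(** Here [F] is the inverse of [psum a] applied to [G]. Continuity comes from openness of [psum a];
    each further order comes from dividing the factor of [G] by that of [psum a] at [F z], which is
    nonzero at [c] and already as smooth as needed by induction. *)
Lemma smooth_lift (n : nat) (a : nat -> C) (F G : C -> C) (c : C) :
  disk_series a -> injective_on_disk (psum a) -> unit_disk c ->
  (forall z, unit_disk z -> unit_disk (F z) /\ psum a (F z) = G z) ->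
  smooth n G c -> smooth n F c.
Proof.
  intros Ha Hinj Hc HF. revert G HF. induction n as [|n IH]; intros G HF HG.
  - intros e He. destruct (HF c Hc) as [HFc EFc].
    destruct (univalent_open a (F c) e Ha Hinj HFc He) as [d [Hd HO]].
    generalize (near_and _ _ _ (HG d Hd) (near_disk c Hc)). apply near_imp.
    intros z [Hz Hz1]. destruct (HF z Hz1) as [HFz EFz].
    rewrite EFc in HO. destruct (HO (G z) Hz) as [w [Hw [Hwc Ew]]].
    rewrite <- EFz in Ew. apply Hinj in Ew; auto. now rewrite <- Ew.
  - pose proof (IH G HF (smooth_pred _ _ _ HG)) as IHF.
    destruct HG as [Q [HQ HE]]. destruct (HF c Hc) as [HFc EFc].
    set (P := psum (synthetic a (F c))).
    assert (HP : forall m, smooth m P (F c)).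
    { intros m. apply smooth_psum; [now apply disk_series_synthetic | exact HFc]. }
    assert (HP0 : P (F c) <> 0).
    { unfold P. rewrite psum_synthetic_diag by auto. now apply univalent_deriv_nonzero. }
    pose proof (smooth_comp _ _ _ _ IHF (HP n)) as HPF.
    exists (fun z => Q z / P (F z))%C. split; [now apply smooth_div|].
    generalize (near_and _ _ _ (near_and _ _ _ HE (near_disk c Hc))
      (cont_at_nonzero _ _ (smooth_cont _ _ _ HPF) HP0)). apply near_imp.
    intros z [[E1 E2] E3]. destruct (HF z E2) as [HFz EFz].
    assert (Hz0 : P (F z) <> 0).
    { apply Cmod_neq_0. pose proof (Cmod_ge_0 (P (F c))). lra. }
    pose proof (psum_factor a (F z) (F c) Ha HFz HFc) as E. fold P in E.
    rewrite EFz, EFc, E1 in E.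
    replace ((z - c) * (Q z / P (F z)))%C with (((z - c) * Q z) / P (F z))%C
      by (field; exact Hz0).
    replace ((z - c) * Q z)%C with ((F z - F c) * P (F z))%C.
    + field. exact Hz0.
    + replace ((F z - F c) * P (F z))%C
        with (G c + (F z - F c) * P (F z) - G c)%C by ring.
      rewrite <- E. ring.
Qed.

(* Schwarz's lemma for the self-map [f^-1 o g] of the disk, whose quotient by [z]
   is written without a removable singularity. *)
Lemma subordination_schwarz (a b : nat -> C) :
  disk_series a -> injective_on_disk (psum a) -> a 0%nat = 0 -> a 1%nat = 1 ->
  disk_series b -> b 0%nat = 0 ->
  (forall z, unit_disk z -> exists w, unit_disk w /\ psum a w = psum b z) ->
  forall z w, unit_disk z -> unit_disk w -> psum a w = psum b z -> Cmod w <= Cmod z.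
Proof.
  intros Ha Hinj Ha0 Ha1 Hb Hb0 Hsub z0 w0 Hz0 Hw0 E0.
  assert (HF : exists F : C -> C, forall z, unit_disk z ->
             unit_disk (F z) /\ psum a (F z) = psum b z).
  { apply (choice_function _ _ (fun z w => unit_disk z ->
             unit_disk w /\ psum a w = psum b z)).
    intros z. destruct (classic (unit_disk z)) as [Hz|Hz].
    - destruct (Hsub z Hz) as [w Hw]. now exists w.
    - exists (RtoC 0). contradiction. }
  destruct HF as [F HF].
  assert (Ew : F z0 = w0).
  { destruct (HF z0 Hz0) as [H1 H2]. apply Hinj; auto. now rewrite H2. }
  set (A := psum (fun n => a (S n))). set (B := psum (fun n => b (S n))).
  pose proof (disk_series_shift a 1 Ha) as HA. pose proof (disk_series_shift b 1 Hb) as HB.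
  assert (EA : forall w, unit_disk w -> psum a w = (w * A w)%C).
  { intros w Hw. rewrite psum_shift, Ha0 by auto. unfold A. ring. }
  assert (EB : forall w, unit_disk w -> psum b w = (w * B w)%C).
  { intros w Hw. rewrite psum_shift, Hb0 by auto. unfold B. ring. }
  (* A zero of [A] would be a zero of [psum a], hence [w = 0] by injectivity; but
     [A 0 = a 1 = 1]. *)
  assert (HA0 : forall w, unit_disk w -> A w <> 0).
  { intros w Hw E. assert (D0 : unit_disk 0) by (unfold unit_disk; rewrite Cmod_0; lra).
    assert (E' : w = 0).
    { apply Hinj; auto. rewrite !EA by auto. rewrite E. ring. }
    subst w. unfold A in E. change (fun n => a (S n)) with (fun n => a (1 + n)%nat) in E.
    rewrite psum_0 in E by exact HA. simpl in E. rewrite Ha1 in E.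
    apply RtoC_inj in E. lra. }
  set (H := fun z => (B z / A (F z))%C).
  assert (EH : forall z, unit_disk z -> F z = (z * H z)%C).
  { intros z Hz. destruct (HF z Hz) as [H1 H2].
    rewrite EA, EB in H2 by auto. pose proof (HA0 _ H1). unfold H.
    replace (z * (B z / A (F z)))%C with ((z * B z) / A (F z))%C by (field; auto).
    rewrite <- H2. field. auto. }
  assert (HS : forall z, unit_disk z -> smooth 2 H z).
  { intros z Hz. destruct (HF z Hz) as [H1 H2]. apply smooth_div; auto.
    - now apply smooth_psum.
    - apply smooth_comp; [|now apply smooth_psum].
      apply (smooth_lift 2 a F (psum b)); auto. now apply smooth_psum. }
  assert (MP : forall r z, 0 < r < 1 -> Cmod z <= r -> Cmod (H z) <= / r).
  { intros r z Hr Hz. apply (maximum_principle H 0 r).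
    - left. apply Rinv_0_lt_compat. lra.
    - intros x Hx. apply HS. unfold unit_disk.
      replace (x - 0)%C with x in Hx by ring. lra.
    - intros x Hx. replace (x - 0)%C with x in Hx by ring.
      assert (Dx : unit_disk x) by (unfold unit_disk; lra).
      destruct (HF x Dx) as [H1 _]. unfold unit_disk in H1.
      rewrite (EH x Dx), Cmod_mult, Hx in H1.
      apply Rmult_le_reg_l with r; [lra|]. rewrite Rinv_r; lra.
    - now replace (z - 0)%C with z by ring. }
  apply Rnot_lt_le. intros Hlt. unfold unit_disk in Hz0, Hw0.
  pose proof (Cmod_ge_0 z0) as P0.
  (* Since [|w0| < 1], [|z0| <= q]. Any [r] strictly between [q] and 1 gives
     [|w0| = |z0| |H z0| <= |w0| q / r < |w0|]. *)
  set (q := Cmod z0 / Cmod w0).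
  assert (Eq : q * Cmod w0 = Cmod z0) by (unfold q; field; lra).
  assert (Hq : 0 <= q < 1).
  { split; [apply Rmult_le_pos; [lra | left; apply Rinv_0_lt_compat; lra]|]. nra. }
  set (r := (1 + q) / 2).
  assert (Hr : q < r < 1) by (unfold r; lra).
  pose proof (MP r z0 ltac:(lra) ltac:(nra)) as M.
  pose proof (EH z0 ltac:(exact Hz0)) as E. rewrite Ew in E.
  assert (Ec : Cmod w0 = Cmod z0 * Cmod (H z0)) by (rewrite E at 1; apply Cmod_mult).
  assert (M2 : Cmod (H z0) * r <= 1).
  { apply Rmult_le_compat_r with (r := r) in M; [|lra]. rewrite Rinv_l in M by lra. exact M. }
  nra.
Qed.

(** * The second-order deformation of a convex function *)

Lemma nonneg_of_derive (f f' : R -> R) (x : R) :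
  f 0 = 0 -> (forall y, is_derive f y (f' y)) -> (forall y, 0 <= y -> 0 <= f' y) ->
  0 <= x -> 0 <= f x.
Proof.
  intros H0 HD Hpos Hx. destruct (Rle_lt_or_eq_dec _ _ Hx) as [L|<-]; [|lra].
  destruct (MVT_gen f 0 x f') as [c [Hc E]].
  - intros y _. apply HD.
  - intros y _. apply continuity_pt_filterlim. apply (ex_derive_continuous f).
    exists (f' y). apply HD.
  - rewrite Rmin_left, Rmax_right in Hc by lra. pose proof (Hpos c ltac:(lra)). nra.
Qed.

(** Only the order [x^4] of the error matters; its constant is generous. Each of [S1] to [S4] has as
    derivative the expression shown nonnegative just before it, and evenness reduces to [x >= 0]. *)
Lemma cos_quadratic (x : R) : Rabs (2 * (1 - cos x) - x * x) <= x * x * (x * x).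
Proof.
  assert (G : forall y, 0 <= y -> y - y ^ 3 / 6 <= sin y /\
     0 <= cos y - 1 + y ^ 2 / 2 /\ 0 <= 1 - y ^ 2 / 2 + y ^ 4 / 24 - cos y).
  { assert (S1 : forall y, 0 <= y -> 0 <= y - sin y).
    { intros y Hy. apply (nonneg_of_derive (fun y => y - sin y) (fun y => 1 - cos y)); auto.
      - rewrite sin_0. ring.
      - intros z. auto_derive; auto. ring.
      - intros z _. pose proof (COS_bound z). lra. }
    assert (S2 : forall y, 0 <= y -> 0 <= cos y - 1 + y ^ 2 / 2).
    { intros y Hy.
      apply (nonneg_of_derive (fun y => cos y - 1 + y ^ 2 / 2) (fun y => y - sin y)); auto.
      - rewrite cos_0. field.
      - intros z. auto_derive; auto. field. }
    assert (S3 : forall y, 0 <= y -> 0 <= sin y - y + y ^ 3 / 6).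
    { intros y Hy.
      apply (nonneg_of_derive (fun y => sin y - y + y ^ 3 / 6)
        (fun y => cos y - 1 + y ^ 2 / 2)); auto.
      - rewrite sin_0. field.
      - intros z. auto_derive; auto. field. }
    assert (S4 : forall y, 0 <= y -> 0 <= 1 - y ^ 2 / 2 + y ^ 4 / 24 - cos y).
    { intros y Hy.
      apply (nonneg_of_derive (fun y => 1 - y ^ 2 / 2 + y ^ 4 / 24 - cos y)
        (fun y => sin y - y + y ^ 3 / 6)); auto.
      - rewrite cos_0. field.
      - intros z. auto_derive; auto. field. }
    intros y Hy. pose proof (S3 y Hy). repeat split; auto. lra. }
  assert (E : Rabs x * Rabs x = x * x) by (pose proof (Rsqr_abs x) as E; unfold Rsqr in E; lra).
  replace (cos x) with (cos (Rabs x)).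
  2:{ unfold Rabs. destruct (Rcase_abs x); [apply cos_neg | reflexivity]. }
  rewrite <- E. pose proof (Rabs_pos x) as Hp. set (y := Rabs x) in *. clearbody y.
  destruct (G y Hp) as [_ [G1 G2]]. apply Rabs_le. assert (0 <= y * y * (y * y)) by nra.
  split; nra.
Qed.

Definition rot (t : R) : C := (cos t, sin t).

Lemma rot_pow (t : R) (n : nat) : (rot t ^ n)%C = rot (INR n * t).
Proof.
  induction n as [|n IH].
  - simpl. unfold rot. rewrite Rmult_0_l, cos_0, sin_0. reflexivity.
  - rewrite Cpow_S, IH, S_INR. unfold rot, Cmult. simpl.
    replace ((INR n + 1) * t) with (t + INR n * t) by ring.
    rewrite cos_plus, sin_plus. f_equal. ring.
Qed.

Lemma Cmod_rot (t : R) : Cmod (rot t) = 1.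
Proof.
  unfold Cmod, rot. simpl. rewrite !Rmult_1_r.
  pose proof (sin2_cos2 t) as H. unfold Rsqr in H.
  replace (cos t * cos t + sin t * sin t) with 1 by lra. apply sqrt_1.
Qed.

Lemma rot_opp (t : R) : (rot t + rot (- t))%C = RtoC (2 * cos t).
Proof.
  unfold rot. rewrite cos_neg, sin_neg. apply injective_projections; simpl; ring.
Qed.

Lemma unit_disk_mul (u z : C) : Cmod u <= 1 -> unit_disk z -> unit_disk (u * z)%C.
Proof.
  unfold unit_disk. intros Hu Hz. rewrite Cmod_mult.
  pose proof (Cmod_ge_0 z). pose proof (Cmod_ge_0 u). nra.
Qed.

Lemma disk_series_pow (a : nat -> C) (u : C) :
  disk_series a -> Cmod u <= 1 -> disk_series (fun n => a n * u ^ n)%C.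
Proof.
  intros Ha Hu r Hr. destruct (Ha r Hr) as [M HM]. exists M. intros n.
  rewrite Cmod_mult, Cmod_pow. eapply Rle_trans; [|apply (HM n)].
  apply Rmult_le_compat_r; [apply pow_le; lra|].
  rewrite <- (Rmult_1_r (Cmod (a n))) at 2. apply Rmult_le_compat_l; [apply Cmod_ge_0|].
  rewrite <- (pow1 n). apply pow_incr. split; [apply Cmod_ge_0 | exact Hu].
Qed.

Lemma psum_pow (a : nat -> C) (u z : C) :
  disk_series a -> Cmod u <= 1 -> unit_disk z ->
  psum (fun n => a n * u ^ n)%C z = psum a (u * z)%C.
Proof.
  intros Ha Hu Hz. apply psum_unique; auto; [now apply disk_series_pow|].
  generalize (psum_spec a _ Ha (unit_disk_mul u z Hu Hz)). apply tends_ext.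
  intros n. apply csum_ext. intros k _. rewrite Cpow_mult_l. ring.
Qed.

(** Coefficients of [(z d/dz)^2 f = z (f' + z f'')], the second-order term in the rotation angle. *)
Definition sq_coef (a : nat -> C) (n : nat) : C := (RtoC (INR n) * (RtoC (INR n) * a n))%C.

(** Coefficients of the mean of [f(e^{it} z)] and [f(e^{-it} z)]. *)
Definition cos_coef (a : nat -> C) (t : R) (n : nat) : C := (RtoC (cos (INR n * t)) * a n)%C.

Lemma disk_series_sq (a : nat -> C) : disk_series a -> disk_series (sq_coef a).
Proof. intros Ha. apply (disk_series_mul_n _ (disk_series_mul_n a Ha)). Qed.

Lemma cos_coef_rot (a : nat -> C) (t : R) (n : nat) :
  cos_coef a t n = (RtoC (/ 2) * (a n * rot t ^ n) + RtoC (/ 2) * (a n * rot (- t) ^ n))%C.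
Proof.
  rewrite !rot_pow. unfold cos_coef.
  replace (INR n * - t) with (- (INR n * t)) by ring.
  replace (RtoC (cos (INR n * t))) with (RtoC (/ 2) * (rot (INR n * t) + rot (- (INR n * t))))%C
    by (rewrite rot_opp, <- RtoC_mult; f_equal; field).
  ring.
Qed.

Lemma disk_series_cos (a : nat -> C) (t : R) : disk_series a -> disk_series (cos_coef a t).
Proof.
  intros Ha r Hr. destruct (Ha r Hr) as [M HM]. exists M. intros n.
  eapply Rle_trans; [|apply (HM n)]. apply Rmult_le_compat_r; [apply pow_le; lra|].
  unfold cos_coef. rewrite Cmod_mult, Cmod_R.
  pose proof (COS_bound (INR n * t)). pose proof (Cmod_ge_0 (a n)).
  assert (Rabs (cos (INR n * t)) <= 1) by (apply Rabs_le; lra). nra.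
Qed.

(** The weight [1 - / 2] is left unsimplified so that the right side is literally the combination in
    [convex_set] at parameter [/ 2]. *)
Lemma psum_cos (a : nat -> C) (t : R) (z : C) :
  disk_series a -> unit_disk z ->
  psum (cos_coef a t) z =
    (RtoC (1 - / 2) * psum a (rot t * z) + RtoC (/ 2) * psum a (rot (- t) * z))%C.
Proof.
  intros Ha Hz. replace (1 - / 2) with (/ 2) by field.
  assert (Ht : forall t, Cmod (rot t) <= 1) by (intros s; rewrite Cmod_rot; lra).
  rewrite <- !psum_pow by auto. rewrite <- !psum_scal by (auto; now apply disk_series_pow).
  rewrite <- psum_plus by (auto; now apply disk_series_scal, disk_series_pow).
  apply psum_ext; [now apply disk_series_cos | exact Hz|]. intros n. apply cos_coef_rot.
Qed.

(** [cos_quadratic] is applied at [n t] in each term, so [B] bounds the sums of [n^4 |a_n| |z|^n]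
    and is uniform in [t]. *)
Lemma psum_cos_expand (a : nat -> C) (z : C) :
  disk_series a -> unit_disk z -> exists B, 0 <= B /\ forall t,
    Cmod (RtoC 2 * (psum a z - psum (cos_coef a t) z) - RtoC (t * t) * psum (sq_coef a) z)
      <= B * (t * t * (t * t)).
Proof.
  intros Ha Hz. pose proof (disk_series_sq _ (disk_series_sq _ Ha)) as Hs4.
  pose proof Hz as Hz1. unfold unit_disk in Hz1.
  destruct (disk_series_abs _ (Cmod z) Hs4) as [B HB]; [split; [apply Cmod_ge_0 | lra]|].
  exists B. split; [apply (HB O)|]. intros t.
  pose proof (disk_series_cos a t Ha) as Hc. pose proof (disk_series_sq a Ha) as Hs.
  set (b := fun n => (RtoC (2 * (1 - cos (INR n * t)) - INR n * t * (INR n * t)) * a n)%C).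
  assert (E : tends (csum (fun n => b n * z ^ n)%C)
    (RtoC 2 * (psum a z - psum (cos_coef a t) z) - RtoC (t * t) * psum (sq_coef a) z)%C).
  { replace (RtoC 2 * (psum a z - psum (cos_coef a t) z) - RtoC (t * t) * psum (sq_coef a) z)%C
      with (RtoC 2 * psum a z + (- RtoC 2 * psum (cos_coef a t) z +
            - RtoC (t * t) * psum (sq_coef a) z))%C by ring.
    pose proof (tends_plus _ _ _ _ (tends_scal (RtoC 2) _ _ (psum_spec a z Ha Hz))
     (tends_plus _ _ _ _ (tends_scal (- RtoC 2) _ _ (psum_spec _ z Hc Hz))
       (tends_scal (- RtoC (t * t)) _ _ (psum_spec _ z Hs Hz)))) as T.
    revert T. apply tends_ext. intros n. rewrite <- !csum_scal, <- !csum_plus.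
    apply csum_ext. intros k _. unfold b, cos_coef, sq_coef.
    rewrite !RtoC_minus, !RtoC_mult, RtoC_minus. ring. }
  eapply tends_bound; [exact E|]. intros n.
  eapply Rle_trans; [apply Cmod_csum|].
  apply Rle_trans with (rsum (fun k => t * t * (t * t) *
    (Cmod (sq_coef (sq_coef a) k) * Cmod z ^ k)) n).
  - apply rsum_le. intros k _. unfold b, sq_coef.
    rewrite !Cmod_mult, !Cmod_R, Cmod_pow.
    rewrite !(Rabs_pos_eq (INR k)) by apply pos_INR.
    pose proof (cos_quadratic (INR k * t)) as Q.
    assert (0 <= Cmod (a k) * Cmod z ^ k)
      by (apply Rmult_le_pos; [apply Cmod_ge_0 | apply pow_le, Cmod_ge_0]).
    rewrite Rmult_assoc.
    eapply Rle_trans; [apply Rmult_le_compat_r; [assumption | exact Q]|].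
    right. ring.
  - rewrite rsum_scal, (Rmult_comm B). apply Rmult_le_compat_l; [|apply HB].
    pose proof (Rle_0_sqr t) as Q. unfold Rsqr in Q. nra.
Qed.

(** Coefficients of [(z f')' = f' + z f'']; dividing by [f'] gives [1 + z f''/f']. *)
Definition num_coef (a : nat -> C) (n : nat) : C := (RtoC (INR (S n)) * deriv_coef a n)%C.

Lemma disk_series_num (a : nat -> C) : disk_series a -> disk_series (num_coef a).
Proof. intros Ha. exact (disk_series_shift _ 1 (disk_series_sq a Ha)). Qed.

(* Uses [w = z - t^2/2 * z (1 + z f''/f') + o(t^2)] for the preimage [w] of the
   mean of [f(z e^{it})] and [f(z e^{-it})]. *)
Lemma convex_positive (a : nat -> C) (z : C) :
  disk_series a -> a 0%nat = 0 -> a 1%nat = 1 ->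
  injective_on_disk (psum a) -> convex_set (disk_range (psum a)) -> unit_disk z ->
  0 <= Re (psum (num_coef a) z / psum (deriv_coef a) z)%C.
Proof.
  intros Ha Ha0 Ha1 Hinj Hconv Hz.
  pose proof (disk_series_num a Ha) as HN. pose proof (disk_series_deriv a Ha) as HD.
  destruct (classic (z = 0)) as [->|Hz0].
  { rewrite !psum_0 by auto. unfold num_coef, deriv_coef. rewrite Ha1. simpl.
    replace (RtoC 1 * (RtoC 1 * RtoC 1) / (RtoC 1 * RtoC 1))%C with (RtoC 1)
      by (field; intros E; apply RtoC_inj in E; lra).
    simpl. lra. }
  set (d := psum (deriv_coef a) z).
  assert (Hd : d <> 0) by now apply univalent_deriv_nonzero.
  set (E := psum (sq_coef a) z).
  assert (EE : E = (z * psum (num_coef a) z)%C).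
  { unfold E. rewrite psum_shift by (auto; now apply disk_series_sq).
    unfold sq_coef at 1. simpl INR. rewrite Cmult_0_l, Cplus_0_l. reflexivity. }
  set (P := psum (synthetic a z)).
  assert (EP : P z = d) by (apply psum_synthetic_diag; auto).
  assert (HP : cont_at P z)
    by (apply psum_cont; [now apply disk_series_synthetic | exact Hz]).
  assert (HX : cont_at (fun w => / P w)%C z) by (apply cont_at_inv; rewrite ?EP; auto).
  pose proof (cont_at_nonzero _ _ HP ltac:(now rewrite EP)) as HPn.
  destruct (psum_cos_expand a z Ha Hz) as [B [HB0 HB]]. fold E in HB.
  assert (Hpre : forall t w, unit_disk w -> psum a w = psum (cos_coef a t) z ->
                 Cmod w <= Cmod z).
  { intros t w Hw Ew.
    apply (subordination_schwarz a (cos_coef a t)); auto.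
    - now apply disk_series_cos.
    - unfold cos_coef. rewrite Ha0. ring.
    - intros x Hx. rewrite psum_cos by auto.
      destruct (Hconv (psum a (rot t * x)) (psum a (rot (- t) * x)) (/ 2)) as [y Hy];
        [ | | lra | now exists y];
        (eexists; split; [apply unit_disk_mul; [|exact Hx] | reflexivity];
         rewrite Cmod_rot; lra). }
  apply Rnot_lt_le. intros Hneg. set (m := (psum (num_coef a) z / d)%C) in *.
  pose proof (Cmod_pos _ Hz0) as Hzp.
  set (L := Cmod z * (Cmod E + 2 / Cmod d + 1)).
  pose proof (Cmod_pos _ Hd) as Hdp.
  assert (HL : 0 < L).
  { unfold L. apply Rmult_lt_0_compat; [exact Hzp|]. pose proof (Cmod_ge_0 E).
    assert (0 < 2 / Cmod d) by (apply Rdiv_lt_0_compat; lra). lra. }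
  (* The errors below add up to less than [t^2 k L = - t^2 |z|^2 Re m], exactly what makes
     [Re (conj z * y)] negative when [y] is close to [t^2 z m]. *)
  set (k := - Re m * (Cmod z * Cmod z) / L).
  assert (Hk : 0 < k) by (unfold k; apply Rdiv_lt_0_compat; [|exact HL];
    apply Rmult_lt_0_compat; [lra | now apply Rmult_lt_0_compat]).
  destruct (near_and _ _ _ (HX k Hk) HPn) as [e [He HXe]].
  destruct (univalent_open a z e Ha Hinj Hz He) as [e2 [He2 HO]].
  (* The first smallness makes the fourth-order remainder at most [k t^2]; the second puts the mean
     [G] within [e2] of [psum a z], so that openness supplies a preimage near [z]. *)
  assert (Hts : exists t, 0 < t /\ B * (t * t) < k /\ B * (t * t * (t * t)) + t * t * Cmod E < e2).
  { set (M := B + Cmod E + 1). assert (HM : 1 <= M) by (unfold M; pose proof (Cmod_ge_0 E); lra).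
    set (t := Rmin 1 (Rmin (k / (2 * M)) (e2 / (2 * M)))). exists t.
    assert (T0 : 0 < t) by (apply Rmin_pos; [lra | apply Rmin_pos; apply Rdiv_lt_0_compat; lra]).
    assert (T1 : t <= 1) by apply Rmin_l.
    assert (T2 : t <= Rmin (k / (2 * M)) (e2 / (2 * M))) by apply Rmin_r.
    assert (T3 : t <= k / (2 * M)) by (eapply Rle_trans; [exact T2 | apply Rmin_l]).
    assert (T4 : t <= e2 / (2 * M)) by (eapply Rle_trans; [exact T2 | apply Rmin_r]).
    assert (T5 : 0 < t * t <= t) by nra.
    assert (T3' : t * M <= k / 2).
    { apply Rmult_le_compat_r with (r := M) in T3; [|lra].
      replace (k / (2 * M) * M) with (k / 2) in T3 by (field; lra). exact T3. }
    assert (T4' : t * M <= e2 / 2).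
    { apply Rmult_le_compat_r with (r := M) in T4; [|lra].
      replace (e2 / (2 * M) * M) with (e2 / 2) in T4 by (field; lra). exact T4. }
    assert (0 <= Cmod E) by apply Cmod_ge_0.
    assert (BM : B * (t * t) <= M * t) by (apply Rmult_le_compat; unfold M in *; lra).
    assert (T6 : (B + Cmod E) * (t * t) <= M * t)
      by (apply Rmult_le_compat; unfold M in *; lra).
    split; [exact T0|]. split; [lra|].
    assert (B * (t * t * (t * t)) <= B * (t * t)).
    { apply Rmult_le_compat_l; [exact HB0|]. nra. }
    lra. }
  destruct Hts as [t [Ht [Ht1 Ht2]]].
  assert (Htt : 0 < t * t) by nra.
  specialize (HB t).
  set (G := psum (cos_coef a t) z) in *. set (rho := (RtoC 2 * (psum a z - G) - RtoC (t * t) * E)%C) in *.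
  assert (HG : Cmod (G - psum a z) < e2).
  { replace (G - psum a z)%C with (RtoC (/ 2) * (- (rho + RtoC (t * t) * E)))%C.
    2:{ unfold rho. rewrite RtoC_inv by lra. field. }
    rewrite Cmod_mult, Cmod_R, Cmod_opp, Rabs_pos_eq by lra.
    pose proof (Cmod_triangle rho (RtoC (t * t) * E)) as T.
    rewrite Cmod_mult, Cmod_R, Rabs_pos_eq in T by lra.
    pose proof (Cmod_ge_0 (rho + RtoC (t * t) * E)). lra. }
  destruct (HO G HG) as [w [Hw [Hwz Ew]]].
  pose proof (Hpre t w Hw Ew) as Hle.
  destruct (HXe w Hwz) as [X1 X2]. rewrite EP in X1, X2.
  assert (HPw : P w <> 0) by (apply Cmod_neq_0; lra).
  pose proof (psum_factor a w z Ha Hw Hz) as EF. fold P in EF. rewrite Ew in EF.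
  assert (Ek : (w - z)%C = (RtoC (- / 2) * ((rho + RtoC (t * t) * E) / P w))%C).
  { replace (w - z)%C with ((G - psum a z) / P w)%C by (rewrite EF; field; exact HPw).
    unfold rho. rewrite RtoC_opp, RtoC_inv by lra. field. exact HPw. }
  set (y := ((rho + RtoC (t * t) * E) / P w)%C) in *.
  (* [w = z - y/2], so [|w| <= |z|] reads [Re (conj z * y) >= |y|^2 / 4]. *)
  assert (Hre : 0 <= Re (Cconj z * y)%C).
  { assert (S1 : Cmod w * Cmod w <= Cmod z * Cmod z)
      by (pose proof (Cmod_ge_0 w); nra).
    replace w with (z + RtoC (- / 2) * y)%C in S1 by (rewrite <- Ek; ring).
    rewrite !Cmod_sqr in S1. destruct z as [z1 z2], y as [y1 y2]. simpl in *. nra. }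
  assert (Hy : (y - RtoC (t * t) * (z * m))%C =
     (RtoC (t * t) * E * (/ P w - / d) + rho * / P w)%C).
  { unfold y, m. rewrite EE. field. auto. }
  assert (Hyb : Cmod (y - RtoC (t * t) * (z * m)) < t * t * (k * (Cmod E + 2 / Cmod d + 1))).
  { rewrite Hy. eapply Rle_lt_trans; [apply Cmod_triangle|].
    rewrite !Cmod_mult, Cmod_R, (Rabs_pos_eq (t * t)) by lra.
    rewrite (Cmod_inv (P w)) by exact HPw.
    assert (I : / Cmod (P w) <= 2 / Cmod d).
    { replace (2 / Cmod d) with (/ (Cmod d / 2)) by (field; lra).
      apply Rinv_le_contravar; lra. }
    assert (0 < / Cmod (P w)) by (apply Rinv_0_lt_compat; lra).
    assert (J1 : Cmod E * Cmod (/ P w - / d) <= Cmod E * k)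
      by (apply Rmult_le_compat_l; [apply Cmod_ge_0 | lra]).
    assert (J2 : Cmod rho * / Cmod (P w) <= t * t * (k * (2 / Cmod d))).
    { apply Rle_trans with ((t * t * k) * (2 / Cmod d)); [|right; ring].
      apply Rmult_le_compat; [apply Cmod_ge_0 | lra | | exact I].
      eapply Rle_trans; [exact HB|].
      replace (B * (t * t * (t * t))) with (t * t * (B * (t * t))) by ring.
      apply Rmult_le_compat_l; lra. }
    assert (0 < t * t * k) by (apply Rmult_lt_0_compat; lra).
    assert (t * t * (Cmod E * Cmod (/ P w - / d)) <= t * t * (Cmod E * k))
      by (apply Rmult_le_compat_l; lra).
    lra. }
  assert (Hfin : Re (Cconj z * (y - RtoC (t * t) * (z * m)))%C < t * t * (k * L)).
  { apply Rle_lt_trans with (Cmod (Cconj z * (y - RtoC (t * t) * (z * m)))%C).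
    - eapply Rle_trans; [apply Rle_abs | apply re_le_Cmod].
    - rewrite Cmod_mult, Cmod_conj. unfold L.
      replace (t * t * (k * (Cmod z * (Cmod E + 2 / Cmod d + 1))))
        with (Cmod z * (t * t * (k * (Cmod E + 2 / Cmod d + 1)))) by ring.
      apply Rmult_lt_compat_l; assumption. }
  replace (k * L) with (- Re m * (Cmod z * Cmod z)) in Hfin by (unfold k; field; lra).
  replace (Cconj z * (y - RtoC (t * t) * (z * m)))%C
    with (Cconj z * y - RtoC (t * t) * (Cconj z * z * m))%C in Hfin by ring.
  rewrite Cmod_sqr in Hfin. clear - Hfin Hre.
  destruct z as [z1 z2], y as [y1 y2], m as [m1 m2]. simpl in *. lra.
Qed.

(** * Averages over roots of unity *)

Definition root (N k : nat) : C := rot (INR k * (2 * PI / INR N)).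

(** A finite stand-in for the mean over the unit circle, exact on the powers [u^l] with [l < N]. *)
Definition avg (N : nat) (F : C -> C) : C :=
  (RtoC (/ INR N) * csum (fun k => F (root N k)) N)%C.

Lemma unit_conj (u : C) : Cmod u = 1 -> (u * Cconj u)%C = 1.
Proof. intros Hu. rewrite <- Cmod2_conj, Hu. f_equal. ring. Qed.

Lemma Cmod_root (N k : nat) : Cmod (root N k) = 1.
Proof. apply Cmod_rot. Qed.

Lemma csum_geom (q : C) (n : nat) :
  q <> 1 -> (q ^ n)%C = 1 -> csum (fun k => q ^ k)%C n = 0.
Proof.
  intros Hq Hn.
  assert (E : ((q - 1) * csum (fun k => q ^ k) n = q ^ n - 1)%C).
  { clear Hn. induction n as [|n IH]; [simpl; ring|].
    cbn [csum]. rewrite Cmult_plus_distr_l, IH, Cpow_S. ring. }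
  rewrite Hn in E.
  replace (csum (fun k => q ^ k)%C n) with ((q - 1) * csum (fun k => q ^ k) n / (q - 1))%C
    by (field; now apply Cminus_neq_0).
  rewrite E. field. now apply Cminus_neq_0.
Qed.

Lemma avg_root_pow (N l : nat) :
  (0 < l < N)%nat -> avg N (fun u => u ^ l)%C = 0.
Proof.
  intros Hl. unfold avg.
  assert (HN : 0 < INR N) by (apply lt_0_INR; lia).
  set (x := INR l * (2 * PI / INR N)).
  rewrite (csum_ext _ (fun k => rot x ^ k)%C).
  - rewrite csum_geom; [ring | |].
    (* The geometric ratio is not 1, since [cos x = 1 - 2 sin(x/2)^2 < 1]. *)
    + assert (Hx : 0 < x / 2 < PI).
      { pose proof PI_RGT_0. assert (0 < INR l) by (apply lt_0_INR; lia).
        assert (INR l < INR N) by (apply lt_INR; lia).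
        replace (x / 2) with (PI * (INR l / INR N)) by (unfold x; field; lra).
        assert (0 < INR l / INR N < 1).
        { split; [apply Rdiv_lt_0_compat | apply ratio_lt_1]; lra. }
        split; [apply Rmult_lt_0_compat; lra|].
        rewrite <- (Rmult_1_r PI) at 2. apply Rmult_lt_compat_l; lra. }
      intros E. apply (f_equal fst) in E. simpl in E.
      replace x with (2 * (x / 2)) in E by field. rewrite cos_2a_sin in E.
      pose proof (sin_gt_0 (x / 2) ltac:(lra) ltac:(lra)). nra.
    + rewrite rot_pow. unfold x.
      replace (INR N * (INR l * (2 * PI / INR N))) with (0 + 2 * INR l * PI) by (field; lra).
      unfold rot. rewrite cos_period, sin_period, cos_0, sin_0. reflexivity.
  - intros k _. unfold root. rewrite !rot_pow. unfold x. f_equal. ring.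
Qed.

Lemma avg_const (N : nat) (c : C) : (0 < N)%nat -> avg N (fun _ => c) = c.
Proof.
  intros HN. assert (H : 0 < INR N) by (apply lt_0_INR; lia). unfold avg.
  assert (E : forall n, csum (fun _ => c) n = (RtoC (INR n) * c)%C).
  { intros n. induction n as [|n IH]; [simpl; ring|].
    cbn [csum]. rewrite IH, S_INR, RtoC_plus. ring. }
  rewrite E, Cmult_assoc, <- RtoC_mult, Rinv_l by lra. ring.
Qed.

Lemma avg_ext (N : nat) (F G : C -> C) :
  (forall u, Cmod u = 1 -> (u ^ N)%C = 1 -> F u = G u) -> avg N F = avg N G.
Proof.
  intros E. unfold avg. f_equal. apply csum_ext. intros k Hk. apply E; [apply Cmod_root|].
  assert (HN : 0 < INR N) by (apply lt_0_INR; lia).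
  unfold root. rewrite rot_pow.
  replace (INR N * (INR k * (2 * PI / INR N))) with (0 + 2 * INR k * PI) by (field; lra).
  unfold rot. rewrite cos_period, sin_period, cos_0, sin_0. reflexivity.
Qed.

Lemma avg_plus (N : nat) (F G : C -> C) :
  avg N (fun u => F u + G u)%C = (avg N F + avg N G)%C.
Proof. unfold avg. rewrite csum_plus. ring. Qed.

Lemma avg_scal (N : nat) (c : C) (F : C -> C) :
  avg N (fun u => c * F u)%C = (c * avg N F)%C.
Proof. unfold avg. rewrite csum_scal. ring. Qed.

Lemma avg_csum (N n : nat) (F : nat -> C -> C) :
  avg N (fun u => csum (fun k => F k u) n) = csum (fun k => avg N (F k)) n.
Proof.
  unfold avg. rewrite csum_swap, <- csum_scal. reflexivity.
Qed.

Lemma avg_bound (N : nat) (F : C -> C) (M : R) :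
  (0 < N)%nat -> (forall u, Cmod u = 1 -> Cmod (F u) <= M) -> Cmod (avg N F) <= M.
Proof.
  intros HN HF. assert (H : 0 < INR N) by (apply lt_0_INR; lia).
  unfold avg. rewrite Cmod_mult, Cmod_R, Rabs_pos_eq
    by (left; now apply Rinv_0_lt_compat).
  apply Rmult_le_reg_l with (INR N); [exact H|].
  rewrite <- Rmult_assoc, Rinv_r, Rmult_1_l by lra.
  eapply Rle_trans; [apply Cmod_csum|].
  apply Rle_trans with (rsum (fun _ => M) N).
  - apply rsum_le. intros k _. apply HF, Cmod_root.
  - right. clear. induction N as [|N IH]; [simpl; ring|].
    cbn [rsum]. rewrite IH, S_INR. ring.
Qed.

Lemma smooth_avg (n N : nat) (F : C -> C -> C) (c : C) :
  (forall u, Cmod u = 1 -> smooth n (fun z => F z u) c) ->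
  smooth n (fun z => avg N (F z)) c.
Proof.
  intros HF. unfold avg. apply smooth_mult; [apply smooth_const|].
  generalize N at 2. intros m. induction m as [|m IH]; cbn [csum]; [apply smooth_const|].
  apply smooth_plus; [exact IH | apply HF, Cmod_root].
Qed.

(** On the roots of unity [conj u ^ l = u ^ (N - l)]. *)
Lemma avg_conj_pow (N l : nat) :
  (0 < l < N)%nat -> avg N (fun u => Cconj u ^ l)%C = 0.
Proof.
  intros Hl. rewrite <- (avg_root_pow N (N - l)) by lia. apply avg_ext.
  intros u H1 HN.
  pose proof (unit_conj u H1) as E.
  transitivity (u ^ N * Cconj u ^ l)%C; [rewrite HN; ring|].
  replace N with (N - l + l)%nat at 1 by lia.
  rewrite Cpow_add_r, <- Cmult_assoc, <- Cpow_mult_l, E, Cpow_1_l. ring.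
Qed.

(** * Positivity of the Toeplitz forms of a quotient *)

(** Long division of power series with [d 0 = 1]: [rem N d m] is the series [R] with [N = (q_0 + ...
    + q_(m-1) z^(m-1)) d + z^m R], and its leading coefficient is the next [q_m]. *)
Fixpoint rem (N d : nat -> C) (m : nat) : nat -> C :=
  match m with
  | O => N
  | S m => fun k => (rem N d m (S k) - rem N d m 0 * d (S k))%C
  end.

(* The Taylor coefficients of [N / d]. *)
Definition quot (N d : nat -> C) (m : nat) : C := rem N d m 0.

Lemma rem_formula (N d : nat -> C) (m k : nat) :
  rem N d m k = (N (m + k)%nat - csum (fun j => quot N d j * d (m + k - j)%nat) m)%C.
Proof.
  revert k. induction m as [|m IH]; intros k; [simpl; ring|].
  cbn [rem csum]. fold (quot N d m). rewrite IH.
  replace (m + S k)%nat with (S m + k)%nat by lia.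
  replace (S m + k - m)%nat with (S k) by lia. ring.
Qed.

Lemma quot_mul (N d : nat -> C) (m : nat) :
  d 0%nat = 1 -> csum (fun j => quot N d j * d (m - j)%nat)%C (S m) = N m.
Proof.
  intros H0. cbn [csum]. rewrite Nat.sub_diag, H0. unfold quot at 2.
  rewrite rem_formula. rewrite Nat.add_0_r. ring.
Qed.

Lemma disk_series_rem (N d : nat -> C) (m : nat) :
  disk_series N -> disk_series d -> disk_series (rem N d m).
Proof.
  intros HN Hd. induction m as [|m IH]; [exact HN|]. cbn [rem].
  pose proof (disk_series_plus _ _ (disk_series_shift _ 1 IH)
    (disk_series_scal (- rem N d m 0) _ (disk_series_shift _ 1 Hd))) as H.
  intros r Hr. destruct (H r Hr) as [M HM]. exists M. intros n.
  specialize (HM n). simpl in HM.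
  replace (rem N d m (S n) - rem N d m 0 * d (S n))%C
    with (rem N d m (S n) + - rem N d m 0 * d (S n))%C by ring. exact HM.
Qed.

(** [N/d] minus its first [m] Taylor terms, divided by [z^m]; going through [rem] leaves no
    singularity at 0. *)
Definition tail (N d : nat -> C) (m : nat) (z : C) : C := (psum (rem N d m) z / psum d z)%C.

Lemma tail_step (N d : nat -> C) (m : nat) (z : C) :
  disk_series N -> disk_series d -> d 0%nat = 1 -> unit_disk z -> psum d z <> 0 ->
  tail N d m z = (quot N d m + z * tail N d (S m) z)%C.
Proof.
  intros HN Hd H0 Hz Hn. unfold tail.
  pose proof (disk_series_rem N d m HN Hd) as Hm.
  assert (E : psum (rem N d (S m)) z =
    (psum (fun k => rem N d m (S k)) z - quot N d m * psum (fun k => d (S k)) z)%C).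
  { rewrite (psum_ext _ (fun k => rem N d m (S k) + - quot N d m * d (S k))%C);
      [ | now apply disk_series_rem | exact Hz | intros n; unfold quot; cbn [rem]; ring].
    pose proof (disk_series_shift _ 1 Hm) as H1. pose proof (disk_series_shift _ 1 Hd) as H2.
    cbn in H1, H2.
    rewrite psum_plus by (auto; now apply disk_series_scal).
    rewrite psum_scal by auto. ring. }
  rewrite E, (psum_shift (rem N d m)) by auto.
  pose proof (psum_shift d z Hd Hz) as Ed. rewrite H0 in Ed.
  fold (quot N d m). set (X := psum (fun k => rem N d m (S k)) z) in *.
  set (Y := psum (fun k => d (S k)) z) in *. set (p := quot N d m) in *.
  rewrite Ed in *. field. exact Hn.
Qed.

Lemma tail_taylor (N d : nat -> C) (m n : nat) (z : C) :
  disk_series N -> disk_series d -> d 0%nat = 1 -> unit_disk z -> psum d z <> 0 ->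
  tail N d m z =
    (csum (fun k => quot N d (m + k) * z ^ k) n + z ^ n * tail N d (m + n) z)%C.
Proof.
  intros HN Hd H0 Hz Hn. induction n as [|n IH].
  - simpl. rewrite Nat.add_0_r. ring.
  - rewrite IH, (tail_step N d (m + n)) by auto.
    replace (m + S n)%nat with (S (m + n)) by lia. cbn [csum]. rewrite Cpow_S. ring.
Qed.

Lemma smooth_tail (n : nat) (N d : nat -> C) (m : nat) (z : C) :
  disk_series N -> disk_series d -> unit_disk z -> psum d z <> 0 ->
  smooth n (tail N d m) z.
Proof.
  intros HN Hd Hz Hn. apply smooth_div; [| |exact Hn]; apply smooth_psum; auto.
  now apply disk_series_rem.
Qed.

Lemma tends_pow_0 (q : R) (c : R) (e : R) :
  0 <= q < 1 -> 0 < e -> exists n0, forall n, (n0 <= n)%nat -> c * q ^ n < e.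
Proof.
  intros Hq He. set (c' := Rabs c + 1).
  assert (Hc : 0 < c') by (unfold c'; pose proof (Rabs_pos c); lra).
  destruct (pow_lt_1_zero q) with (y := e / c') as [n0 H0].
  - rewrite Rabs_pos_eq; lra.
  - now apply Rdiv_lt_0_compat.
  - exists n0. intros n Hn. specialize (H0 n Hn).
    assert (Hp : 0 <= q ^ n) by (apply pow_le; lra).
    rewrite Rabs_pos_eq in H0 by exact Hp.
    apply Rle_lt_trans with (c' * q ^ n).
    + apply Rmult_le_compat_r; [exact Hp|]. unfold c'. pose proof (Rle_abs c). lra.
    + apply Rmult_lt_compat_l with (r := c') in H0; [|exact Hc].
      replace (c' * (e / c')) with e in H0 by (field; lra). exact H0.
Qed.

(* Discrete Cauchy theorem: up to the aliasing at order [N] the average vanishes,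
   and the maximum principle bounds the aliased part by [(r/R)^(N-l)]. *)
Lemma avg_tail_vanish (N d : nat -> C) (m l : nat) (r : R) :
  disk_series N -> disk_series d -> d 0%nat = 1 ->
  (forall z, unit_disk z -> psum d z <> 0) -> 0 < r < 1 -> (0 < l)%nat ->
  tends (fun n => avg n (fun u => u ^ l * tail N d m (RtoC r * u)))%C 0.
Proof.
  intros HN Hd H0 Hnz Hr Hl e He.
  set (s := (1 + r) / 2). assert (Hs : r < s < 1) by (unfold s; lra).
  destruct (circle_bound (tail N d m) 0 s ltac:(lra)) as [z1 [_ HM]].
  { intros z Hz. replace (z - 0)%C with z in Hz by ring.
    assert (Dz : unit_disk z) by (unfold unit_disk; lra).
    apply (smooth_cont 0). apply smooth_tail; auto. }
  set (M := Cmod (tail N d m z1)) in *. assert (HM0 : 0 <= M) by apply Cmod_ge_0.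
  assert (Hin : forall w u, Cmod w <= s -> Cmod u = 1 -> unit_disk (w * u)%C).
  { intros w u Hw Hu. unfold unit_disk. rewrite Cmod_mult, Hu. lra. }
  (* Expand [tail] to order [n - l]: the powers [u^(l+k)] with [k < n - l] average to 0, and in the
     remainder [u^l u^(n-l) = u^n = 1]. *)
  assert (Alias : forall n w, (l < n)%nat -> Cmod w <= s ->
    avg n (fun u => u ^ l * tail N d m (w * u))%C =
    (w ^ (n - l) * avg n (fun u => tail N d (m + (n - l)) (w * u)))%C).
  { intros n w Hn Hw.
    rewrite (avg_ext n _ (fun u =>
      csum (fun k => (quot N d (m + k) * w ^ k) * u ^ (l + k)) (n - l) +
      w ^ (n - l) * tail N d (m + (n - l)) (w * u)))%C.
    - rewrite avg_plus, avg_scal, avg_csum.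
      rewrite (csum_ext _ (fun _ => RtoC 0)).
      + rewrite csum_0. ring.
      + intros k Hk. rewrite avg_scal, avg_root_pow by lia. ring.
    - intros u Hu Hun. rewrite (tail_taylor N d m (n - l)) by auto.
      rewrite Cmult_plus_distr_l, <- csum_scal. f_equal.
      + apply csum_ext. intros k _. rewrite Cpow_mult_l, Cpow_add_r. ring.
      + rewrite Cpow_mult_l.
        transitivity (u ^ (l + (n - l)) * (w ^ (n - l) * tail N d (m + (n - l)) (w * u)))%C;
          [rewrite Cpow_add_r; ring|].
        replace (l + (n - l))%nat with n by lia. rewrite Hun. ring. }
  assert (Bound : forall n, (l < n)%nat ->
    Cmod (avg n (fun u => u ^ l * tail N d m (RtoC r * u))%C) <= M * (r / s) ^ (n - l)).
  { intros n Hn.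
    assert (Er : Cmod (RtoC r) = r) by (rewrite Cmod_R, Rabs_pos_eq; lra).
    rewrite Alias by (auto; lra). rewrite Cmod_mult, Cmod_pow, Er.
    set (J := fun w => avg n (fun u => tail N d (m + (n - l)) (w * u)%C)).
    assert (Hsp : 0 < s ^ (n - l)) by (apply pow_lt; lra).
    (* On [|w| = s] the aliasing identity read backwards gives [s^(n-l) |J w| <= M]; the maximum
       principle carries the bound on [J] inward to [r]. *)
    assert (HJ : Cmod (J (RtoC r)) <= M / s ^ (n - l)).
    { apply (maximum_principle J 0 s).
      - apply Rmult_le_pos; [exact HM0 | left; now apply Rinv_0_lt_compat].
      - intros w Hw. replace (w - 0)%C with w in Hw by ring. unfold J.
        apply (smooth_avg 2 n (fun w u => tail N d (m + (n - l)) (w * u)%C)).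
        intros u Hu.
        apply (smooth_comp 2 (fun z => z * u)%C).
        + apply smooth_mult; [apply smooth_id | apply smooth_const].
        + apply smooth_tail; auto.
      - intros w Hw. replace (w - 0)%C with w in Hw by ring.
        assert (HA : Cmod (w ^ (n - l) * J w)%C <= M).
        { unfold J. rewrite <- Alias by (auto; lra). apply avg_bound; [lia|].
          intros u Hu. rewrite Cmod_mult, Cmod_pow, Hu, pow1, Rmult_1_l. apply HM.
          replace (w * u - 0)%C with (w * u)%C by ring. rewrite Cmod_mult, Hu. lra. }
        rewrite Cmod_mult, Cmod_pow, Hw in HA.
        apply Rmult_le_reg_l with (s ^ (n - l)); [exact Hsp|].
        replace (s ^ (n - l) * (M / s ^ (n - l))) with M by (field; lra). exact HA.
      - replace (RtoC r - 0)%C with (RtoC r) by ring. lra. }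
    unfold Rdiv in *. rewrite Rpow_mult_distr, pow_inv.
    assert (0 <= r ^ (n - l)) by (apply pow_le; lra).
    apply Rmult_le_compat_l with (r := r ^ (n - l)) in HJ; [|assumption].
    fold (J (RtoC r)). lra. }
  destruct (tends_pow_0 (r / s) M e) as [n0 Hn0]; [|exact He|].
  { apply ratio_lt_1. lra. }
  exists (n0 + S l)%nat. intros n Hn.
  unfold Cminus. rewrite Copp_0, Cplus_0_r.
  eapply Rle_lt_trans; [apply Bound; lia|]. apply Hn0. lia.
Qed.

(** For [j <= i], expanding to degree [i - j] isolates a constant term: lower terms become powers of
    [conj u] and average to 0, the remainder is removed by [avg_tail_vanish]. For [j > i] only a
    positive power of [u] times [tail] is left. *)
Lemma avg_fourier (N d : nat -> C) (i j : nat) (r : R) :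
  disk_series N -> disk_series d -> d 0%nat = 1 ->
  (forall z, unit_disk z -> psum d z <> 0) -> 0 < r < 1 ->
  tends (fun n => avg n (fun u => tail N d 0 (RtoC r * u) * (u ^ j * Cconj u ^ i)))%C
    (if Nat.leb j i then quot N d (i - j) * RtoC (r ^ (i - j)) else 0)%C.
Proof.
  intros HN Hd H0 Hnz Hr.
  destruct (Nat.leb_spec j i) as [Hji|Hij].
  - set (s := (i - j)%nat).
    pose proof (tends_scal (RtoC (r ^ S s)) _ _
      (avg_tail_vanish N d (S s) 1 r HN Hd H0 Hnz Hr ltac:(lia))) as T.
    pose proof (tends_plus _ _ _ _ (tends_const (quot N d s * RtoC (r ^ s))%C) T) as T2.
    replace (quot N d s * RtoC (r ^ s) + RtoC (r ^ S s) * 0)%C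
      with (quot N d s * RtoC (r ^ s))%C in T2 by ring.
    intros e He. destruct (T2 e He) as [n0 Hn0]. exists (n0 + S s)%nat. intros n Hn.
    specialize (Hn0 n ltac:(lia)). clear T T2.
    cbv beta in *.
    match goal with H : Cmod (?x - _) < _ |- Cmod (?y - _) < _ => replace y with x; [exact H|] end.
    clear Hn0.
    rewrite (avg_ext n (fun u => tail N d 0 (RtoC r * u) * (u ^ j * Cconj u ^ i))%C (fun u =>
      csum (fun k => (quot N d k * RtoC (r ^ k)) * (Cconj u ^ (s - k))) s +
      (quot N d s * RtoC (r ^ s) + RtoC (r ^ S s) * (u ^ 1 * tail N d (S s) (RtoC r * u)))))%C.
    + rewrite !avg_plus, avg_csum, avg_const, avg_scal by lia.
      rewrite (csum_ext _ (fun _ => RtoC 0)), csum_0; [ring|].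
      intros k Hk. rewrite avg_scal, avg_conj_pow by lia. ring.
    + intros u Hu _. pose proof (unit_conj u Hu) as E.
      replace (u ^ j * Cconj u ^ i)%C with (Cconj u ^ s)%C.
      2:{ replace i with (j + s)%nat by (unfold s; lia).
          rewrite Cpow_add_r, Cmult_assoc, <- Cpow_mult_l, E, Cpow_1_l. ring. }
      assert (Du : unit_disk (RtoC r * u)%C).
      { unfold unit_disk. rewrite Cmod_mult, Hu, Cmod_R, Rabs_pos_eq; lra. }
      rewrite (tail_taylor N d 0 (S s)) by auto.
      assert (Ek : forall k, (k <= s)%nat -> (u ^ k * Cconj u ^ s)%C = (Cconj u ^ (s - k))%C).
      { intros k Hk. replace s with (k + (s - k))%nat at 1 by lia.
        rewrite Cpow_add_r, Cmult_assoc, <- Cpow_mult_l, E, Cpow_1_l. ring. }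
      rewrite Cmult_plus_distr_r, (Cmult_comm (csum _ _)), <- csum_scal.
      cbn [csum]. rewrite <- Cplus_assoc. f_equal.
      * apply csum_ext. intros k Hk. rewrite <- Ek by lia.
        rewrite Cpow_mult_l, RtoC_pow. simpl. ring.
      * pose proof (Ek s (le_n s)) as Es. rewrite Nat.sub_diag in Es.
        change (Cconj u ^ 0)%C with (RtoC 1) in Es.
        rewrite !Cpow_mult_l, !RtoC_pow, !Cpow_S.
        change (0 + s)%nat with s. change (0 + S s)%nat with (S s).
        transitivity ((u ^ s * Cconj u ^ s) * (quot N d s * RtoC r ^ s +
          RtoC r * RtoC r ^ s * (u * tail N d (S s) (RtoC r * u))))%C; [ring|].
        rewrite Es. change (u ^ 0)%C with (RtoC 1). ring.
  - pose proof (avg_tail_vanish N d 0 (j - i) r HN Hd H0 Hnz Hr ltac:(lia)) as T.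
    revert T. apply tends_ext. intros n. apply avg_ext. intros u Hu _.
    replace (u ^ j)%C with (u ^ (j - i) * u ^ i)%C
      by (rewrite <- Cpow_add_r; f_equal; lia).
    transitivity (u ^ (j - i) * (u ^ i * Cconj u ^ i) * tail N d 0 (RtoC r * u))%C; [|ring].
    rewrite <- Cpow_mult_l, (unit_conj u Hu), Cpow_1_l. ring.
Qed.

Lemma tends_csum (F : nat -> nat -> C) (L : nat -> C) (m : nat) :
  (forall k, tends (fun n => F n k) (L k)) ->
  tends (fun n => csum (F n) m) (csum L m).
Proof.
  intros H. induction m as [|m IH]; cbn [csum]; [apply tends_const|].
  now apply tends_plus.
Qed.

Lemma tends_Re_nonneg (u : nat -> C) (l : C) (n0 : nat) :
  tends u l -> (forall n, (n0 <= n)%nat -> 0 <= Re (u n)) -> 0 <= Re l.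
Proof.
  intros H Hu. apply Rnot_lt_le. intros Hl.
  destruct (H (- Re l) ltac:(lra)) as [n1 Hn1]. specialize (Hn1 (n0 + n1)%nat ltac:(lia)).
  specialize (Hu (n0 + n1)%nat ltac:(lia)). set (x := u (n0 + n1)%nat) in *.
  pose proof (Rle_abs (Re (x - l))) as A. pose proof (re_le_Cmod (x - l)) as B.
  replace (Re (x - l)) with (Re x - Re l) in * by (destruct x, l; reflexivity). lra.
Qed.

Lemma csum_truncate (F : nat -> C) (i n : nat) :
  (i < n)%nat -> csum (fun j => if Nat.leb j i then F j else RtoC 0) n = csum F (S i).
Proof.
  intros Hi. induction n as [|n IH]; [lia|]. cbn [csum].
  destruct (Nat.leb_spec n i) as [L|L].
  - assert (n = i) by lia. subst n. cbn [csum]. f_equal. apply csum_ext.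
    intros k Hk. destruct (Nat.leb_spec k i); [reflexivity | lia].
  - rewrite IH by lia. cbn [csum]. ring.
Qed.

(** The average of [tail(r u) |Q(u)|^2], with [Q] the polynomial of coefficients [x], has
    nonnegative real part; let the number of roots tend to infinity, then [r] to 1. Averaging the
    function itself and not its real part yields only the entries [j <= i], that is, half the
    Hermitian form. *)
Lemma toeplitz_positive (N d : nat -> C) :
  disk_series N -> disk_series d -> d 0%nat = 1 ->
  (forall z, unit_disk z -> psum d z <> 0) ->
  (forall z, unit_disk z -> 0 <= Re (psum N z / psum d z)%C) ->
  forall (x : nat -> C) (m : nat),
  0 <= Re (csum (fun i => Cconj (x i) * csum (fun j => x j * quot N d (i - j)) (S i)) m)%C.
Proof.
  intros HN Hd H0 Hnz Hpos x m.
  assert (HT : forall r, 0 < r < 1 -> 0 <= Re (csum (fun i => Cconj (x i) *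
    csum (fun j => x j * (quot N d (i - j) * RtoC (r ^ (i - j)))) (S i)) m)%C).
  { intros r Hr.
    set (U := (fun n => csum (fun i => Cconj (x i) * csum (fun j => x j *
      avg n (fun u => tail N d 0 (RtoC r * u) * (u ^ j * Cconj u ^ i))) m) m)%C).
    apply (tends_Re_nonneg U _ 1).
    - rewrite (csum_ext _ (fun i => Cconj (x i) * csum (fun j => x j *
        (if Nat.leb j i then quot N d (i - j) * RtoC (r ^ (i - j)) else 0)) m)%C).
      + unfold U.
        apply (tends_csum (fun n i => Cconj (x i) * csum (fun j => x j *
          avg n (fun u => tail N d 0 (RtoC r * u) * (u ^ j * Cconj u ^ i))) m)%C).
        intros i. apply tends_scal.
        apply (tends_csum (fun n j => x j *
          avg n (fun u => tail N d 0 (RtoC r * u) * (u ^ j * Cconj u ^ i)))%C).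
        intros j. apply tends_scal. now apply avg_fourier.
      + intros i Hi. f_equal. rewrite <- (csum_truncate _ i m Hi). apply csum_ext.
        intros j _. destruct (Nat.leb j i); [reflexivity | ring].
    - intros n Hn.
      set (Q := fun u : C => csum (fun j => x j * u ^ j)%C m).
      assert (E : U n = avg n (fun u => tail N d 0 (RtoC r * u) * (Q u * Cconj (Q u)))%C).
      { unfold U, avg. rewrite <- csum_scal.
        rewrite (csum_ext _ (fun i => csum (fun k => RtoC (/ INR n) *
          (tail N d 0 (RtoC r * root n k) *
            (Q (root n k) * (Cconj (x i) * Cconj (root n k) ^ i)))) n)%C).
        - rewrite csum_swap. apply csum_ext. intros k _.
          rewrite (csum_ext _ (fun i => (RtoC (/ INR n) * tail N d 0 (RtoC r * root n k)
            * Q (root n k)) * Cconj (x i * root n k ^ i))%C m).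
          + rewrite csum_scal, <- csum_conj. unfold Q. ring.
          + intros i _. rewrite Cmult_conj, Cpow_conj. ring.
        - intros i _. rewrite csum_scal.
          rewrite (csum_ext (fun j => x j * (RtoC (/ INR n) * csum (fun k =>
              tail N d 0 (RtoC r * root n k) * (root n k ^ j * Cconj (root n k) ^ i)) n))%C
            (fun j => csum (fun k => RtoC (/ INR n) * (tail N d 0 (RtoC r * root n k) *
              (x j * root n k ^ j) * Cconj (root n k) ^ i)) n)%C).
          + rewrite csum_swap, <- !csum_scal. apply csum_ext. intros k _.
            unfold Q.
            rewrite (csum_ext _ (fun j => (RtoC (/ INR n) * tail N d 0 (RtoC r * root n k) *
              Cconj (root n k) ^ i) * (x j * root n k ^ j))%C) by (intros; ring).
            rewrite csum_scal. ring.
          + intros j _. rewrite <- !csum_scal. apply csum_ext. intros k _. ring. }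
      rewrite E. unfold avg. rewrite re_scal_l, Re_csum.
      assert (Hn' : 0 < INR n) by (apply lt_0_INR; lia).
      apply Rmult_le_pos; [left; now apply Rinv_0_lt_compat|].
      apply rsum_ge_0. intros k. rewrite <- Cmod2_conj.
      rewrite re_scal_r. apply Rmult_le_pos; [|apply pow2_ge_0].
      apply Hpos. unfold unit_disk.
      rewrite Cmod_mult, Cmod_root, Cmod_R, Rabs_pos_eq; lra. }
  (* Radii in [(0, 1)] tending to 1; Bernoulli's inequality [r^k >= 1 - k/(n + 2)] makes each fixed
     power tend to 1. *)
  set (r := fun n : nat => 1 - / (INR n + 2)).
  assert (Hr : forall n, 0 < r n < 1).
  { intros n. unfold r. pose proof (pos_INR n).
    assert (0 < / (INR n + 2)) by (apply Rinv_0_lt_compat; lra).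
    assert (/ (INR n + 2) <= / 2) by (apply Rinv_le_contravar; lra). lra. }
  assert (Hlim : forall k, tends (fun n => RtoC (r n ^ k)) 1).
  { intros k e He. destruct (INR_unbounded (INR k / e)) as [n0 Hn0].
    exists n0. intros n Hn. rewrite <- RtoC_minus, Cmod_R.
    assert (HB : 1 - INR k * / (INR n + 2) <= r n ^ k <= 1).
    { pose proof (Hr n) as Hrn. split.
      - clear - Hrn. unfold r in *. set (h := / (INR n + 2)) in *.
        induction k as [|k IH]; [simpl; lra|].
        rewrite S_INR. simpl. pose proof (pos_INR k). assert (0 < h) by lra.
        assert ((1 - h) * (1 - INR k * h) <= (1 - h) * (1 - h) ^ k)
          by (apply Rmult_le_compat_l; lra).
        nra.
      - rewrite <- (pow1 k). apply pow_incr. lra. }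
    assert (Hk : INR k * / (INR n + 2) < e).
    { pose proof (le_INR _ _ Hn). pose proof (pos_INR n).
      apply Rmult_lt_reg_r with (INR n + 2); [lra|].
      rewrite Rmult_assoc, Rinv_l by lra.
      apply Rmult_lt_compat_l with (r := e) in Hn0; [|exact He].
      replace (e * (INR k / e)) with (INR k) in Hn0 by (field; lra). nra. }
    apply Rabs_def1; lra. }
  apply (tends_Re_nonneg (fun n => csum (fun i => Cconj (x i) *
    csum (fun j => x j * (quot N d (i - j) * RtoC (r n ^ (i - j)))) (S i)) m)%C _ 0).
  - apply (tends_csum (fun n i => Cconj (x i) *
      csum (fun j => x j * (quot N d (i - j) * RtoC (r n ^ (i - j)))) (S i))%C).
    intros i. apply tends_scal.
    apply (tends_csum (fun n j => x j * (quot N d (i - j) * RtoC (r n ^ (i - j))))%C).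
    intros j. apply tends_scal.
    pose proof (tends_scal (quot N d (i - j)) _ _ (Hlim (i - j)%nat)) as T.
    rewrite Cmult_1_r in T. exact T.
  - intros n _. apply HT, Hr.
Qed.

(** * Convolution of sequences *)

Definition conv (f g : nat -> C) (n : nat) : C :=
  csum (fun j => f j * g (n - j)%nat)%C (S n).

Lemma csum_rev (f : nat -> C) (n : nat) :
  csum f (S n) = csum (fun k => f (n - k)%nat) (S n).
Proof.
  revert f. induction n as [|n IH]; intros f; [reflexivity|].
  rewrite (csum_first (fun k => f (S n - k)%nat)), Nat.sub_0_r.
  cbn [csum] in *. rewrite IH. rewrite Cplus_comm. f_equal.
Qed.

Lemma rsum_rev (f : nat -> R) (n : nat) :
  rsum f (S n) = rsum (fun k => f (n - k)%nat) (S n).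
Proof.
  revert f. induction n as [|n IH]; intros f; [reflexivity|].
  rewrite (rsum_first (fun k => f (S n - k)%nat)), Nat.sub_0_r.
  cbn [rsum] in *. rewrite IH. rewrite Rplus_comm. f_equal.
Qed.

Lemma csum_single (f : nat -> C) (k n : nat) :
  (k < n)%nat -> (forall j, (j < n)%nat -> j <> k -> f j = 0) -> csum f n = f k.
Proof.
  intros Hk Hf. induction n as [|n IH]; [lia|]. cbn [csum].
  destruct (Nat.eq_dec k n) as [->|Hne].
  - rewrite (csum_ext _ (fun _ => RtoC 0)), csum_0; [ring|].
    intros j Hj. apply Hf; lia.
  - rewrite IH by (try lia; intros; apply Hf; lia). rewrite (Hf n) by lia. ring.
Qed.

Lemma csum_triangle (F : nat -> nat -> C) (n : nat) :
  csum (fun m => csum (fun i => F i (m - i)%nat) (S m)) n =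
  csum (fun i => csum (fun j => F i j) (n - i)) n.
Proof.
  induction n as [|n IH]; [reflexivity|].
  transitivity (csum (fun i => csum (fun j => F i j) (n - i) + F i (n - i)%nat)%C (S n)).
  - rewrite csum_plus. cbn [csum] in *. rewrite IH, Nat.sub_diag. cbn [csum]. ring.
  - apply csum_ext. intros i Hi. replace (S n - i)%nat with (S (n - i)) by lia. reflexivity.
Qed.

Lemma conv_comm (f g : nat -> C) (n : nat) : conv f g n = conv g f n.
Proof.
  unfold conv. rewrite csum_rev. apply csum_ext. intros k Hk.
  replace (n - (n - k))%nat with k by lia. ring.
Qed.

Lemma conv_ext (f f' g g' : nat -> C) (n : nat) :
  (forall k, (k <= n)%nat -> f k = f' k) -> (forall k, (k <= n)%nat -> g k = g' k) ->
  conv f g n = conv f' g' n.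
Proof.
  intros Hf Hg. apply csum_ext. intros k Hk. rewrite Hf, Hg by lia. reflexivity.
Qed.

Lemma conv_assoc (f g h : nat -> C) (n : nat) :
  conv f (conv g h) n = conv (conv f g) h n.
Proof.
  unfold conv at 1 3.
  rewrite (csum_ext (fun m => conv f g m * h (n - m)%nat)%C
    (fun m => csum (fun i => f i * (g (m - i)%nat * h (n - i - (m - i))%nat)) (S m))%C).
  - rewrite (csum_triangle (fun i j => f i * (g j * h (n - i - j)%nat))%C (S n)).
    apply csum_ext. intros i Hi. unfold conv. rewrite <- csum_scal.
    replace (S n - i)%nat with (S (n - i)) by lia. reflexivity.
  - intros m Hm. unfold conv. rewrite Cmult_comm, <- csum_scal. apply csum_ext.
    intros i Hi. replace (n - i - (m - i))%nat with (n - m)%nat by lia. ring.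
Qed.

Lemma conv_scal (c : C) (f g : nat -> C) (n : nat) :
  conv (fun k => c * f k)%C g n = (c * conv f g n)%C.
Proof. unfold conv. rewrite <- csum_scal. apply csum_ext. intros k _. ring. Qed.

(** Multiplying the coefficient of index [n] by [n] is the derivation [z d/dz]; this is its rule for
    a square. *)
Lemma conv_theta (f : nat -> C) (n : nat) :
  (RtoC (INR n) * conv f f n)%C =
  (RtoC 2 * conv f (fun k => RtoC (INR k) * f k) n)%C.
Proof.
  transitivity (conv (fun k => RtoC (INR k) * f k)%C f n +
                conv f (fun k => RtoC (INR k) * f k)%C n)%C.
  - unfold conv. rewrite <- csum_plus, <- csum_scal. apply csum_ext. intros k Hk.
    rewrite (minus_INR n k) by lia. rewrite RtoC_minus. ring.
  - rewrite (conv_comm _ f). ring.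
Qed.

(** * Coefficients with positive Toeplitz forms *)

Definition toeplitz_nonneg (q : nat -> C) : Prop :=
  forall (x : nat -> C) (m : nat),
    0 <= Re (csum (fun i => Cconj (x i) * conv x q i) m)%C.

(** Test vector [|q_k|] at index 0 and [- q_k] at index [k]: with [t = |q_k|] the form equals
    [(2 - t) t^2]. *)
Lemma caratheodory_bound (q : nat -> C) (k : nat) :
  toeplitz_nonneg q -> q 0%nat = 1 -> (1 <= k)%nat -> Cmod (q k) <= 2.
Proof.
  intros HT H0 Hk. set (t := Cmod (q k)).
  set (x := fun i => match i with O => RtoC t | _ => if Nat.eqb i k then (- q k)%C else 0 end).
  assert (x0 : x 0%nat = RtoC t) by reflexivity.
  assert (xk : x k = (- q k)%C).
  { destruct k as [|k]; [lia|]. unfold x. now rewrite Nat.eqb_refl. }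
  assert (xj : forall j, j <> 0%nat -> j <> k -> x j = 0).
  { intros [|j] H1 H2; [congruence|]. unfold x.
    destruct (Nat.eqb_spec (S j) k); [congruence | reflexivity]. }
  assert (Ek : conv x q k = (RtoC t * q k - q k)%C).
  { unfold conv. cbn [csum]. rewrite Nat.sub_diag, H0, xk.
    rewrite (csum_single _ 0) by (try lia; intros; rewrite xj by lia; ring).
    rewrite x0, Nat.sub_0_r. ring. }
  pose proof (HT x (S k)) as P. cbn [csum] in P.
  rewrite (csum_single _ 0) in P.
  2:{ lia. }
  2:{ intros j Hj Hj0. rewrite xj by lia. rewrite <- (Cmult_0_l (conv x q j)). f_equal.
      apply injective_projections; simpl; ring. }
  assert (E0 : conv x q 0 = RtoC t) by (unfold conv; simpl; rewrite H0; ring).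
  rewrite Ek, E0, xk, x0 in P.
  assert (Et : t * t = fst (q k) * fst (q k) + snd (q k) * snd (q k))
    by (unfold t; apply Cmod_sqr).
  pose proof (Cmod_ge_0 (q k)) as Ht. fold t in Ht.
  clear - P Et Ht. destruct (q k) as [u v]. simpl in *.
  apply Rnot_lt_le. intros Hlt.
  assert (0 <= (2 - t) * (t * t)) by (rewrite Et at 1; lra).
  assert (0 < (t - 2) * (t * t))
    by (apply Rmult_lt_0_compat; [lra | apply Rmult_lt_0_compat; lra]).
  lra.
Qed.

Lemma rsum_cauchy_schwarz (x y : nat -> R) (n : nat) :
  (forall k, 0 <= x k) -> (forall k, 0 <= y k) ->
  rsum (fun k => x k * y k) n * rsum (fun k => x k * y k) n <=
  rsum (fun k => x k * x k) n * rsum (fun k => y k * y k) n.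
Proof.
  intros Hx Hy. induction n as [|n IH]; cbn [rsum]; [lra|].
  assert (S0 : 0 <= rsum (fun k => x k * y k) n).
  { apply rsum_ge_0. intros k. apply Rmult_le_pos; auto. }
  assert (A0 : 0 <= rsum (fun k => x k * x k) n).
  { apply rsum_ge_0. intros k. apply Rmult_le_pos; auto. }
  assert (B0 : 0 <= rsum (fun k => y k * y k) n).
  { apply rsum_ge_0. intros k. apply Rmult_le_pos; auto. }
  set (S := rsum (fun k => x k * y k) n) in *. set (A := rsum (fun k => x k * x k) n) in *.
  set (B := rsum (fun k => y k * y k) n) in *.
  pose proof (Hx n) as Xn. pose proof (Hy n) as Yn.
  set (u := x n) in *. set (v := y n) in *. clearbody u v S A B.
  assert (H : 2 * (S * (u * v)) <= A * (v * v) + B * (u * u)).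
  { apply Rsqr_incr_0_var; [|apply Rplus_le_le_0_compat; apply Rmult_le_pos; nra].
    unfold Rsqr.
    assert (S * S * ((u * v) * (u * v)) <= A * B * ((u * v) * (u * v)))
      by (apply Rmult_le_compat_r; nra).
    pose proof (Rle_0_sqr (A * (v * v) - B * (u * u))) as Q. unfold Rsqr in Q. nra. }
  nra.
Qed.

(** Course-of-values recursion made structural: the table of rank [n] is right at indices up to [n]
    and irrelevant beyond. *)
Fixpoint half_root_upto (q : nat -> C) (n : nat) : nat -> C :=
  match n with
  | O => fun _ => RtoC 1
  | S m => fun k =>
      if Nat.leb k m then half_root_upto q m k
      else (RtoC (/ INR (S m) / 2) * csum (fun j => q (S j) * half_root_upto q m (m - j)%nat) (S m))%C
  end.

(* Coefficients of [exp (1/2 * sum q_k z^k / k)]. *)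
Definition half_root (q : nat -> C) (n : nat) : C := half_root_upto q n n.

Lemma half_root_upto_stable (q : nat -> C) (m k : nat) :
  (k <= m)%nat -> half_root_upto q m k = half_root q k.
Proof.
  intros Hk. induction m as [|m IH].
  - replace k with O by lia. reflexivity.
  - destruct (Nat.eq_dec k (S m)) as [->|Hne]; [reflexivity|].
    cbn [half_root_upto]. destruct (Nat.leb_spec k m); [apply IH; lia | lia].
Qed.

Lemma half_root_step (q : nat -> C) (m : nat) :
  half_root q (S m) =
  (RtoC (/ INR (S m) / 2) * csum (fun j => q (S j) * half_root q (m - j)%nat) (S m))%C.
Proof.
  unfold half_root at 1. cbn [half_root_upto].
  destruct (Nat.leb_spec (S m) m) as [|_]; [lia|]. f_equal. apply csum_ext.
  intros j Hj. f_equal. apply half_root_upto_stable. lia.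
Qed.

Definition drop0 (q : nat -> C) (n : nat) : C := match n with O => RtoC 0 | S _ => q n end.

Lemma half_root_theta (q : nat -> C) (n : nat) :
  (RtoC 2 * (RtoC (INR n) * half_root q n))%C = conv (drop0 q) (half_root q) n.
Proof.
  unfold conv. rewrite csum_first. simpl (drop0 q 0). destruct n as [|n].
  - simpl. ring.
  - rewrite half_root_step. assert (Hn : 0 < INR (S n)) by (apply lt_0_INR; lia).
    assert (E : (RtoC 2 * (RtoC (INR (S n)) * RtoC (/ INR (S n) / 2)))%C = 1)
      by (rewrite <- !RtoC_mult; f_equal; field; lra).
    rewrite 2!Cmult_assoc, <- (Cmult_assoc (RtoC 2)), E. simpl (S n - 0)%nat.
    rewrite Cmult_1_l, Cmult_0_l, Cplus_0_l. apply csum_ext. intros j Hj. reflexivity.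
Qed.

(** The square of [half_root q] and [d] solve the same equation [z y' = (q - q_0) y] with value 1 at
    0, which determines every coefficient from the earlier ones. *)
Lemma half_root_square (q d : nat -> C) (n : nat) :
  d 0%nat = 1 -> (forall n, (RtoC (INR n) * d n)%C = conv (drop0 q) d n) ->
  conv (half_root q) (half_root q) n = d n.
Proof.
  intros H0 Hd. set (b := half_root q).
  assert (HS : forall n, (RtoC (INR n) * conv b b n)%C = conv (drop0 q) (conv b b) n).
  { intros m. rewrite conv_theta.
    transitivity (conv b (conv (drop0 q) b) m).
    - rewrite conv_comm, <- conv_scal, conv_comm. apply conv_ext; [auto|].
      intros k _. apply half_root_theta.
    - rewrite !conv_assoc. rewrite (conv_comm (conv b (drop0 q))), (conv_comm (conv (drop0 q) b)).
      apply conv_ext; auto. intros k _. apply conv_comm. }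
  induction n as [n IH] using (well_founded_induction lt_wf). destruct n as [|n].
  - unfold conv. simpl. rewrite H0. unfold b, half_root. simpl. ring.
  - assert (Hn : RtoC (INR (S n)) <> 0).
    { intros E. apply RtoC_inj in E. pose proof (lt_0_INR (S n) ltac:(lia)). lra. }
    assert (E : (RtoC (INR (S n)) * conv b b (S n))%C = (RtoC (INR (S n)) * d (S n))%C).
    { rewrite HS, Hd. unfold conv at 1 3. rewrite !(csum_first _ (S n)).
      cbn [drop0]. f_equal; [ring|]. apply csum_ext. intros k Hk.
      f_equal. apply IH. lia. }
    replace (conv b b (S n)) with (/ RtoC (INR (S n)) * (RtoC (INR (S n)) * conv b b (S n)))%C
      by (field; exact Hn).
    rewrite E. field. exact Hn.
Qed.

(** Write [m = n + 1] and [B_n] for the sum on the left. Cauchy-Schwarz in the recurrence gives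
    [m^2 |b_m|^2 <= (m + s) B_n]: each [|q_k/2|^2] is at most 1 except that the first is kept as
    [1 + s]. Induction on [n] turns this into the product bound. *)
Lemma half_root_energy (q : nat -> C) (n : nat) :
  (forall k, (1 <= k)%nat -> Cmod (q k) <= 2) ->
  let s := (Cmod (q 1%nat) / 2) ^ 2 - 1 in
  rsum (fun k => Cmod (half_root q k) * Cmod (half_root q k)) (S n) <=
    INR (S n) * exp (s * (1 - / INR (S n))).
Proof.
  intros Hq s. set (b := half_root q).
  set (B := fun n => rsum (fun k => Cmod (b k) * Cmod (b k)) (S n)).
  assert (HA : forall n, rsum (fun k => Cmod (q (S k)) / 2 * (Cmod (q (S k)) / 2)) (S n)
                         <= INR (S n) + s).
  { intros m. rewrite rsum_first, S_INR.
    assert (rsum (fun k => Cmod (q (S (S k))) / 2 * (Cmod (q (S (S k))) / 2)) m <= INR m).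
    { induction m as [|m IH]; [simpl; lra|]. cbn [rsum]. rewrite S_INR.
      pose proof (Hq (S (S m)) ltac:(lia)). pose proof (Cmod_ge_0 (q (S (S m)))). nra. }
    unfold s. lra. }
  assert (HBstep : forall n, Cmod (b (S n)) * Cmod (b (S n)) * (INR (S n) * INR (S n)) <=
                   (INR (S n) + s) * B n).
  { intros m. assert (Hm : 0 < INR (S m)) by (apply lt_0_INR; lia).
    assert (E : Cmod (b (S m)) * INR (S m) <=
      rsum (fun k => Cmod (q (S k)) / 2 * Cmod (b (m - k)%nat)) (S m)).
    { unfold b at 1. rewrite half_root_step, Cmod_mult, Cmod_R, Rabs_pos_eq.
      2:{ left. apply Rmult_lt_0_compat; [now apply Rinv_0_lt_compat | lra]. }
      set (T := csum _ _).
      replace (/ INR (S m) / 2 * Cmod T * INR (S m)) with (/ 2 * Cmod T) by (field; lra).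
      apply Rle_trans with (/ 2 * rsum (fun k => Cmod (q (S k)) * Cmod (b (m - k)%nat)) (S m)).
      - apply Rmult_le_compat_l; [lra|]. eapply Rle_trans; [apply Cmod_csum|].
        apply rsum_le. intros k _. rewrite Cmod_mult. apply Rle_refl.
      - rewrite <- rsum_scal. apply rsum_le. intros k _. lra. }
    assert (E0 : 0 <= Cmod (b (S m)) * INR (S m))
      by (apply Rmult_le_pos; [apply Cmod_ge_0 | lra]).
    pose proof (rsum_cauchy_schwarz (fun k => Cmod (q (S k)) / 2)
      (fun k => Cmod (b (m - k)%nat)) (S m)) as CS. cbv beta in CS.
    rewrite <- (rsum_rev (fun k => Cmod (b k) * Cmod (b k))) in CS. fold (B m) in CS.
    specialize (CS ltac:(intros k; pose proof (Cmod_ge_0 (q (S k))); lra)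
                   ltac:(intros k; apply Cmod_ge_0)).
    assert (HB0 : 0 <= B m)
      by (apply rsum_ge_0; intros k; pose proof (Cmod_ge_0 (b k)); nra).
    pose proof (Rmult_le_compat_r (B m) _ _ HB0 (HA m)) as HAB.
    set (S1 := rsum (fun k => Cmod (q (S k)) / 2 * Cmod (b (m - k)%nat)) (S m)) in *.
    assert (Cmod (b (S m)) * INR (S m) * (Cmod (b (S m)) * INR (S m)) <= S1 * S1)
      by (apply Rmult_le_compat; lra).
    lra. }
  change (B n <= INR (S n) * exp (s * (1 - / INR (S n)))).
  induction n as [|n IH].
  - unfold B. simpl. unfold b, half_root. simpl. rewrite Cmod_1, Rinv_1.
    replace (s * (1 - 1)) with 0 by ring. rewrite exp_0. lra.
  - change (B (S n)) with (B n + Cmod (b (S n)) * Cmod (b (S n))).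
    specialize (HBstep n). rewrite (S_INR (S n)).
    assert (Hm : 1 <= INR (S n)) by (rewrite S_INR; pose proof (pos_INR n); lra).
    set (m := INR (S n)) in *.
    assert (HB0 : 0 <= B n)
      by (apply rsum_ge_0; intros k; pose proof (Cmod_ge_0 (b k)); nra).
    assert (Hs : -1 <= s) by (unfold s; pose proof (pow2_ge_0 (Cmod (q 1%nat) / 2)); lra).
    (* [1 + (m + s)/m^2 = ((m + 1)/m) (1 + y)], and [1 + y <= exp y] makes the exponents
       telescope. *)
    set (y := s * (/ m - / (m + 1))).
    replace (exp (s * (1 - / (m + 1)))) with (exp (s * (1 - / m)) * exp y)
      by (rewrite <- exp_plus; f_equal; unfold y; ring).
    pose proof (exp_ineq1_le y) as Hy.
    assert (Ey : y * (m * (m + 1)) = s) by (unfold y; field; lra).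
    assert (Hmul : (B n + Cmod (b (S n)) * Cmod (b (S n))) * (m * m) <=
                   B n * (1 + y) * (m + 1) * m).
    { replace (B n * (1 + y) * (m + 1) * m) with (B n * (m * (m + 1) + y * (m * (m + 1)))) by ring.
      rewrite Ey. lra. }
    apply Rmult_le_reg_r with (m * m); [nra|].
    eapply Rle_trans; [exact Hmul|].
    replace ((m + 1) * (exp (s * (1 - / m)) * exp y) * (m * m))
      with (m * exp (s * (1 - / m)) * exp y * (m + 1) * m) by ring.
    apply Rmult_le_compat_r; [lra|]. apply Rmult_le_compat_r; [lra|].
    eapply Rle_trans; [apply Rmult_le_compat_l; [exact HB0 | exact Hy]|].
    apply Rmult_le_compat_r; [left; apply exp_pos | exact IH].
Qed.

Lemma half_root_square_bound (q : nat -> C) (n : nat) :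
  Cmod (conv (half_root q) (half_root q) n) <=
  rsum (fun k => Cmod (half_root q k) * Cmod (half_root q k)) (S n).
Proof.
  set (b := half_root q). unfold conv.
  eapply Rle_trans; [apply Cmod_csum|].
  set (B := rsum (fun k => Cmod (b k) * Cmod (b k)) (S n)).
  assert (E : B = rsum (fun k => / 2 * (Cmod (b k) * Cmod (b k) +
     Cmod (b (n - k)%nat) * Cmod (b (n - k)%nat))) (S n)).
  { rewrite rsum_scal.
    assert (P : forall f g m, rsum (fun k => f k + g k) m = rsum f m + rsum g m).
    { intros f g m. induction m as [|m IH]; simpl; [ring|]. rewrite IH. ring. }
    rewrite P, <- (rsum_rev (fun k => Cmod (b k) * Cmod (b k))). fold B. field. }
  rewrite E. apply rsum_le. intros k _. rewrite Cmod_mult.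
  pose proof (Rle_0_sqr (Cmod (b k) - Cmod (b (n - k)%nat))) as Q. unfold Rsqr in Q. lra.
Qed.

(** * Growth of the coefficients *)

(** Four times the Toeplitz form of [g] on the indices below [n], because [conv g q i = i g_i]; the
    factor 4 clears the quarter produced by optimising over the last coefficient. *)
Definition energy (g : nat -> C) (n : nat) : R :=
  rsum (fun k => 4 * INR k * (Cmod (g k) * Cmod (g k))) n.

(* Toeplitz positivity for [g] with its last two coefficients modified; the
   optimal last one has already been chosen. *)
Lemma toeplitz_modified (q g : nat -> C) (n : nat) (v : C) :
  toeplitz_nonneg q -> q 0%nat = 1 ->
  (forall i, conv g q i = (RtoC (INR i) * g i)%C) ->
  Cmod (RtoC (INR n) * g (S n) + (v - g n) * q 1%nat) ^ 2 <=
  energy g n + 4 * (Cmod v ^ 2 + (INR n - 1) * Re (Cconj v * g n)%C).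
Proof.
  intros HT H0 Hg.
  set (c := (RtoC (INR n) * g (S n) + (v - g n) * q 1%nat)%C).
  (* The last index contributes [|u|^2 + Re (conj u * c)], whose minimum over [u] is
     [- |c|^2 / 4]. *)
  set (u := (RtoC (- / 2) * c)%C).
  set (X := fun i => if Nat.ltb i n then g i else if Nat.eqb i n then v else u).
  assert (X1 : forall i, (i < n)%nat -> X i = g i).
  { intros i Hi. unfold X. destruct (Nat.ltb_spec i n); [reflexivity | lia]. }
  assert (X2 : X n = v).
  { unfold X. rewrite Nat.ltb_irrefl, Nat.eqb_refl. reflexivity. }
  assert (X3 : X (S n) = u).
  { unfold X. destruct (Nat.ltb_spec (S n) n); [lia|].
    destruct (Nat.eqb_spec (S n) n); [lia | reflexivity]. }
  assert (V1 : forall i, (i < n)%nat -> conv X q i = (RtoC (INR i) * g i)%C).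
  { intros i Hi. rewrite <- Hg. apply conv_ext; [|auto]. intros k Hk. apply X1. lia. }
  assert (V2 : conv X q n = (RtoC (INR n - 1) * g n + v)%C).
  { pose proof (Hg n) as E. unfold conv in *. cbn [csum] in *.
    rewrite Nat.sub_diag, H0 in *. rewrite X2.
    rewrite (csum_ext _ (fun j => g j * q (n - j)%nat)%C)
      by (intros k Hk; rewrite X1 by lia; reflexivity).
    rewrite RtoC_minus.
    transitivity ((csum (fun j => g j * q (n - j)%nat) n + g n * 1) - g n + v)%C; [ring|].
    rewrite E. ring. }
  assert (V3 : conv X q (S n) = (u + c)%C).
  { pose proof (Hg (S n)) as E. unfold conv in *. cbn [csum] in *.
    rewrite Nat.sub_diag, H0 in *. replace (S n - n)%nat with 1%nat in * by lia.
    rewrite X2, X3.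
    rewrite (csum_ext _ (fun j => g j * q (S n - j)%nat)%C)
      by (intros k Hk; rewrite X1 by lia; reflexivity).
    rewrite S_INR, RtoC_plus in E. unfold c.
    transitivity ((csum (fun j => g j * q (S n - j)%nat) n + g n * q 1%nat + g (S n) * 1)
      + (v - g n) * q 1%nat + u - g (S n))%C; [ring|]. rewrite E. ring. }
  pose proof (HT X (S (S n))) as P. cbn [csum] in P. rewrite V2, V3, X2, X3 in P.
  rewrite (csum_ext _ (fun i => RtoC (/ 4) * RtoC (4 * INR i * (Cmod (g i) * Cmod (g i))))%C) in P.
  2:{ intros i Hi. rewrite V1, X1 by lia.
      rewrite !RtoC_mult, RtoC_inv by lra.
      replace (RtoC (Cmod (g i)) * RtoC (Cmod (g i)))%C with (g i * Cconj (g i))%C.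
      2:{ rewrite <- Cmod2_conj, <- RtoC_mult. f_equal. ring. }
      field. }
  rewrite csum_scal, !re_plus, re_scal_l, Re_csum in P.
  change (rsum (fun k => Re (RtoC (4 * INR k * (Cmod (g k) * Cmod (g k))))) n)
    with (energy g n) in P.
  unfold u in P. clear - P. rewrite !Cmod2_alt.
  destruct c as [c1 c2], v as [v1 v2], (g n) as [g1 g2]. simpl in *. lra.
Qed.

(** The choice [v = - (n-1)/2 * g_n] minimises the terms in [v] on the right of [toeplitz_modified];
    the square on the left is discarded. *)
Lemma toeplitz_energy (q g : nat -> C) (n : nat) :
  toeplitz_nonneg q -> q 0%nat = 1 ->
  (forall i, conv g q i = (RtoC (INR i) * g i)%C) ->
  (INR n - 1) ^ 2 * Cmod (g n) ^ 2 <= energy g n.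
Proof.
  intros HT H0 Hg.
  pose proof (toeplitz_modified q g n (RtoC (- (INR n - 1) / 2) * g n)%C HT H0 Hg) as P.
  set (A := Cmod _ ^ 2) in P. assert (0 <= A) by apply pow2_ge_0. clearbody A.
  rewrite !Cmod2_alt in *. destruct (g n) as [g1 g2]. simpl in *. lra.
Qed.

(** Here both sides of [toeplitz_modified] count. With [a = q_1/2], it is a quadratic inequality in
    [v] with leading coefficient [4 s], [s = 1 - |a|^2 > 0], and the optimum [v = B/(2 s)] turns it
    into [s |A|^2 + |B|^2 <= s Q]. Expanding the left side leaves one cross term, bounded by
    [|a| |g_n| |g_(n+1)|]. *)
Lemma toeplitz_energy_sharp (q g : nat -> C) (n : nat) :
  toeplitz_nonneg q -> q 0%nat = 1 ->
  (forall i, conv g q i = (RtoC (INR i) * g i)%C) ->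
  let al := Cmod (q 1%nat) / 2 in al < 1 ->
  INR n ^ 2 * Cmod (g (S n)) ^ 2 + (4 * INR n * al ^ 2 + (INR n - 1) ^ 2) * Cmod (g n) ^ 2 <=
  (1 - al ^ 2) * energy g n + 2 * INR n * (INR n + 1) * al * (Cmod (g n) * Cmod (g (S n))).
Proof.
  intros HT H0 Hg al Hal.
  set (a := (RtoC (/ 2) * q 1%nat)%C).
  assert (Ea : q 1%nat = (RtoC 2 * a)%C).
  { unfold a. rewrite Cmult_assoc, <- RtoC_mult. replace (2 * / 2) with 1 by field. ring. }
  assert (Eal : Cmod a = al).
  { unfold a, al. rewrite Cmod_mult, Cmod_R, Rabs_pos_eq by lra. field. }
  assert (Hal0 : 0 <= al) by (rewrite <- Eal; apply Cmod_ge_0).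
  set (s := 1 - al ^ 2). assert (Hs : 0 < s) by (unfold s; nra).
  set (A := (RtoC (INR n) * g (S n) - RtoC 2 * a * g n)%C).
  set (B := (Cconj a * A - RtoC (INR n - 1) * g n)%C).
  pose proof (toeplitz_modified q g n (RtoC (/ s / 2) * B)%C HT H0 Hg) as P.
  rewrite Ea in P.
  replace (RtoC (INR n) * g (S n) + (RtoC (/ s / 2) * B - g n) * (RtoC 2 * a))%C
    with (A + RtoC (/ s) * (a * B))%C in P.
  2:{ unfold A. replace (RtoC (/ s / 2)) with (RtoC (/ s) * RtoC (/ 2))%C
        by (rewrite <- RtoC_mult; reflexivity).
      rewrite (RtoC_inv 2) by lra. field. }
  assert (P2 : s * Cmod A ^ 2 + Cmod B ^ 2 <= s * energy g n).
  { set (N := INR n - 1) in *. set (t := / s) in *.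
    assert (Est : t * s = 1) by (unfold t; field; lra).
    assert (Es : s = 1 - (fst a * fst a + snd a * snd a)).
    { unfold s. rewrite <- Eal, Cmod2_alt. unfold Re, Im. ring. }
    assert (EB1 : fst B = fst a * fst A + snd a * snd A - N * fst (g n))
      by (unfold B; simpl; ring).
    assert (EB2 : snd B = fst a * snd A - snd a * fst A - N * snd (g n))
      by (unfold B; simpl; ring).
    set (Q := energy g n) in *.
    rewrite !Cmod2_alt in *. clearbody N t A B Q. clear - P Est Es EB1 EB2 Hs.
    destruct a as [a1 a2], A as [A1 A2], B as [B1 B2], (g n) as [g1 g2]. simpl in *.
    apply Rmult_le_reg_l with t.
    { apply Rmult_lt_reg_r with s; [exact Hs|]. lra. }
    assert (E1 : N * g1 = a1 * A1 + a2 * A2 - B1) by lra.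
    assert (E2 : N * g2 = a1 * A2 - a2 * A1 - B2) by lra.
    assert (ER : 4 * (N * ((t / 2 * B1 - 0 * B2) * g1 - - (t / 2 * B2 + 0 * B1) * g2)) =
      2 * t * (B1 * (a1 * A1 + a2 * A2 - B1) + B2 * (a1 * A2 - a2 * A1 - B2)))
      by (rewrite <- E1, <- E2; field).
    assert (EQ : t * (a1 * a1 + a2 * a2) = t - 1) by (replace (a1 * a1 + a2 * a2) with (1 - s) by lra; lra).
    assert (EQ2 : t * t * (a1 * a1 + a2 * a2) * (B1 * B1 + B2 * B2) =
                  t * (t - 1) * (B1 * B1 + B2 * B2)) by (rewrite (Rmult_assoc t t), EQ; ring).
    replace (t * (s * (A1 * (A1 * 1) + A2 * (A2 * 1)) + (B1 * (B1 * 1) + B2 * (B2 * 1))))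
      with ((t * s) * (A1 * A1 + A2 * A2) + t * (B1 * B1 + B2 * B2)) by ring.
    replace (t * (s * Q)) with ((t * s) * Q) by ring. rewrite Est. lra. }
  pose proof (re_le_Cmod (Cconj a * (g (S n) * Cconj (g n)))%C) as HR.
  rewrite !Cmod_mult, !Cmod_conj, Eal in HR.
  pose proof (Rle_trans _ _ _ (Rle_abs _) HR) as HR'.
  assert (E : s * Cmod A ^ 2 + Cmod B ^ 2 =
    INR n ^ 2 * Cmod (g (S n)) ^ 2 + (4 * INR n * al ^ 2 + (INR n - 1) ^ 2) * Cmod (g n) ^ 2
    - 2 * INR n * (INR n + 1) * Re (Cconj a * (g (S n) * Cconj (g n)))%C).
  { assert (Es : al ^ 2 = fst a * fst a + snd a * snd a).
    { rewrite <- Eal, Cmod2_alt. unfold Re, Im. ring. }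
    unfold s. rewrite Es. rewrite !Cmod2_alt. unfold B, A. clear.
    destruct a as [a1 a2], (g n) as [g1 g2], (g (S n)) as [h1 h2]. simpl. ring. }
  rewrite E in P2. fold s.
  assert (2 * INR n * (INR n + 1) * Re (Cconj a * (g (S n) * Cconj (g n)))%C <=
          2 * INR n * (INR n + 1) * (al * (Cmod (g (S n)) * Cmod (g n)))).
  { apply Rmult_le_compat_l; [|exact HR']. pose proof (pos_INR n). nra. }
  lra.
Qed.

Lemma Rpower_bernoulli_ge (x p : R) : 0 < x -> 1 <= p -> 1 + p * x <= Rpower (1 + x) p.
Proof.
  intros Hx Hp. unfold Rpower. set (y := ln (1 + x)).
  assert (Ey : exp y = 1 + x) by (unfold y; apply exp_ln; lra).
  assert (Hy : 0 <= y).
  { unfold y. rewrite <- ln_1. left. apply ln_increasing; lra. }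
  replace (p * y) with (y + (p - 1) * y) by ring. rewrite exp_plus, Ey.
  pose proof (exp_ineq1_le (- y)) as H1.
  assert (H2 : exp (- y) * (1 + x) = 1) by (rewrite <- Ey, <- exp_plus, Rplus_opp_l, exp_0; reflexivity).
  assert (H3 : x <= (1 + x) * y).
  { apply Rmult_le_compat_r with (r := 1 + x) in H1; lra. }
  pose proof (exp_ineq1_le ((p - 1) * y)) as H4.
  apply Rmult_le_compat_l with (r := 1 + x) in H4; [|lra].
  apply Rmult_le_compat_l with (r := p - 1) in H3; lra.
Qed.

Lemma Rpower_div_base (x y p : R) :
  0 < x -> 0 < y -> Rpower x p * Rpower (y / x) p = Rpower y p.
Proof.
  intros Hx Hy. rewrite Rpower_mult_distr by (try apply Rdiv_lt_0_compat; assumption).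
  f_equal. field. lra.
Qed.

Lemma Rpower_double (x p : R) : Rpower x (2 * p) = Rpower x p * Rpower x p.
Proof. rewrite <- Rpower_plus. f_equal. ring. Qed.

(** The real-variable core: the two Toeplitz inequalities give a two-step recursion for [Q], which
    is compared with [n^be], [be = 2 + 2 al], up to a bounded factor. *)
Lemma energy_growth (al : R) (y Q : nat -> R) :
  0 <= al < 1 -> (forall n, 0 <= y n) -> (forall n, 0 <= Q n) ->
  (forall n, Q (S n) = Q n + 4 * INR n * (y n * y n)) ->
  (forall n, (INR n - 1) ^ 2 * y n ^ 2 <= Q n) ->
  (forall n, INR n ^ 2 * y (S n) ^ 2 + (4 * INR n * al ^ 2 + (INR n - 1) ^ 2) * y n ^ 2 <=
     (1 - al ^ 2) * Q n + 2 * INR n * (INR n + 1) * al * (y n * y (S n))) ->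
  exists M, forall n, (2 <= n)%nat -> y n <= M * Rpower (INR n) al.
Proof.
  intros Hal Hy HQ0 HQ HP HE.
  set (be := 2 + 2 * al).
  assert (Step : forall n, (2 <= n)%nat ->
    Q (S (S n)) <= Q n * ((1 + be * (2 / INR n)) * (1 + 200 / (INR n * INR n)))).
  { intros n Hn. assert (Hx : 2 <= INR n) by (apply (le_INR 2) in Hn; exact Hn).
    rewrite (HQ (S n)), (HQ n), S_INR.
    specialize (HP n). specialize (HE n). pose proof (HQ0 n) as HQn.
    pose proof (Hy n) as Y0. pose proof (Hy (S n)) as Y1.
    set (x := INR n) in *. set (u := y n) in *. set (v := y (S n)) in *.
    set (E := Q n) in *. clearbody x u v E.
    (* Bound the cross term by [2 x (x+1) u v <= x^2 v^2 + (x+1)^2 u^2]; a factor [1 - al] then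
       comes out of every term and is cancelled. *)
    assert (H1 : x ^ 2 * v ^ 2 + ((x - 1) ^ 2 - 4 * x * al) * u ^ 2 <= (1 + al) * E).
    { apply Rmult_le_reg_l with (1 - al); [lra|].
      pose proof (pow2_ge_0 (x * v - (x + 1) * u)) as Sq.
      apply Rmult_le_compat_l with (r := al) in Sq; [|lra]. nra. }
    assert (H2 : x ^ 2 * u ^ 2 <= 4 * E).
    { assert (x <= 2 * (x - 1)) by lra.
      assert (x ^ 2 <= 4 * (x - 1) ^ 2) by nra. pose proof (pow2_ge_0 u). nra. }
    set (W := u * u + v * v).
    (* Restoring the full [x^2 u^2] costs at most [6 x u^2], and [x^2 u^2 <= 4 E] by [H2]; hence
       [24 = 6 * 4]. *)
    assert (H3 : x * (x ^ 2 * W) <= (x * (1 + al) + 24) * E).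
    { unfold W. assert (x * (x * u ^ 2) <= 4 * E) by lra.
      pose proof (pow2_ge_0 u).
      assert (x ^ 2 * (u * u + v * v) <= (1 + al) * E + 6 * (x * u ^ 2)) by nra.
      nra. }
    assert (H4 : 4 * x * (u * u) + 4 * (x + 1) * (v * v) <= 4 * (x + 1) * W) by (unfold W; nra).
    assert (H5 : 4 * (x + 1) * W <= E * (be * (2 / x) + 200 / (x * x))).
    { apply Rmult_le_reg_l with (x * (x ^ 2)); [nra|].
      replace (x * x ^ 2 * (E * (be * (2 / x) + 200 / (x * x))))
        with (E * (2 * be * (x * x) + 200 * x)) by (field; lra).
      replace (x * x ^ 2 * (4 * (x + 1) * W)) with (4 * (x + 1) * (x * (x ^ 2 * W))) by ring.
      eapply Rle_trans; [apply Rmult_le_compat_l; [lra | exact H3]|].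
      replace (4 * (x + 1) * ((x * (1 + al) + 24) * E))
        with (E * (4 * (x + 1) * (x * (1 + al) + 24))) by ring.
      apply Rmult_le_compat_l; [exact HQn|]. unfold be. nra. }
    assert (0 <= be * (2 / x) * (200 / (x * x))).
    { unfold be. apply Rmult_le_pos; [apply Rmult_le_pos; [lra|]|];
        left; apply Rdiv_lt_0_compat; nra. }
    replace (E * ((1 + be * (2 / x)) * (1 + 200 / (x * x))))
      with (E + E * (be * (2 / x) + 200 / (x * x)) + E * (be * (2 / x) * (200 / (x * x)))) by ring.
    assert (0 <= E * (be * (2 / x) * (200 / (x * x)))) by now apply Rmult_le_pos.
    lra. }
  (* The exponential absorbs the [200/n^2] terms: over two indices its exponent grows by
     [400/((n-1)(n+1)) >= 200/n^2]. As it is at most 1, the upper bound [n^be] survives. *)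
  set (Phi := fun n : nat => Rpower (INR n) be * exp (- (200 / (INR n - 1)))).
  assert (HPhi : forall n, 0 < Phi n).
  { intros n. apply Rmult_lt_0_compat; apply exp_pos. }
  assert (PhiStep : forall n, (2 <= n)%nat ->
    Phi n * ((1 + be * (2 / INR n)) * (1 + 200 / (INR n * INR n))) <= Phi (S (S n))).
  { intros n Hn. assert (Hx : 2 <= INR n) by (apply (le_INR 2) in Hn; exact Hn).
    unfold Phi. rewrite !S_INR. set (x := INR n) in *. clearbody x.
    replace (x + 1 + 1) with (x + 2) by ring.
    rewrite <- (Rpower_div_base x (x + 2) be) by lra.
    replace (- (200 / (x + 2 - 1))) with
      (- (200 / (x - 1)) + (200 / (x - 1) - 200 / (x + 1))) by (field; lra).
    rewrite exp_plus.
    set (z := 200 / (x - 1) - 200 / (x + 1)).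
    assert (B1 : 1 + be * (2 / x) <= Rpower ((x + 2) / x) be).
    { replace ((x + 2) / x) with (1 + 2 / x) by (field; lra).
      apply Rpower_bernoulli_ge; [apply Rdiv_lt_0_compat; lra | unfold be; lra]. }
    assert (B2 : 1 + 200 / (x * x) <= exp z).
    { eapply Rle_trans; [|apply exp_ineq1_le]. apply Rplus_le_compat_l.
      replace z with (400 / ((x - 1) * (x + 1))) by (unfold z; field; lra).
      apply Rmult_le_reg_r with ((x * x) * ((x - 1) * (x + 1)));
        [apply Rmult_lt_0_compat; apply Rmult_lt_0_compat; lra|].
      replace (200 / (x * x) * (x * x * ((x - 1) * (x + 1)))) with (200 * ((x - 1) * (x + 1)))
        by (field; lra).
      replace (400 / ((x - 1) * (x + 1)) * (x * x * ((x - 1) * (x + 1)))) with (400 * (x * x))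
        by (field; lra).
      nra. }
    assert (P0 : 0 < Rpower x be * exp (- (200 / (x - 1))))
      by (apply Rmult_lt_0_compat; apply exp_pos).
    replace (Rpower x be * Rpower ((x + 2) / x) be * (exp (- (200 / (x - 1))) * exp z))
      with (Rpower x be * exp (- (200 / (x - 1))) * (Rpower ((x + 2) / x) be * exp z)) by ring.
    apply Rmult_le_compat_l; [lra|].
    assert (0 <= be * (2 / x)).
    { apply Rmult_le_pos; [unfold be; lra | left; apply Rdiv_lt_0_compat; lra]. }
    assert (0 < 200 / (x * x)) by (apply Rdiv_lt_0_compat; nra).
    apply Rmult_le_compat; lra. }
  (* The recursion has step two, so even and odd indices start separately, at 2 and 3. *)
  set (M := Q 2%nat / Phi 2%nat + Q 3%nat / Phi 3%nat).
  assert (HM : 0 <= Q 2%nat / Phi 2%nat /\ 0 <= Q 3%nat / Phi 3%nat).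
  { split; apply Rmult_le_pos; auto; left; now apply Rinv_0_lt_compat. }
  assert (HM0 : 0 <= M) by (unfold M; lra).
  assert (Base : forall n, Q n / Phi n <= M -> Q n <= M * Phi n).
  { intros n Hn. pose proof (HPhi n). apply Rmult_le_compat_r with (r := Phi n) in Hn; [|lra].
    unfold Rdiv in Hn. rewrite Rmult_assoc, Rinv_l in Hn; lra. }
  assert (Main : forall n, (2 <= n)%nat -> Q n <= M * Phi n).
  { assert (G : forall k, Q (2 + 2 * k)%nat <= M * Phi (2 + 2 * k)%nat /\
                     Q (3 + 2 * k)%nat <= M * Phi (3 + 2 * k)%nat).
    { assert (G1 : forall n, (2 <= n)%nat -> Q n <= M * Phi n ->
                   Q (S (S n)) <= M * Phi (S (S n))).
      { intros n Hn Hq. eapply Rle_trans; [now apply Step|].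
        assert (Hx : 2 <= INR n) by (apply (le_INR 2) in Hn; exact Hn).
        eapply Rle_trans; [apply Rmult_le_compat_r; [|exact Hq]|].
        - apply Rmult_le_pos.
          + assert (0 < be * (2 / INR n)); [|lra].
            apply Rmult_lt_0_compat; [unfold be; lra | apply Rdiv_lt_0_compat; lra].
          + assert (0 < 200 / (INR n * INR n)); [|lra]. apply Rdiv_lt_0_compat; nra.
        - rewrite Rmult_assoc. apply Rmult_le_compat_l; [exact HM0 | now apply PhiStep]. }
      induction k as [|k [I1 I2]].
      - simpl (2 + 2 * 0)%nat. simpl (3 + 2 * 0)%nat.
        split; apply Base; unfold M; lra.
      - replace (2 + 2 * S k)%nat with (S (S (2 + 2 * k))) by lia.
        replace (3 + 2 * S k)%nat with (S (S (3 + 2 * k))) by lia.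
        split; apply G1; auto; lia. }
    intros n Hn. destruct (Nat.Even_or_Odd n) as [[k Ek]|[k Ek]].
    - replace n with (2 + 2 * (k - 1))%nat by lia. apply G.
    - replace n with (3 + 2 * (k - 1))%nat by lia. apply G. }
  exists (1 + 4 * M). intros n Hn.
  assert (Hx : 2 <= INR n) by (apply (le_INR 2) in Hn; exact Hn).
  pose proof (Main n Hn) as Hq. specialize (HP n).
  assert (HPn : Phi n <= Rpower (INR n) be).
  { unfold Phi. rewrite <- (Rmult_1_r (Rpower (INR n) be)) at 2.
    apply Rmult_le_compat_l; [left; apply exp_pos|].
    apply Rle_trans with (exp 0); [|rewrite exp_0; lra].
    assert (0 < 200 / (INR n - 1)) by (apply Rdiv_lt_0_compat; lra).
    left. apply exp_increasing. lra. }
  set (x := INR n) in *.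
  assert (Eb : Rpower x be = x * x * (Rpower x al * Rpower x al)).
  { unfold be. rewrite Rpower_plus, Rpower_double.
    f_equal. replace 2 with (INR 2) by reflexivity. rewrite Rpower_pow by lra. ring. }
  pose proof (exp_pos (al * ln x)) as Ha. fold (Rpower x al) in Ha.
  set (w := Rpower x al) in *.
  assert (Hsq : y n * y n <= 4 * M * (w * w)).
  { apply Rmult_le_reg_l with (x * x); [nra|].
    assert (M * Phi n <= M * (x * x * (w * w)))
      by (apply Rmult_le_compat_l; [exact HM0 | rewrite <- Eb; exact HPn]).
    assert (Hxx : x * x <= 4 * (x - 1) ^ 2) by nra.
    apply Rmult_le_compat_r with (r := y n ^ 2) in Hxx; [|apply pow2_ge_0].
    lra. }
  apply Rsqr_incr_0_var; [|apply Rmult_le_pos; lra]. unfold Rsqr.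
  assert (4 * M * (w * w) <= (1 + 4 * M) * (1 + 4 * M) * (w * w))
    by (apply Rmult_le_compat_r; nra).
  lra.
Qed.

(** * Coefficients of convex functions *)

(** Passes from [f], arbitrary outside the disk, to the sum of its series, with which it agrees on
    the disk. *)
Lemma class_C_psum (f : C -> C) (a : nat -> C) :
  class_C f -> normalized_expansion f a ->
  disk_series a /\ injective_on_disk (psum a) /\ convex_set (disk_range (psum a)).
Proof.
  intros [[_ [Hinj _]] Hconv] [_ [_ Hps]].
  pose proof (pseries_disk_series a f Hps) as Ha.
  assert (E : forall z, unit_disk z -> psum a z = f z).
  { intros z Hz. apply psum_unique; auto. now apply series_to_is_pseries, Hps. }
  split; [exact Ha|]. split.
  - intros z w Hz Hw H. apply Hinj; auto. now rewrite <- !E.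
  - assert (R : forall v, disk_range (psum a) v <-> disk_range f v).
    { intros v. split; intros [z [Hz Ez]]; exists z; (split; [exact Hz|]);
        rewrite <- Ez; [symmetry|]; now apply E. }
    intros u v t Hu Hv Ht. apply R. apply Hconv; [now apply R | now apply R | exact Ht].
Qed.

(* The Taylor coefficients of [1 + z f''/f']. *)
Definition convexity_coef (a : nat -> C) : nat -> C := quot (num_coef a) (deriv_coef a).

(** With [p = 1 + z f''/f'], the two product identities are [p (z f') = z (z f')'], used for the
    growth, and [z f'' = (p - 1) f'], used for the square root of [f']. *)
Lemma convexity_coef_props (a : nat -> C) :
  disk_series a -> a 0%nat = 0 -> a 1%nat = 1 ->
  injective_on_disk (psum a) -> convex_set (disk_range (psum a)) ->
  let q := convexity_coef a in
  toeplitz_nonneg q /\ q 0%nat = 1 /\ q 1%nat = (RtoC 2 * a 2%nat)%C /\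
  (forall i, conv (fun k => RtoC (INR k) * a k)%C q i = (RtoC (INR i) * (RtoC (INR i) * a i))%C) /\
  (forall n, (RtoC (INR n) * deriv_coef a n)%C = conv (drop0 q) (deriv_coef a) n).
Proof.
  intros Ha H0 H1 Hinj Hconv q.
  assert (D0 : deriv_coef a 0%nat = 1) by (unfold deriv_coef; rewrite H1; simpl; ring).
  assert (Q0 : q 0%nat = 1).
  { unfold q, convexity_coef, quot, num_coef. simpl. rewrite D0. ring. }
  assert (QD : forall n, conv q (deriv_coef a) n = num_coef a n).
  { intros n. now apply quot_mul. }
  assert (QD' : forall n, (RtoC (INR n) * deriv_coef a n)%C = conv (drop0 q) (deriv_coef a) n).
  { intros n. pose proof (QD n) as E. unfold conv in *. rewrite csum_first in *.
    rewrite Q0, Nat.sub_0_r in E. cbn [drop0]. unfold num_coef in E.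
    rewrite S_INR, RtoC_plus in E.
    set (T := csum (fun k => q (S k) * deriv_coef a (n - S k)%nat)%C n) in *.
    transitivity ((RtoC (INR n) + RtoC 1) * deriv_coef a n - deriv_coef a n)%C; [ring|].
    rewrite <- E. unfold T. ring. }
  split; [|split; [exact Q0|split; [|split]]]; [| | |exact QD'].
  - intros x m. apply toeplitz_positive; auto.
    + now apply disk_series_num.
    + now apply disk_series_deriv.
    + intros z Hz. now apply univalent_deriv_nonzero.
    + intros z Hz. now apply convex_positive.
  - pose proof (QD' 1%nat) as E. unfold conv in E. cbn [csum Nat.sub drop0] in E.
    rewrite D0 in E. unfold deriv_coef in E. rewrite (S_INR 1) in E. change (INR 1) with 1 in E.
    replace (1 + 1) with 2 in E by ring.
    transitivity (0 + 0 * (RtoC 2 * a 2%nat) + q 1%nat * 1)%C; [ring|]. rewrite <- E. ring.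
  - intros i. rewrite conv_comm. destruct i as [|n].
    + unfold conv. simpl. rewrite H0. ring.
    + transitivity (num_coef a n); [|reflexivity]. rewrite <- QD.
      unfold conv. cbn [csum]. rewrite !Nat.sub_diag.
      replace (S n - n)%nat with 1%nat by lia.
      rewrite (csum_ext _ (fun j => q j * deriv_coef a (n - j)%nat)%C).
      * unfold deriv_coef at 3. simpl. ring.
      * intros j Hj. unfold deriv_coef. replace (S n - j)%nat with (S (n - j)) by lia.
        reflexivity.
Qed.

Lemma convex_coef_bound (a : nat -> C) (n : nat) :
  disk_series a -> a 0%nat = 0 -> a 1%nat = 1 ->
  injective_on_disk (psum a) -> convex_set (disk_range (psum a)) -> (2 <= n)%nat ->
  Cmod (a n) <= exp ((Cmod (a 2%nat) ^ 2 - 1) / 2).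
Proof.
  intros Ha H0 H1 Hinj Hconv Hn.
  destruct (convexity_coef_props a Ha H0 H1 Hinj Hconv) as [HT [Q0 [Q1 [_ HD]]]].
  set (q := convexity_coef a) in *.
  assert (D0 : deriv_coef a 0%nat = 1) by (unfold deriv_coef; rewrite H1; simpl; ring).
  assert (Hq : forall k, (1 <= k)%nat -> Cmod (q k) <= 2)
    by (intros k Hk; now apply caratheodory_bound).
  destruct n as [|m]; [lia|].
  pose proof (half_root_energy q m Hq) as HE. cbv zeta in HE.
  pose proof (half_root_square_bound q m) as HB.
  rewrite (half_root_square q (deriv_coef a) m D0 HD) in HB.
  assert (Eq : Cmod (q 1%nat) / 2 = Cmod (a 2%nat)).
  { rewrite Q1, Cmod_mult, Cmod_R, Rabs_pos_eq by lra. field. }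
  rewrite Eq in HE. set (s := Cmod (a 2%nat) ^ 2 - 1) in *.
  assert (Hs : s <= 0).
  { pose proof (Hq 1%nat (le_n _)). pose proof (Cmod_ge_0 (a 2%nat)). unfold s. nra. }
  assert (Hm : 2 <= INR (S m)) by (apply (le_INR 2) in Hn; exact Hn).
  unfold deriv_coef in HB. rewrite Cmod_mult, Cmod_R, Rabs_pos_eq in HB by lra.
  apply Rle_trans with (exp (s * (1 - / INR (S m)))).
  - apply Rmult_le_reg_l with (INR (S m)); lra.
  (* Since [s <= 0], the worst index is [n = 2], where [1 - 1/n = 1/2]; this is the one half in the
     exponent. *)
  - assert (I : / INR (S m) <= / 2) by (apply Rinv_le_contravar; lra).
    assert (L : s * (1 - / INR (S m)) <= s / 2) by nra.
    destruct (Rle_lt_or_eq_dec _ _ L) as [L'|L'];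
      [left; now apply exp_increasing | rewrite L'; lra].
Qed.

Lemma convex_coef_growth (a : nat -> C) :
  disk_series a -> a 0%nat = 0 -> a 1%nat = 1 ->
  injective_on_disk (psum a) -> convex_set (disk_range (psum a)) ->
  exists M, forall n, (2 <= n)%nat -> Cmod (a n) <= M * Rpower (INR n) (Cmod (a 2%nat) - 1).
Proof.
  intros Ha H0 H1 Hinj Hconv.
  destruct (convexity_coef_props a Ha H0 H1 Hinj Hconv) as [HT [Q0 [Q1 [HG _]]]].
  set (q := convexity_coef a) in *. set (al := Cmod (a 2%nat)).
  assert (Eq : Cmod (q 1%nat) / 2 = al).
  { rewrite Q1, Cmod_mult, Cmod_R, Rabs_pos_eq by lra. unfold al. field. }
  assert (Hal1 : al <= 1).
  { pose proof (caratheodory_bound q 1 HT Q0 (le_n _)). lra. }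
  assert (Hal0 : 0 <= al) by apply Cmod_ge_0.
  destruct (Rle_lt_or_eq_dec _ _ Hal1) as [Hal|Hal].
  - set (g := fun k => (RtoC (INR k) * a k)%C) in *.
    destruct (energy_growth al (fun n => Cmod (g n)) (energy g)) as [M HM].
    + lra.
    + intros n. apply Cmod_ge_0.
    + intros n. apply rsum_ge_0. intros k. pose proof (pos_INR k).
      pose proof (Cmod_ge_0 (g k)). apply Rmult_le_pos; nra.
    + intros n. reflexivity.
    + intros n. now apply (toeplitz_energy q).
    + intros n. pose proof (toeplitz_energy_sharp q g n HT Q0 HG) as P. cbv zeta in P.
      rewrite Eq in P. now apply P.
    + exists M. intros n Hn. assert (Hx : 2 <= INR n) by (apply (le_INR 2) in Hn; exact Hn).
      specialize (HM n Hn). cbv beta in HM. unfold g in HM.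
      rewrite Cmod_mult, Cmod_R, Rabs_pos_eq in HM by lra.
      apply Rmult_le_reg_l with (INR n); [lra|]. eapply Rle_trans; [exact HM|].
      replace al with (1 + (al - 1)) at 1 by ring.
      rewrite Rpower_plus, Rpower_1 by lra. right. ring.
  (* For [al = 1] the claim is boundedness, and the exponential bound equals 1. *)
  - exists 1. intros n Hn. rewrite Hal.
    pose proof (convex_coef_bound a n Ha H0 H1 Hinj Hconv Hn) as B.
    fold al in B. rewrite Hal in B. replace ((1 ^ 2 - 1) / 2) with 0 in B by field.
    rewrite exp_0 in B. unfold Rpower. replace ((1 - 1) * ln (INR n)) with 0 by ring.
    rewrite exp_0. lra.
Qed.

(** * The extremal functions *)

Lemma curve_slope_plus (g h : R -> C) (t : R) (l m : C) :
  curve_slope g t l -> curve_slope h t m -> curve_slope (fun s => g s + h s)%C t (l + m)%C.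
Proof.
  intros Hg Hh.
  destruct (curve_slope_parts _ _ _ Hg) as [G1 G2].
  destruct (curve_slope_parts _ _ _ Hh) as [H1 H2].
  apply (curve_slope_of_parts (fun s => fst (g s) + fst (h s)) (fun s => snd (g s) + snd (h s))).
  - now apply (is_derive_plus (fun s => fst (g s)) (fun s => fst (h s))).
  - now apply (is_derive_plus (fun s => snd (g s)) (fun s => snd (h s))).
Qed.

Lemma curve_slope_mult (g h : R -> C) (t : R) (l m : C) :
  curve_slope g t l -> curve_slope h t m ->
  curve_slope (fun s => g s * h s)%C t (l * h t + g t * m)%C.
Proof.
  intros Hg Hh.
  destruct (curve_slope_parts _ _ _ Hg) as [G1 G2].
  destruct (curve_slope_parts _ _ _ Hh) as [H1 H2].
  pose proof (is_derive_minus _ _ _ _ _ (is_derive_mult _ _ _ _ _ G1 H1 Rmult_comm)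
    (is_derive_mult _ _ _ _ _ G2 H2 Rmult_comm)) as D1.
  pose proof (is_derive_plus _ _ _ _ _ (is_derive_mult _ _ _ _ _ G1 H2 Rmult_comm)
    (is_derive_mult _ _ _ _ _ G2 H1 Rmult_comm)) as D2.
  pose proof (curve_slope_of_parts _ _ _ _ _ D1 D2) as D.
  match goal with |- curve_slope _ _ ?r => match type of D with curve_slope _ _ ?r' =>
    replace r with r' end end; [exact D|].
  apply injective_projections; unfold minus, plus, opp, mult; simpl; unfold mult; simpl; ring.
Qed.

(** * The complex exponential and the Cayley map *)

Definition cexp (z : C) : C := (exp (fst z) * cos (snd z), exp (fst z) * sin (snd z)).

Lemma cexp_plus (u v : C) : cexp (u + v)%C = (cexp u * cexp v)%C.
Proof.
  unfold cexp. simpl. rewrite exp_plus, cos_plus, sin_plus.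
  apply injective_projections; simpl; ring.
Qed.

Lemma cexp_0 : cexp 0 = 1.
Proof.
  unfold cexp. simpl. rewrite exp_0, cos_0, sin_0. apply injective_projections; simpl; ring.
Qed.

Lemma cexp_opp (u : C) : (cexp u * cexp (- u))%C = 1.
Proof. rewrite <- cexp_plus, Cplus_opp_r. apply cexp_0. Qed.

Lemma cexp_slope (z : C) (t : R) :
  curve_slope (fun s => cexp (RtoC s * z)%C) t (z * cexp (RtoC t * z))%C.
Proof.
  pose proof (curve_slope_of_parts
    (fun s => exp (s * fst z) * cos (s * snd z)) (fun s => exp (s * fst z) * sin (s * snd z)) t
    (fst z * (exp (t * fst z) * cos (t * snd z)) - snd z * (exp (t * fst z) * sin (t * snd z)))
    (fst z * (exp (t * fst z) * sin (t * snd z)) + snd z * (exp (t * fst z) * cos (t * snd z))))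
    as H.
  assert (E : forall s, cexp (RtoC s * z)%C =
    (exp (s * fst z) * cos (s * snd z), exp (s * fst z) * sin (s * snd z))).
  { intros s. unfold cexp. simpl.
    replace (s * fst z - 0 * snd z) with (s * fst z) by ring.
    replace (s * snd z + 0 * fst z) with (s * snd z) by ring. reflexivity. }
  destruct H as [P [H1 [H2 [d [Hd H3]]]]].
  - auto_derive; auto. ring.
  - auto_derive; auto. ring.
  - exists P. rewrite (E t). split; [exact H1|]. split; [exact H2|].
    exists d. split; [exact Hd|]. intros s Hs. rewrite !E. apply (H3 s Hs).
Qed.

Lemma cexp_injective (u v : C) :
  Rabs (snd u) < PI / 2 -> Rabs (snd v) < PI / 2 -> cexp u = cexp v -> u = v.
Proof.
  intros Hu Hv E. apply Rabs_lt_between in Hu. apply Rabs_lt_between in Hv.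
  unfold cexp in E. injection E as E1 E2.
  destruct u as [u1 u2], v as [v1 v2]. simpl in *.
  pose proof (exp_pos u1) as P1. pose proof (exp_pos v1) as P2.
  assert (Cu : 0 < cos u2) by (apply cos_gt_0; lra).
  (* The imaginary parts differ by less than [PI], so a vanishing sine forces them to be equal. *)
  assert (S0 : sin (u2 - v2) = 0).
  { rewrite sin_minus.
    assert (H : exp u1 * exp v1 * (sin u2 * cos v2 - cos u2 * sin v2) = 0).
    { replace (exp u1 * exp v1 * (sin u2 * cos v2 - cos u2 * sin v2))
        with ((exp u1 * sin u2) * (exp v1 * cos v2) - (exp u1 * cos u2) * (exp v1 * sin v2))
        by ring. rewrite E1, E2. ring. }
    apply Rmult_integral in H. destruct H as [H|H]; [nra | exact H]. }
  assert (E3 : u2 = v2).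
  { destruct (Rtotal_order u2 v2) as [L|[L|L]]; [|exact L|]; exfalso.
    - pose proof (sin_gt_0 (v2 - u2) ltac:(lra) ltac:(lra)) as Q.
      replace (v2 - u2) with (- (u2 - v2)) in Q by ring. rewrite sin_neg in Q. lra.
    - pose proof (sin_gt_0 (u2 - v2) ltac:(lra) ltac:(lra)). lra. }
  subst v2. apply Rmult_eq_reg_r in E1; [|lra]. apply exp_inv in E1. now subst.
Qed.

Lemma cexp_right_half_plane (w : C) :
  0 < fst w -> exists z, Rabs (snd z) < PI / 2 /\ cexp z = w.
Proof.
  intros Hw. destruct w as [x y]. simpl in Hw.
  exists (ln (sqrt (x * x + y * y)), atan (y / x)).
  pose proof (atan_bound (y / x)) as B. split; [apply Rabs_lt_between; simpl; lra|].
  assert (Hp : 0 < sqrt (x * x + y * y)) by (apply sqrt_lt_R0; nra).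
  unfold cexp. simpl. rewrite exp_ln by exact Hp.
  rewrite cos_atan, sin_atan.
  assert (E : sqrt (1 + (y / x) ^ 2) = sqrt (x * x + y * y) / x).
  { apply sqrt_lem_1.
    - pose proof (pow2_ge_0 (y / x)). lra.
    - left. now apply Rdiv_lt_0_compat.
    - replace (sqrt (x * x + y * y) / x * (sqrt (x * x + y * y) / x))
        with ((sqrt (x * x + y * y) * sqrt (x * x + y * y)) / (x * x)) by (field; lra).
      rewrite sqrt_sqrt by nra. field. lra. }
  unfold Rsqr in *. simpl in E. rewrite ?Rmult_1_r in E. rewrite E.
  apply injective_projections; simpl; field; lra.
Qed.

Lemma cexp_right (z : C) : Rabs (snd z) < PI / 2 -> 0 < fst (cexp z).
Proof.
  intros Hz. apply Rabs_lt_between in Hz. apply Rmult_lt_0_compat; [apply exp_pos|].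
  apply cos_gt_0; lra.
Qed.

(** Inverse of [z -> (1 + z)/(1 - z)], from the right half plane onto the disk. Composed with [cexp]
    it parametrises the disk by the strip [|Im x| < PI/2], so powers and logarithms of
    [(1 + z)/(1 - z)] require no choice of branch. *)
Definition cayley (w : C) : C := ((w - 1) / (w + 1))%C.

Lemma right_plus_1 (w : C) : 0 < fst w -> (w + 1)%C <> 0.
Proof. intros Hw E. apply (f_equal fst) in E. simpl in E. lra. Qed.

Lemma cayley_disk (w : C) : 0 < fst w -> unit_disk (cayley w).
Proof.
  intros Hw. pose proof (right_plus_1 w Hw) as H1. unfold unit_disk, cayley.
  rewrite Cmod_div by exact H1. pose proof (Cmod_pos _ H1) as Hp.
  apply Rmult_lt_reg_r with (Cmod (w + 1)); [exact Hp|].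
  unfold Rdiv. rewrite Rmult_assoc, Rinv_l, Rmult_1_r, Rmult_1_l by lra.
  apply Rsqr_incrst_0; [|apply Cmod_ge_0 | lra]. unfold Rsqr. rewrite !Cmod_sqr.
  simpl. nra.
Qed.

Lemma cayley_surjective (z : C) : unit_disk z -> exists w, 0 < fst w /\ cayley w = z.
Proof.
  intros Hz. unfold unit_disk in Hz.
  assert (H1 : (1 - z)%C <> 0).
  { apply Cminus_neq_0. intros E. rewrite <- E, Cmod_1 in Hz. lra. }
  exists ((1 + z) / (1 - z))%C. split.
  - assert (Hm : Cmod z * Cmod z < 1) by (pose proof (Cmod_ge_0 z); nra).
    rewrite Cmod_sqr in Hm. pose proof (Cmod_pos _ H1) as Hp.
    assert (Hd : 0 < Cmod (1 - z) * Cmod (1 - z)) by nra. rewrite Cmod_sqr in Hd.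
    destruct z as [x y]. simpl in *.
    match goal with |- 0 < ?e => replace e with ((1 - (x * x + y * y)) /
      ((1 + - x) * (1 + - x) + (0 + - y) * (0 + - y))) by (field; lra) end.
    apply Rdiv_lt_0_compat; lra.
  - unfold cayley. field. split; [exact H1|].
    replace (1 + z + (1 - z))%C with (RtoC 2) by ring.
    intros E. apply RtoC_inj in E. lra.
Qed.

Lemma cayley_slope (w : C) :
  0 < fst w -> has_slope 0 cayley w (RtoC 2 / ((w + 1) * (w + 1)))%C.
Proof.
  intros Hw. pose proof (right_plus_1 w Hw) as H1.
  assert (HS : smooth 0 (fun z => z + 1)%C w)
    by (apply smooth_plus; [apply smooth_id | apply smooth_const]).
  exists (fun z => RtoC 2 / ((z + 1) * (w + 1)))%C. split; [|split; [reflexivity|]].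
  - apply smooth_div; [apply smooth_const | | now apply Cmult_neq_0].
    apply smooth_mult; [exact HS | apply smooth_const].
  - generalize (cont_at_nonzero _ _ HS H1). apply near_imp. intros z Hz.
    assert (Hz1 : (z + 1)%C <> 0).
    { apply Cmod_neq_0. pose proof (Cmod_ge_0 (w + 1)). lra. }
    unfold cayley. field. auto.
Qed.

(* The recurrence expresses [(1 - z^2) f' = 1 + 2 al f]. *)
Fixpoint ext_pair (al : R) (n : nat) : R * R :=
  match n with
  | O => (0, 1)
  | S m => let (x, y) := ext_pair al m in (y, (2 * al * y + INR m * x) / (INR m + 2))
  end.

Definition ext_coef (al : R) (n : nat) : R := fst (ext_pair al n).

Lemma ext_coef_step (al : R) (n : nat) :
  (INR n + 2) * ext_coef al (S (S n)) = 2 * al * ext_coef al (S n) + INR n * ext_coef al n.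
Proof.
  unfold ext_coef. simpl. destruct (ext_pair al n) as [x y]. cbn [fst].
  field. pose proof (pos_INR n). lra.
Qed.

(** Two consecutive coefficients in [[0, 1]] keep [2 al y + n x] between 0 and [n + 2], so the next
    one stays in [[0, 1]]. *)
Lemma ext_coef_bound (al : R) (n : nat) :
  0 <= al <= 1 -> 0 <= ext_coef al n <= 1 /\ 0 <= ext_coef al (S n) <= 1.
Proof.
  intros Hal. induction n as [|n [I1 I2]].
  - unfold ext_coef. simpl. lra.
  - split; [exact I2|]. pose proof (ext_coef_step al n) as E. pose proof (pos_INR n) as Hn.
    set (x := ext_coef al (S (S n))) in *. set (y := ext_coef al (S n)) in *.
    set (z := ext_coef al n) in *. clearbody x y z.
    assert (0 <= al * y <= 1) by nra. assert (0 <= INR n * z <= INR n) by nra.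
    split; apply Rmult_le_reg_l with (INR n + 2); lra.
Qed.

Definition ext_fun (al : R) : C -> C := psum (fun n => RtoC (ext_coef al n)).

Lemma disk_series_ext (al : R) :
  0 <= al <= 1 -> disk_series (fun n => RtoC (ext_coef al n)).
Proof.
  intros Hal. apply disk_series_bounded with 1. intros n.
  destruct (ext_coef_bound al n Hal) as [B _]. rewrite Cmod_R, Rabs_pos_eq; lra.
Qed.

(** For the coefficients [d] of the derivative the recurrence reads [d_(n+2) = 2 al a_(n+2) + d_n];
    the first two terms are split off and summed separately. *)
Lemma ext_fun_ode (al : R) (z : C) :
  0 <= al <= 1 -> unit_disk z ->
  ((1 - z * z) * psum (deriv_coef (fun n => RtoC (ext_coef al n))) z =
   1 + RtoC (2 * al) * ext_fun al z)%C.
Proof.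
  intros Hal Hz. set (a := fun n => RtoC (ext_coef al n)).
  pose proof (disk_series_ext al Hal : disk_series a) as Ha.
  pose proof (disk_series_deriv a Ha) as Hd. set (d := deriv_coef a) in *.
  assert (E1 : psum d z = (d 0%nat + z * (d 1%nat + z * psum (fun n => d (S (S n))) z))%C).
  { rewrite psum_shift by auto. f_equal. f_equal.
    apply (psum_shift (fun n => d (S n))); [exact (disk_series_shift d 1 Hd) | exact Hz]. }
  assert (E2 : psum a z = (a 0%nat + z * (a 1%nat + z * psum (fun n => a (S (S n))) z))%C).
  { rewrite psum_shift by auto. f_equal. f_equal.
    apply (psum_shift (fun n => a (S n))); [exact (disk_series_shift a 1 Ha) | exact Hz]. }
  assert (E3 : psum (fun n => d (S (S n))) z =
    (RtoC (2 * al) * psum (fun n => a (S (S n))) z + psum d z)%C).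
  { rewrite <- psum_scal by (auto; exact (disk_series_shift a 2 Ha)).
    rewrite <- psum_plus by (auto; apply disk_series_scal; exact (disk_series_shift a 2 Ha)).
    apply psum_ext; [exact (disk_series_shift d 2 Hd) | exact Hz|].
    intros n. unfold d, deriv_coef, a. rewrite <- !RtoC_mult, <- RtoC_plus. f_equal.
    rewrite !S_INR. pose proof (ext_coef_step al (S n)) as E. rewrite S_INR in E. lra. }
  assert (d0 : d 0%nat = 1).
  { unfold d, deriv_coef, a. rewrite <- RtoC_mult. f_equal. unfold ext_coef. simpl. ring. }
  assert (d1 : d 1%nat = RtoC (2 * al)).
  { unfold d, deriv_coef, a. rewrite <- RtoC_mult. f_equal. unfold ext_coef. simpl. field. }
  assert (a0 : a 0%nat = 0) by reflexivity. assert (a1 : a 1%nat = 1) by reflexivity.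
  unfold ext_fun. fold a. rewrite d0, d1, E3 in E1. rewrite a0, a1 in E2.
  set (D := psum d z) in *. set (F := psum a z) in *.
  set (G := psum (fun n => a (S (S n))) z) in *.
  transitivity (D - z * (z * D))%C; [ring|]. rewrite E1 at 1. rewrite E2. ring.
Qed.

(* Along the curve [cayley (exp (s z))] the differential equation reads
   [d/ds f = z (1 + 2 al f) / 2]. *)
Lemma ext_fun_slope (al : R) (z : C) (t : R) :
  0 <= al <= 1 -> Rabs (snd z) < PI / 2 -> 0 <= t <= 1 ->
  curve_slope (fun s => ext_fun al (cayley (cexp (RtoC s * z)))) t
    (RtoC (/ 2) * z * (1 + RtoC (2 * al) * ext_fun al (cayley (cexp (RtoC t * z)))))%C.
Proof.
  intros Hal Hz Ht.
  assert (Htz : Rabs (snd (RtoC t * z)%C) < PI / 2).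
  { simpl. rewrite Rmult_0_l, Rplus_0_r, Rabs_mult, (Rabs_pos_eq t) by lra.
    pose proof (Rabs_pos (snd z)). nra. }
  pose proof (cexp_right _ Htz) as Hw.
  pose proof (cexp_slope z t) as S1. pose proof (cayley_slope _ Hw) as S2.
  pose proof (cayley_disk _ Hw) as HD.
  pose proof (psum_slope 0 _ _ (disk_series_ext al Hal) HD) as S3.
  pose proof (curve_slope_comp _ _ _ _ _ (curve_slope_comp _ _ _ _ _ S1 S2) S3) as S4.
  pose proof (ext_fun_ode al _ Hal HD) as E.
  match goal with |- curve_slope _ _ ?r => match type of S4 with curve_slope _ _ ?r' =>
    replace r with r' end end; [exact S4|].
  rewrite <- E. set (D := psum _ _). set (w := cexp (RtoC t * z)%C) in *.
  pose proof (right_plus_1 w Hw) as H1. unfold cayley. rewrite (RtoC_inv 2) by lra.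
  field. exact H1.
Qed.

Lemma ext_fun_center (al : R) : 0 <= al <= 1 -> ext_fun al (cayley 1) = 0.
Proof.
  intros Hal. unfold cayley. replace (1 - 1)%C with (RtoC 0) by ring.
  unfold Cdiv. rewrite Cmult_0_l. now apply psum_0, disk_series_ext.
Qed.

(** Along [s -> s z] the product of [exp (- s al z)] and [1 + 2 al f] has slope zero by the
    differential equation; comparing [s = 0] with [s = 1] identifies [1 + 2 al f] with the power
    [al] of [(1 + z)/(1 - z)]. *)
Lemma ext_fun_power (al : R) (z : C) :
  0 <= al <= 1 -> Rabs (snd z) < PI / 2 ->
  (1 + RtoC (2 * al) * ext_fun al (cayley (cexp z)))%C = cexp (RtoC al * z)%C.
Proof.
  intros Hal Hz.
  set (F := fun s => ext_fun al (cayley (cexp (RtoC s * z)))).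
  set (K := fun s => (cexp (RtoC s * (- (RtoC al * z))) * (1 + RtoC (2 * al) * F s))%C).
  assert (HK : K 0 = K 1).
  { apply curve_slope_zero; [lra|]. intros t Ht. unfold K.
    pose proof (cexp_slope (- (RtoC al * z))%C t) as S1.
    pose proof (ext_fun_slope al z t Hal Hz Ht) as S2. fold F in S2.
    assert (C0 : forall c, curve_slope (fun _ => c) t 0).
    { intros c. exists (fun _ => RtoC 0). split; [reflexivity|]. split.
      - intros e He. exists 1. split; [lra|]. intros s _. rewrite Cmod_0_minus. exact He.
      - exists 1. split; [lra|]. intros s _. ring. }
    pose proof (curve_slope_mult _ _ _ _ _ S1 (curve_slope_plus _ _ _ _ _ (C0 (RtoC 1))
      (curve_slope_mult _ _ _ _ _ (C0 (RtoC (2 * al))) S2))) as S3.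
    match goal with |- curve_slope _ _ ?r => match type of S3 with curve_slope _ _ ?r' =>
      replace r with r' end end; [exact S3|].
    cbv beta. rewrite RtoC_mult, (RtoC_inv 2) by lra.
    change (ext_fun al (cayley (cexp (RtoC t * z)))) with (F t). field. }
  unfold K, F in HK.
  replace (RtoC 0 * - (RtoC al * z))%C with (RtoC 0) in HK by ring.
  replace (RtoC 0 * z)%C with (RtoC 0) in HK by ring.
  replace (RtoC 1 * - (RtoC al * z))%C with (- (RtoC al * z))%C in HK by ring.
  replace (RtoC 1 * z)%C with z in HK by ring.
  rewrite cexp_0 in HK.
  rewrite ext_fun_center in HK by assumption.
  set (X := (1 + RtoC (2 * al) * ext_fun al (cayley (cexp z)))%C) in *.
  transitivity (cexp (RtoC al * z) * cexp (- (RtoC al * z)) * X)%C.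
  - rewrite cexp_opp. ring.
  - rewrite <- Cmult_assoc, <- HK. ring.
Qed.

(** At [al = 0] the power identity degenerates to [1 = 1]; here the slope along the curve is the
    constant [z/2], integrated directly. *)
Lemma ext_fun_log (z : C) :
  Rabs (snd z) < PI / 2 -> ext_fun 0 (cayley (cexp z)) = (RtoC (/ 2) * z)%C.
Proof.
  intros Hz. assert (Hal : 0 <= 0 <= 1) by lra.
  set (F := fun s => ext_fun 0 (cayley (cexp (RtoC s * z)))).
  set (L := fun s : R => (s * (- / 2 * fst z), s * (- / 2 * snd z)) : C).
  assert (HK : (F 0 + L 0)%C = (F 1 + L 1)%C).
  { apply (curve_slope_zero (fun s => F s + L s)%C); [lra|]. intros t Ht.
    pose proof (ext_fun_slope 0 z t Hal Hz Ht) as S2. fold F in S2.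
    assert (S1 : curve_slope L t (- / 2 * fst z, - / 2 * snd z)).
    { apply curve_slope_of_parts; auto_derive; auto; ring. }
    pose proof (curve_slope_plus _ _ _ _ _ S2 S1) as S3.
    match goal with |- curve_slope _ _ ?r => match type of S3 with curve_slope _ _ ?r' =>
      replace r with r' end end; [exact S3|].
    rewrite !Rmult_0_r. apply injective_projections; simpl; ring. }
  unfold F in HK.
  replace (RtoC 0 * z)%C with (RtoC 0) in HK by ring.
  replace (RtoC 1 * z)%C with z in HK by ring. rewrite cexp_0 in HK.
  rewrite ext_fun_center in HK by assumption.
  transitivity (ext_fun 0 (cayley (cexp z)) + L 1 - L 1)%C; [ring|].
  rewrite <- HK. apply injective_projections; simpl; ring.
Qed.

Lemma disk_strip (z : C) :
  unit_disk z -> exists x, Rabs (snd x) < PI / 2 /\ cayley (cexp x) = z.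
Proof.
  intros Hz. destruct (cayley_surjective z Hz) as [w [Hw Ew]].
  destruct (cexp_right_half_plane w Hw) as [x [Hx Ex]]. exists x. now rewrite Ex.
Qed.

Lemma RtoC_cancel (k l : R) (x : C) : k * l = 1 -> (RtoC k * (RtoC l * x))%C = x.
Proof. intros H. rewrite Cmult_assoc, <- RtoC_mult, H. apply Cmult_1_l. Qed.

Lemma ext_fun_injective (al : R) : 0 <= al <= 1 -> injective_on_disk (ext_fun al).
Proof.
  intros Hal z w Hz Hw E.
  destruct (disk_strip z Hz) as [x [Hx <-]]. destruct (disk_strip w Hw) as [y [Hy <-]].
  enough (x = y) by now subst.
  destruct (Req_dec_T al 0) as [->|H0].
  - rewrite !ext_fun_log in E by assumption.
    rewrite <- (RtoC_cancel 2 (/ 2) x), E by lra. apply RtoC_cancel. lra.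
  - assert (Ee : cexp (RtoC al * x)%C = cexp (RtoC al * y)%C).
    { rewrite <- !ext_fun_power by assumption. now rewrite E. }
    assert (Hs : forall u : C, Rabs (snd u) < PI / 2 -> Rabs (snd (RtoC al * u)%C) < PI / 2).
    { intros u Hu. simpl. rewrite Rmult_0_l, Rplus_0_r, Rabs_mult, (Rabs_pos_eq al) by lra.
      pose proof (Rabs_pos (snd u)). nra. }
    apply cexp_injective in Ee; auto.
    rewrite <- (RtoC_cancel (/ al) al x), Ee by (field; lra).
    apply RtoC_cancel. field. lra.
Qed.

(* The sector [|arg w| < al * PI / 2] is an intersection of two half planes. *)
Definition sector (be : R) (w : C) : Prop :=
  0 < fst w * cos be - snd w * sin be /\ 0 < fst w * cos be + snd w * sin be.

(** For [w = exp x] the two linear forms of [sector be] are [|w| cos (Im x + be)] and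
    [|w| cos (Im x - be)], positive together exactly when [|Im x| < al * PI/2]. Their sum forces
    [Re w > 0], which supplies such an [x]. *)
Lemma cexp_sector (al : R) (w : C) :
  0 < al <= 1 ->
  (sector (PI / 2 - al * (PI / 2)) w <->
   exists z, Rabs (snd z) < PI / 2 /\ cexp (RtoC al * z)%C = w).
Proof.
  intros Hal. set (be := PI / 2 - al * (PI / 2)). pose proof PI_RGT_0 as HPI.
  assert (Hbe : 0 <= be < PI / 2) by (unfold be; nra).
  assert (Hcos : forall z : C, fst (cexp z) * cos be - snd (cexp z) * sin be =
      exp (fst z) * cos (snd z + be) /\
    fst (cexp z) * cos be + snd (cexp z) * sin be = exp (fst z) * cos (snd z - be)).
  { intros z. unfold cexp. simpl. rewrite cos_plus, cos_minus. split; ring. }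
  split.
  - intros [W1 W2].
    assert (Hc : 0 < cos be) by (apply cos_gt_0; lra).
    assert (Hw : 0 < fst w) by nra.
    destruct (cexp_right_half_plane w Hw) as [x [Hx Ex]].
    apply Rabs_lt_between in Hx. destruct (Hcos x) as [C1 C2]. rewrite Ex in C1, C2.
    rewrite C1 in W1. rewrite C2 in W2. pose proof (exp_pos (fst x)) as He.
    assert (X1 : snd x < al * (PI / 2)).
    { apply Rnot_le_lt. intros L. assert (cos (snd x + be) <= 0); [|nra].
      apply cos_le_0; unfold be in *; lra. }
    assert (X2 : - (al * (PI / 2)) < snd x).
    { apply Rnot_le_lt. intros L. assert (cos (snd x - be) <= 0); [|nra].
      rewrite <- cos_neg. apply cos_le_0; unfold be in *; lra. }
    exists (RtoC (/ al) * x)%C. split.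
    + simpl. rewrite Rmult_0_l, Rplus_0_r. apply Rabs_lt_between.
      split; apply Rmult_lt_reg_l with al; try lra; rewrite <- Rmult_assoc, Rinv_r by lra; lra.
    + rewrite RtoC_cancel; [exact Ex | field; lra].
  - intros [z [Hz <-]]. apply Rabs_lt_between in Hz.
    destruct (Hcos (RtoC al * z)%C) as [C1 C2]. unfold sector. rewrite C1, C2.
    assert (Es : snd (RtoC al * z)%C = al * snd z) by (simpl; ring). rewrite Es.
    split; apply Rmult_lt_0_compat; try apply exp_pos; apply cos_gt_0; unfold be; nra.
Qed.

Lemma ext_fun_range_power (al : R) (v : C) :
  0 < al <= 1 ->
  (disk_range (ext_fun al) v <->
   sector (PI / 2 - al * (PI / 2)) (1 + RtoC (2 * al) * v)%C).
Proof.
  intros Hal. rewrite cexp_sector by exact Hal. split.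
  - intros [z [Hz <-]]. destruct (disk_strip z Hz) as [x [Hx <-]].
    exists x. split; [exact Hx|]. now rewrite ext_fun_power by lra.
  - intros [x [Hx E]]. exists (cayley (cexp x)). split; [now apply cayley_disk, cexp_right|].
    rewrite <- ext_fun_power in E by lra.
    assert (Hn : RtoC (2 * al) <> 0) by (intros Q; apply RtoC_inj in Q; lra).
    set (F := ext_fun al (cayley (cexp x))) in *.
    replace F with ((1 + RtoC (2 * al) * F - 1) / RtoC (2 * al))%C by (field; exact Hn).
    rewrite E. field. exact Hn.
Qed.

Lemma ext_fun_range_log (v : C) : disk_range (ext_fun 0) v <-> Rabs (snd v) < PI / 4.
Proof.
  split.
  - intros [z [Hz <-]]. destruct (disk_strip z Hz) as [x [Hx <-]].
    rewrite ext_fun_log by exact Hx. simpl. apply Rabs_lt_between in Hx.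
    apply Rabs_lt_between. lra.
  - intros Hv. apply Rabs_lt_between in Hv.
    assert (Hx : Rabs (snd (RtoC 2 * v)%C) < PI / 2)
      by (apply Rabs_lt_between; simpl; lra).
    exists (cayley (cexp (RtoC 2 * v)%C)). split; [now apply cayley_disk, cexp_right|].
    rewrite ext_fun_log by exact Hx. apply RtoC_cancel. lra.
Qed.

(** The range, up to an affine change of variable for [al > 0], is cut out by two strict linear
    inequalities: a sector, or a horizontal strip when [al = 0]. [Conv] preserves each of them. *)
Lemma ext_fun_convex (al : R) : 0 <= al <= 1 -> convex_set (disk_range (ext_fun al)).
Proof.
  intros Hal u v t Hu Hv Ht.
  assert (Conv : forall p r, 0 < p -> 0 < r -> 0 < (1 - t) * p + t * r).
  { intros p r Hp Hr. destruct (Req_dec_T t 0) as [->|]; [lra|].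
    assert (0 < t * r) by (apply Rmult_lt_0_compat; lra).
    assert (0 <= (1 - t) * p) by (apply Rmult_le_pos; lra). lra. }
  destruct (Req_dec_T al 0) as [->|H0].
  - apply ext_fun_range_log in Hu. apply ext_fun_range_log in Hv. apply ext_fun_range_log.
    apply Rabs_lt_between in Hu. apply Rabs_lt_between in Hv. apply Rabs_lt_between.
    pose proof (Conv (PI / 4 - snd u) (PI / 4 - snd v) ltac:(lra) ltac:(lra)).
    pose proof (Conv (PI / 4 + snd u) (PI / 4 + snd v) ltac:(lra) ltac:(lra)).
    simpl. lra.
  - assert (Hal' : 0 < al <= 1) by lra.
    apply (ext_fun_range_power al u Hal') in Hu. apply (ext_fun_range_power al v Hal') in Hv.
    apply (ext_fun_range_power al _ Hal').
    set (be := PI / 2 - al * (PI / 2)) in *.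
    replace (1 + RtoC (2 * al) * (RtoC (1 - t) * u + RtoC t * v))%C
      with (RtoC (1 - t) * (1 + RtoC (2 * al) * u) + RtoC t * (1 + RtoC (2 * al) * v))%C
      by (rewrite RtoC_minus; ring).
    set (x := (1 + RtoC (2 * al) * u)%C) in *. set (y := (1 + RtoC (2 * al) * v)%C) in *.
    destruct Hu as [U1 U2], Hv as [V1 V2]. unfold sector in *.
    pose proof (Conv _ _ U1 V1) as W1. pose proof (Conv _ _ U2 V2) as W2.
    clearbody x y. simpl. split; lra.
Qed.

Lemma slope_ex_derive (f : C -> C) (z l : C) :
  has_slope 0 f z l -> @ex_derive C_AbsRing C_NormedModule f z.
Proof.
  intros [P [HP [HPz [d [Hd HE]]]]]. exists l. split.
  - apply is_linear_scal_l.
  - intros x Hx. apply (is_filter_lim_locally_unique (V := AbsRing_NormedModule C_AbsRing)) in Hx. subst x.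
    intros [e He]. destruct (HP e He) as [d2 [Hd2 HC]].
    assert (Hp : 0 < Rmin d d2) by now apply Rmin_pos.
    exists (mkposreal _ Hp). intros y Hy.
    change (Cmod (y - z) < Rmin d d2) in Hy.
    pose proof (Rmin_l d d2). pose proof (Rmin_r d d2).
    change (Cmod (f y - f z - (y - z) * l)%C <= e * Cmod (y - z)%C).
    rewrite (HE y) by lra.
    replace (f z + (y - z) * P y - f z - (y - z) * l)%C with ((P y - P z) * (y - z))%C
      by (rewrite HPz; ring).
    rewrite Cmod_mult. apply Rmult_le_compat_r; [apply Cmod_ge_0|].
    left. apply HC. lra.
Qed.

(** * Lower bound for the extremal coefficients *)

Lemma Rpower_bernoulli_le (x p : R) : 0 <= x -> 0 <= p <= 1 -> Rpower (1 + x) p <= 1 + p * x.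
Proof.
  intros Hx Hp. unfold Rpower. set (y := ln (1 + x)).
  assert (Ey : exp y = 1 + x) by (unfold y; apply exp_ln; lra).
  (* [1 + u <= exp u] at [u = (1 - p) y] and at [u = - p y] *)
  pose proof (exp_ineq1_le ((1 - p) * y)) as H1. pose proof (exp_ineq1_le (- (p * y))) as H2.
  pose proof (exp_pos (p * y)) as Hm.
  assert (E1 : exp (p * y) * exp ((1 - p) * y) = 1 + x)
    by (rewrite <- exp_plus, <- Ey; f_equal; ring).
  assert (E2 : exp (p * y) * exp (- (p * y)) = 1)
    by (rewrite <- exp_plus, Rplus_opp_r; apply exp_0).
  set (m := exp (p * y)) in *.
  apply Rmult_le_compat_l with (r := m) in H1; [|lra].
  apply Rmult_le_compat_l with (r := m) in H2; [|lra].
  rewrite E1 in H1. rewrite E2 in H2.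
  apply Rmult_le_compat_l with (r := p) in H1; [|lra].
  apply Rmult_le_compat_l with (r := 1 - p) in H2; [|lra]. lra.
Qed.

(** The recurrence reads [e_(n+2) = e_n + 2 al e_(n+1)/(n+1)], so two steps multiply [e_n + e_(n+1)]
    by at least [1 + 2 al/(n+2)], which dominates [((n+4)/(n+2))^al]. The start is
    [e_0 + e_1 = 1 >= 2^al / 2]. A sum of two neighbours is used because the recurrence has order
    two. *)
Lemma ext_coef_lower (al : R) (k : nat) :
  0 <= al <= 1 ->
  let e n := INR n * ext_coef al n in
  / 2 * Rpower (INR (2 * k) + 2) al <= e (2 * k)%nat + e (S (2 * k)).
Proof.
  intros Hal e.
  assert (He : forall n, 0 <= e n).
  { intros n. apply Rmult_le_pos; [apply pos_INR | apply ext_coef_bound, Hal]. }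
  assert (Hstep : forall n, e (S (S n)) = e n + 2 * al * (e (S n) / INR (S n))).
  { intros n. unfold e. rewrite !S_INR. pose proof (pos_INR n) as Hn.
    replace (INR n + 1 + 1) with (INR n + 2) by ring. rewrite ext_coef_step. field. lra. }
  induction k as [|k IH].
  - simpl (2 * 0)%nat. unfold e, ext_coef. simpl. rewrite Rplus_0_l.
    assert (Rpower 2 al <= Rpower 2 1) by (apply Rle_Rpower; lra).
    rewrite Rpower_1 in * by lra. lra.
  - replace (2 * S k)%nat with (S (S (2 * k))) by lia. set (n := (2 * k)%nat) in *.
    assert (Hn : 0 <= INR n) by apply pos_INR.
    rewrite (Hstep (S n)), (Hstep n). rewrite !S_INR.
    replace (INR n + 1 + 1) with (INR n + 2) by ring.
    replace (INR n + 2 + 2) with ((INR n + 2) * (1 + 2 / (INR n + 2))) by (field; lra).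
    assert (Hx : 0 < 2 / (INR n + 2)) by (apply Rdiv_lt_0_compat; lra).
    rewrite <- Rpower_mult_distr by lra.
    pose proof (Rpower_bernoulli_le (2 / (INR n + 2)) al ltac:(lra) Hal) as B.
    set (p := Rpower (INR n + 2) al) in *.
    assert (Hp : 0 < p) by apply exp_pos.
    pose proof (He n) as E0. pose proof (He (S n)) as E1.
    set (u := e n) in *. set (v := e (S n)) in *. set (x := INR n) in *.
    set (b := Rpower (1 + 2 / (x + 2)) al) in *.
    assert (Hb : 0 < b) by apply exp_pos.
    assert (I : v / (x + 2) <= v / (x + 1)).
    { apply Rmult_le_compat_l; [exact E1|]. apply Rinv_le_contravar; lra. }
    assert (I0 : 0 <= v / (x + 1)).
    { apply Rmult_le_pos; [exact E1 | left; apply Rinv_0_lt_compat; lra]. }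
    assert (J : u / (x + 2) <= (u + 2 * al * (v / (x + 1))) / (x + 2)).
    { apply Rmult_le_compat_r; [left; apply Rinv_0_lt_compat; lra|].
      assert (0 <= al * (v / (x + 1))) by (apply Rmult_le_pos; lra). lra. }
    apply Rle_trans with ((u + v) * (1 + al * (2 / (x + 2)))).
    + rewrite <- Rmult_assoc. apply Rmult_le_compat; lra || nra.
    + replace ((u + v) * (1 + al * (2 / (x + 2))))
        with (u + v + 2 * al * (u / (x + 2)) + 2 * al * (v / (x + 2))) by (field; lra).
      apply Rmult_le_compat_l with (r := 2 * al) in I; [|lra].
      apply Rmult_le_compat_l with (r := 2 * al) in J; [|lra]. lra.
Qed.

(** With the constant [1/8], two neighbouring terms together would be at most a quarter of
    [(n+2)^al], below the half guaranteed by [ext_coef_lower]. *)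
Lemma ext_coef_not_little_o (al : R) :
  0 <= al <= 1 -> ~ little_o (fun n => RtoC (ext_coef al n)) (npow (al - 1)).
Proof.
  intros Hal Ho. assert (H8 : 0 < / 8) by lra.
  destruct (Ho (mkposreal _ H8)) as [N HN].
  assert (B : forall n, (N <= n)%nat -> (1 <= n)%nat ->
     INR n * ext_coef al n <= / 8 * Rpower (INR n) al).
  { intros n Hn Hn1. specialize (HN n Hn).
    change (Cmod (RtoC (ext_coef al n)) <= / 8 * Rabs (npow (al - 1) n)) in HN.
    destruct (ext_coef_bound al n Hal) as [Hb _].
    unfold npow in HN. rewrite Cmod_R, Rabs_pos_eq, Rabs_pos_eq in HN;
      [|left; apply exp_pos | lra].
    assert (Hx : 1 <= INR n) by (apply (le_INR 1) in Hn1; exact Hn1).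
    replace al with (1 + (al - 1)) at 2 by ring. rewrite Rpower_plus, Rpower_1 by lra.
    apply Rmult_le_compat_l with (r := INR n) in HN; lra. }
  pose proof (ext_coef_lower al (S N) Hal) as L. cbv zeta in L.
  pose proof (B (2 * S N)%nat ltac:(lia) ltac:(lia)) as B1.
  pose proof (B (S (2 * S N)) ltac:(lia) ltac:(lia)) as B2.
  set (n := (2 * S N)%nat) in *.
  assert (Hx : 1 <= INR n) by (apply (le_INR 1); unfold n; lia).
  assert (M1 : Rpower (INR n) al <= Rpower (INR n + 2) al) by (apply Rle_Rpower_l; lra).
  assert (M2 : Rpower (INR (S n)) al <= Rpower (INR n + 2) al)
    by (rewrite S_INR; apply Rle_Rpower_l; lra).
  assert (0 < Rpower (INR n + 2) al) by apply exp_pos. lra.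
Qed.

Lemma ext_fun_class_C (al : R) :
  0 <= al <= 1 ->
  class_C (ext_fun al) /\ normalized_expansion (ext_fun al) (fun n => RtoC (ext_coef al n)).
Proof.
  intros Hal. pose proof (disk_series_ext al Hal) as Ha.
  assert (HN : normalized_expansion (ext_fun al) (fun n => RtoC (ext_coef al n))).
  { split; [reflexivity|]. split; [reflexivity|]. intros z Hz.
    apply series_to_is_pseries. now apply psum_spec. }
  split; [|exact HN]. split; [|now apply ext_fun_convex].
  split; [|split; [now apply ext_fun_injective | eexists; exact HN]].
  intros z Hz. eapply slope_ex_derive. now apply psum_slope.
Qed.

Theorem theorem2 :
  (forall (f : C -> C) (a : nat -> C),
     class_C f -> normalized_expansion f a ->
     big_O a (npow (Cmod (a 2%nat) - 1)) /\
     (forall n : nat, (2 <= n)%nat ->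
        Cmod (a n) <= exp ((Cmod (a 2%nat) ^ 2 - 1) / 2)))
  /\
  (forall alpha : R, 0 <= alpha <= 1 ->
     exists (f : C -> C) (a : nat -> C),
       class_C f /\ normalized_expansion f a /\
       Cmod (a 2%nat) = alpha /\
       ~ little_o a (npow (alpha - 1))).
Proof.
  split.
  - intros f a Hf Hn. destruct (class_C_psum f a Hf Hn) as [Ha [Hinj Hconv]].
    destruct Hn as [H0 [H1 _]]. split.
    + destruct (convex_coef_growth a Ha H0 H1 Hinj Hconv) as [M HM].
      exists M, 2%nat. intros n Hn. unfold npow.
      rewrite Rabs_pos_eq by (left; apply exp_pos). now apply HM.
    + intros n Hn. now apply convex_coef_bound.
  - intros al Hal. destruct (ext_fun_class_C al Hal) as [HC HN].
    exists (ext_fun al), (fun n => RtoC (ext_coef al n)).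
    split; [exact HC|]. split; [exact HN|]. split; [|now apply ext_coef_not_little_o].
    replace (ext_coef al 2) with al by (unfold ext_coef; simpl; field).
    rewrite Cmod_R. apply Rabs_pos_eq. lra.
Qed.
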